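(* Let $X=(x_1,\dots,x_N)$ and $Y=(y_1,\dots,y_N)$ be in $\tilde{\mathcal{X}}_N(L)$ and $t\ge0$. The transition probability of the $q$-TAZRP on the ring is $$\mathbb{P}_Y(X;t)=\frac{u_Y(X;t)}{W(X)},\qquad u_Y(X;t)=\sum_{\mathbb{L}\in\mathbb{Z}^N(0)}u_Y^{\mathbb{L}}(X;t),\qquad u_Y^{\mathbb{L}}(X;t)=\sum_{\sigma\in S_N}\Lambda_Y^{\mathbb{L}}(X;t;\sigma),$$ where only finitely many terms in the sum over $\mathbb{L}$ are nonzero.
   Context: Process. Fix integers $N,L\ge1$, $q\in(0,1)$, and conductances $a_{[i]}>0$ for $[i]\in\mathbb{Z}/L\mathbb{Z}$; put $b_{[i]}=(1-q)a_{[i]}$, where $[i]$ denotes the class of $i\in\mathbb{Z}$ modulo $L$. Let $$\tilde{\mathcal{X}}_N(L)=\{(x_1,\dots,x_N)\in\mathbb{Z}^N: x_N+L\ge x_1\ge x_2\ge\dots\ge x_N\}.$$ For $X\in\tilde{\mathcal{X}}_N(L)$ let $n_{[i]}(X)$ be the number of particles $x_j$ in the class $i+L\mathbb{Z}$. Particles in the same class form a stack, ordered vertically so that $x_j$ is above $x_{j+1}$ if they are in the same stack with $x_j=x_{j+1}$ ($1\le j\le N-1$), and $x_N$ is above $x_1$ if $x_1=x_N+L$. Thus a stack consists of particles $j+1,\dots,j+k$ (with $j+k\le N$) at the same position, with $j+1$ on top, or of particles $j+1,\dots,N$ at position $x$ and $1,\dots,j+k-N$ at position $x+L$, with $j+1$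 on top. The $q$-TAZRP on the ring (lifted to $\mathbb{Z}$) is the continuous-time Markov chain on $\tilde{\mathcal{X}}_N(L)$ in which, for each occupied class $[i]$, the top particle of the stack there jumps one step to the right ($x_j\mapsto x_j+1$, becoming the bottom particle of its new stack) at rate $a_{[i]}(1-q^{n_{[i]}(X)})$; the other particles of the stack do not move. $\mathbb{P}_Y(X;t)$ is the probability of being in state $X$ at time $t$ when started from $Y$ at time $0$. Formula. $W(X)=\prod_{i=1}^L[n_{[i]}(X)]_q!$ with $[k]_q!=\prod_{i=1}^k\frac{1-q^i}{1-q}$. $\mathbb{Z}^N(k)$ is the set of $\mathbb{L}=(\ell_1,\dots,\ell_N)\in\mathbb{Z}^N$ with $\sum\ell_i=k$. For $\sigma\in S_N$, $$A_\sigma(w_1,\dots,w_N)=\operatorname{sgn}(\sigma)\prod_{1\le i<j\le N}\frac{qw_{\sigma(i)}-w_{\sigma(j)}}{qw_i-w_j},$$ $$D_{\mathbb{L}}(w_1,\dots,w_N)=\prod_{j=1}^N\Big(\prod_{i=1}^L(b_{[i]}-w_j)\prod_{k=1}^N\frac{qw_k-w_j}{qw_j-w_k}\Big)^{\ell_j},$$ $$\Lambda_Y^{\mathbb{L}}(X;t;\sigma)=\Big(\prod_{k=1}^N\frac{-1}{b_{[x_k]}}\Big)\frac1{(2\pi i)^N}\oint_Cdw_1\cdots\oint_Cdw_N\,A_\sigma\prod_{j=1}^N\Big[\Big(\prod_{k=y_{\sigma(j)}}^{\prime\,x_j}\frac{b_{[k]}}{b_{[k]}-w_{\sigma(j)}}\Big)e^{-w_jt}\Big]D_{\mathbb{L}}(w_1,\dots,w_N),$$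 where $C=\{|z|=R\}$ is a counterclockwise circle with $R>b_{[i]}$ for all $i$, and $\prod_{k=m}^{\prime\,n}f(k)$ equals $\prod_{k=m}^nf(k)$ if $n\ge m$, equals $1$ if $n=m-1$, and equals $\prod_{k=n+1}^{m-1}f(k)^{-1}$ if $n<m-1$. *)

(* Defs.v *)
From HB Require Import structures.
From mathcomp Require Import all_boot all_order all_algebra all_fingroup.
From mathcomp Require Import all_classical all_reals all_analysis.
From mathcomp Require Import complex.

Set Implicit Arguments.
Unset Strict Implicit.
Unset Printing Implicit Defensive.

Import Order.TTheory GRing.Theory Num.Theory.
Import numFieldNormedType.Exports.

Local Open Scope classical_set_scope.
Local Open Scope ring_scope.
Local Open Scope complex_scope.

Section MarkovChain.
Context {R : realType} {T : countType}.

(* An honest transition function: p t x y is the probability of moving from x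
   to y in time t; only times t >= 0 are constrained. *)
Definition transition_function (p : R -> T -> T -> R) : Prop :=
  [/\ forall t x y, 0 <= t -> 0 <= p t x y,
      forall t x, 0 <= t -> \esum_(y in [set: T]) (p t x y)%:E = 1%:E,
      forall x y, p 0 x y = (x == y)%:R &
      forall s t x z, 0 <= s -> 0 <= t ->
        (p (s + t) x z)%:E = \esum_(y in [set: T]) (p s x y * p t y z)%:E].

(* The jump rates are the derivatives of p at time 0; the total rate out of x
   is the sum of rate x y over y != x. *)
Definition has_jump_rates (rate : T -> T -> R) (p : R -> T -> T -> R) : Prop :=
  forall x,
    (forall y, y != x -> p h x y / h @[h --> 0^'+] --> rate x y) /\
    ((1 - p h x x) / h)%:E @[h --> 0^'+]
      --> \esum_(y in [set y | y != x]) (rate x y)%:E.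

(* The Markov property is expressed by the finite-dimensional distributions;
   xi is only constrained at times >= 0. *)
Definition is_markov_chain (rate : T -> T -> R) (y0 : T)
    {d : measure_display} {Omega : measurableType d} (P : probability Omega R)
    (xi : R -> Omega -> T) : Prop :=
  (forall t x, 0 <= t -> measurable [set o | xi t o = x]) /\
  exists p : R -> T -> T -> R,
    [/\ transition_function p, has_jump_rates rate p &
      forall (m : nat) (s : nat -> R) (z : nat -> T),
        s 0%N = 0 -> (forall k, s k <= s k.+1) ->
        P [set o | forall k, (k <= m)%N -> xi (s k) o = z k] =
        ((z 0%N == y0)%:R *
         \prod_(k < m) p (s k.+1 - s k) (z k) (z k.+1))%:E].

End MarkovChain.

(* Particles are numbered from 0: the i-th coordinate x i, for i : 'I_N, is the
   position of particle i + 1.  For N > 0 the constraints are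
   x_1 >= ... >= x_N and x_N + L >= x_1. *)
Definition ring_config (N L : nat) (x : {ffun 'I_N -> int}) : bool :=
  [forall i : 'I_N, forall j : 'I_N, (i.+1 == j)%N ==> (x j <= x i)] &&
  [forall i : 'I_N, forall j : 'I_N,
     ((i == 0%N :> nat) && (j.+1 == N)) ==> (x i <= x j + L%:Z)].

Definition ring_state (N L : nat) := {x : {ffun 'I_N -> int} | ring_config L x}.

Section TAZRP.
Context {R : realType} (N L : nat).
(* Functions on Z/LZ, such as the conductances a, are represented by
   L-periodic functions on Z. *)
Variables (q : R) (a : int -> R).
Implicit Types (x : {ffun 'I_N -> int}) (i j : 'I_N).

Definition conductance_b (k : int) : R := (1 - q) * a k.

Definition occupation x (k : int) : nat := #|[pred j | (x j == k %[mod L])%Z]|.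

(* Particle i lies immediately above particle j in a stack. *)
Definition directly_above x i j : bool :=
  ((i.+1 == j)%N && (x i == x j)) ||
  [&& i.+1 == N, j == 0%N :> nat & x j == x i + L%:Z].

Definition is_top x j : bool := [forall i, ~~ directly_above x i j].

Definition jump x j : {ffun 'I_N -> int} := [ffun k => x k + (k == j)%:Z].

(* Top particles correspond bijectively to occupied classes. *)
Definition tazrp_rate (X Y : ring_state N L) : R :=
  \sum_(j | is_top (val X) j && (val Y == jump (val X) j))
    a (val X j) * (1 - q ^+ occupation (val X) (val X j)).

Definition q_factorial (k : nat) : R :=
  \prod_(1 <= i < k.+1) ((1 - q ^+ i) / (1 - q)).

Definition weight x : R :=
  \prod_(1 <= i < L.+1) q_factorial (occupation x i%:Z).

End TAZRP.

Section Contour.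
Context {R : realType}.

Definition imag_unit : R[i] := 0 +i* 1.

Definition cexp (z : R[i]) : R[i] :=
  (expR (complex.Re z))%:C * (cos (complex.Im z) +i* sin (complex.Im z)).

(* Integral over [0, 2 pi] of a complex-valued function. *)
Definition angular_integral (f : R -> R[i]) : R[i] :=
  (\int[lebesgue_measure]_(th in `[0, 2 * pi]) complex.Re (f th)) +i*
  (\int[lebesgue_measure]_(th in `[0, 2 * pi]) complex.Im (f th)).

Definition circle_point (r th : R) : R[i] := r%:C * (cos th +i* sin th).

(* Integral of f along |z| = r, counterclockwise, with the parametrization
   z = r e^(i th), dz = i z dth. *)
Definition contour_integral (r : R) (f : R[i] -> R[i]) : R[i] :=
  angular_integral (fun th =>
    f (circle_point r th) * (imag_unit * circle_point r th)).

(* w_1 is the variable of the outermost integral. *)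
Fixpoint iterated_contour_integral (r : R) (n : nat) :
    (('I_n -> R[i]) -> R[i]) -> R[i] :=
  match n with
  | 0 => fun F => F (fun=> 0)
  | n'.+1 => fun F => contour_integral r (fun z =>
      iterated_contour_integral r (fun w : 'I_n' -> R[i] =>
        F (fun k => if unlift ord0 k is Some k' then w k' else z)))
  end.

End Contour.

(* The product of f k over m <= k <= n, extended to all integers m, n so that
   the product over [m, n] times the product over [n + 1, p] is the product
   over [m, p]. *)
Definition prod_ext {F : fieldType} (m n : int) (f : int -> F) : F :=
  if m <= n then \prod_(k < absz (n - m + 1)%R) f (m + k%:Z)
  else if n == m - 1 then 1
  else \prod_(k < absz (m - 1 - n)%R) (f (n + 1 + k%:Z))^-1.

Definition int_vectors (N : nat) (k : int) : set {ffun 'I_N -> int} :=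
  [set l | \sum_j l j = k].
Arguments int_vectors : clear implicits.

Section Formula.
Context {R : realType} (N L : nat).
Variables (q : R) (a : int -> R) (r : R).
Implicit Types (w : 'I_N -> R[i]) (s : 'S_N) (l : {ffun 'I_N -> int}).

Local Notation b k := (conductance_b q a k)%:C.

Definition A_coef s w : R[i] :=
  (-1) ^+ s *
  \prod_(i < N) \prod_(j < N | (i < j)%N)
    ((q%:C * w (s i) - w (s j)) / (q%:C * w i - w j)).

Definition D_coef l w : R[i] :=
  \prod_(j < N)
    ((\prod_(1 <= i < L.+1) (b i%:Z - w j)) *
     \prod_(k < N) ((q%:C * w k - w j) / (q%:C * w j - w k))) ^ (l j).

Definition Lambda (Y X : {ffun 'I_N -> int}) (t : R) l s : R[i] :=
  (\prod_(k < N) (- 1 / b (X k))) *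
  (1 / (2 * pi%:C * imag_unit) ^+ N) *
  iterated_contour_integral r (fun w : 'I_N -> R[i] =>
    A_coef s w *
    (\prod_(j < N)
       (prod_ext (Y (s j)) (X j) (fun k => b k / (b k - w (s j))) *
        cexp (- w (s j) * t%:C))) *
    D_coef l w).

End Formula.

Definition u_term {R : realType} {N : nat} (L : nat) (q : R) (a : int -> R)
    (r : R) (Y X : {ffun 'I_N -> int}) (t : R) (l : {ffun 'I_N -> int}) : R[i] :=
  \sum_(s : 'S_N) Lambda L q a r Y X t l s.

(* The \in-indexed sum is the sum over the finite support of u_term; it is 0 by
   convention if that support is infinite. *)
Definition u_total {R : realType} {N : nat} (L : nat) (q : R) (a : int -> R)
    (r : R) (Y X : {ffun 'I_N -> int}) (t : R) : R[i] :=
  \sum_(l \in int_vectors N 0) u_term L q a r Y X t l.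

(* Main.v *)
Require Import Defs.
From HB Require Import structures.
From mathcomp Require Import all_boot all_order all_algebra all_fingroup.
From mathcomp Require Import all_classical all_reals all_analysis.
From mathcomp Require Import complex ring lra zify.

(** The contour formula, divided by the weight, solves the forward equation of the
chain with initial value the point mass at Y.  It is compared with the transition
function through the backward equation, which follows from the jump rates at
time 0.

Integrals.  On the torus |w_1| = ... = |w_N| = r every function that occurs is a
uniform limit of Laurent polynomials.  The predicate [degle r v m F] says that
the monomials w^alpha can be taken with <v, alpha> <= m.  Only the monomial with
all exponents -1 has a nonzero integral, so F integrates to 0 as soon as
m < - (v_1 + ... + v_N) ([iter_vanish]).  Choosing v plays the part of moving the
contours to 0 or to infinity, at rates prescribed by v; the factors 1 / (q w_i - w_j) and
1 / (b - w_j) are handled by geometric series ([degle_geom]).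

Normal form ([integrandE]).  For the term of the permutation s and of the vector
l put x'_j = x_(s^-1 j) - L l_j ([apos]) and e_ij = l_i - l_j + [s^-1 j < s^-1 i]
([ainv]).  Up to a sign, the integrand is the product over i < j of the e_ij-th
powers of (q w_j - w_i) / (q w_i - w_j) and of the site products from y_j to x'_j
in the variable w_j.  If a term is nonzero then y_j <= x'_j for all j
([dominance]).  Hence only finitely many l contribute, and u_Y(X; t) vanishes
unless x_1 + ... + x_N >= y_1 + ... + y_N.

Forward equation ([u_deriv_forward]).  The time derivative inserts the factor
- (w_1 + ... + w_N).  When the particle i lies on j, replacing s by its
composite with the transposition of i and j (and shifting l accordingly when the pair
straddles the end of the ring) shows that the sums with w_(s i) and with q w_(s j)
inserted agree ([total_exchange]).  A stack of n particles therefore contributes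
[n]_q times its bottom particle ([stack_sum]), and inserting w at a bottom
particle amounts to moving this particle one step back ([bottom_term]).

Initial value ([uval_initial], [uval_initial_other]).  At t = 0 a total degree
argument turns y_j <= x'_j into equality, which forces X = Y and leaves one l for
each permutation preserving the classes of the particles modulo L.  The value of
each remaining integral is read off from leading terms ([coef_initial_value]), and
their sum is the product of q-factorials W(Y) ([config_stab_sum]).

Comparison ([transition_candidate]).  Let v be the quotient of the formula by the
weight.  The sum of v_Z(s) p_(t - s)(Z, X) over the finite set of states Z
whose coordinate sum lies between those of X and Y does not depend on s ([duality]);
its values at s = t and at s = 0 are v_X(t) and p_t(Y, X). *)

Set Implicit Arguments.
Unset Strict Implicit.
Unset Printing Implicit Defensive.

Import Order.TTheory GRing.Theory Num.Theory.
Import numFieldNormedType.Exports.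

Local Open Scope classical_set_scope.
Local Open Scope ring_scope.
Local Open Scope complex_scope.

(** * Fourier modes on the circle *)

Section Circle.
Context {R : realType}.
Implicit Types (a b r th : R) (k : int) (f g : R -> R[i]).

Definition cis th : R[i] := cos th +i* sin th.

Lemma cisD a b : cis (a + b) = cis a * cis b.
Proof. by rewrite /cis cosD sinD; simpc; congr (_ +i* _); rewrite addrC [X in X + _]mulrC. Qed.

Lemma cis0 : cis 0 = 1.
Proof. by rewrite /cis cos0 sin0. Qed.

Lemma norm_cis a : `|cis a| = 1.
Proof. by rewrite normc_def /= cos2Dsin2 sqrtr1. Qed.

Lemma cis_neq0 a : cis a != 0.
Proof. by rewrite -normr_eq0 norm_cis oner_eq0. Qed.

Lemma cisX a n : cis a ^+ n = cis (n%:R * a).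
Proof.
elim: n => [|n IHn]; first by rewrite expr0 mul0r cis0.
by rewrite exprS IHn -cisD -addn1 natrD mulrDl mul1r addrC.
Qed.

Lemma cisXz a k : cis a ^ k = cis (k%:~R * a).
Proof.
case: k => n; first by rewrite -exprnP cisX.
rewrite NegzE -exprnN cisX; apply: (mulfI (cis_neq0 (n.+1%:R * a))).
by rewrite divff ?cis_neq0// -cisD mulrNz mulNr subrr cis0.
Qed.

Lemma norm_circle_point r th : 0 <= r -> `|circle_point r th| = r%:C.
Proof. by move=> r0; rewrite normrM norm_cis mulr1 ger0_norm ?ler0c. Qed.

Lemma normc_le_ReIm (z : R[i]) (e : R) : `|z| <= e%:C -> `|complex.Re z| <= e /\ `|complex.Im z| <= e.
Proof.
move=> ze; split; rewrite -lecR; apply: le_trans ze; first exact: normc_ge_Re.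
have := normc_ge_Re (z * 'i%C); rewrite ReiNIm normrN normrM.
by rewrite [`|'i%C|]normc_def /= expr0n /= expr1n add0r sqrtr1 mulr1.
Qed.

Lemma normc_le_sum (z : R[i]) : `|z| <= (`|complex.Re z| + `|complex.Im z|)%:C.
Proof.
rewrite rmorphD /= {1}[z]complexE (le_trans (ler_normD _ _))// normrM.
rewrite [`|'i%C|]normc_def /= expr0n /= expr1n add0r sqrtr1 mul1r.
by rewrite !normc_def /= !expr0n /= !addr0 !sqrtr_sqr.
Qed.

(** Componentwise continuity in the angle, the form in which the real integration lemmas
apply to the two components of [angular_integral]. *)
Definition ccont f := continuous (fun x => complex.Re (f x)) /\ continuous (fun x => complex.Im (f x)).

Lemma continuous_unif_limit (f : R -> R) :
  (forall e, 0 < e -> exists2 g : R -> R, continuous g & forall x, `|f x - g x| <= e) ->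
  continuous f.
Proof.
move=> H x; apply/cvgrPdist_le => e e0.
have [|g cg fg] := H (e / 3%:R); first by rewrite divr_gt0.
have /cvgrPdist_le/(_ (e / 3%:R)) := cg x.
have e3 : 0 < e / 3%:R by rewrite divr_gt0.
move=> /(_ e3) ge; near=> y.
have gxy : `|g x - g y| <= e / 3%:R by near: y.
have := fg x; have := fg y.
move: gxy; rewrite !ler_norml; set d := e / 3%:R.
have -> : e = 3%:R * d by rewrite /d mulrC divfK.
by move=> /andP[? ?] /andP[? ?] /andP[? ?]; apply/andP; split; lra.
Unshelve. all: end_near. Qed.

Lemma ccont_unif_limit f :
  (forall e, 0 < e -> exists2 g, ccont g & forall x, `|f x - g x| <= e%:C) -> ccont f.
Proof.
move=> H; split; apply: continuous_unif_limit => e e0; have [g [g1 g2] fg] := H e e0.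
  exists (fun x => complex.Re (g x)) => // x.
  by have [+ _] := normc_le_ReIm (fg x); rewrite raddfB.
exists (fun x => complex.Im (g x)) => // x.
by have [_ +] := normc_le_ReIm (fg x); rewrite raddfB.
Qed.

Lemma eq_continuous (f g : R -> R) : f =1 g -> continuous f -> continuous g.
Proof. by move=> /funext ->. Qed.

Lemma ccontD f g : ccont f -> ccont g -> ccont (fun x => f x + g x).
Proof.
move=> [f1 f2] [g1 g2]; split.
  apply: (@eq_continuous (fun x => complex.Re (f x) + complex.Re (g x))) => [x|x].
    by rewrite raddfD.
  by apply: continuousD; [exact: f1|exact: g1].
apply: (@eq_continuous (fun x => complex.Im (f x) + complex.Im (g x))) => [x|x].
  by rewrite raddfD.
by apply: continuousD; [exact: f2|exact: g2].
Qed.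

Lemma ReM (x y : R[i]) : complex.Re (x * y) = complex.Re x * complex.Re y - complex.Im x * complex.Im y.
Proof. by case: x y => [? ?] [? ?]. Qed.
Lemma ImM (x y : R[i]) : complex.Im (x * y) = complex.Re x * complex.Im y + complex.Im x * complex.Re y.
Proof. by case: x y => [? ?] [? ?]. Qed.

Lemma ccont_cisZ (c : R[i]) k : ccont (fun th => c * cis (k%:~R * th)).
Proof.
have cc : continuous (fun th : R => cos (k%:~R * th)).
  by move=> x; apply: continuous_comp; [exact: mulrl_continuous|exact: continuous_cos].
have cs : continuous (fun th : R => sin (k%:~R * th)).
  by move=> x; apply: continuous_comp; [exact: mulrl_continuous|exact: continuous_sin].
split.
  apply: (@eq_continuous (fun th => complex.Re c * cos (k%:~R * th) - complex.Im c * sin (k%:~R * th))) => [x|x].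
    by rewrite ReM.
  by apply: cvgB; apply: cvgM => //; [exact: cvg_cst|exact: cc|exact: cvg_cst|exact: cs].
apply: (@eq_continuous (fun th => complex.Re c * sin (k%:~R * th) + complex.Im c * cos (k%:~R * th))) => [x|x].
  by rewrite ImM.
by apply: cvgD; apply: cvgM => //; [exact: cvg_cst|exact: cs|exact: cvg_cst|exact: cc].
Qed.

Lemma cis_period k : cis (k%:~R * (2%:R * pi)) = 1.
Proof.
have c1 : cis (2%:R * pi : R) = 1.
  by rewrite /cis mulr_natl cos2pi sin2pi.
by rewrite -cisXz c1 exp1rz.
Qed.

Let four_split (x y : R) : 2%:R * x * y + 2%:R * x * y = 4%:R * x * y.
Proof. ring. Qed.

Let trig_field (K u v c s : R) : K != 0 ->
  K^-1 * (u * (c * (K * 1)) - v * (- s * (K * 1))) = u * c + v * s.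
Proof. by move=> K0; field. Qed.

Let mu := @lebesgue_measure R.
Let D : set (measurableTypeR R) := `[0, 2 * pi]%classic.

Lemma cont_integrable (f : R -> R) : continuous f -> mu.-integrable D (EFin \o f).
Proof.
move=> cf; apply: continuous_compact_integrable; first exact: segment_compact.
exact: continuous_subspaceT.
Qed.

Lemma angular_integralD f g : ccont f -> ccont g ->
  angular_integral (fun x => f x + g x) = angular_integral f + angular_integral g.
Proof.
move=> [f1 f2] [g1 g2]; rewrite /angular_integral; simpc; congr (_ +i* _).
  rewrite -RintegralD//; [|exact: cont_integrable|exact: cont_integrable].
  by apply: eq_Rintegral => x _; rewrite raddfD.
rewrite -RintegralD//; [|exact: cont_integrable|exact: cont_integrable].
by apply: eq_Rintegral => x _; rewrite raddfD.
Qed.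

(** The constant is 4 pi rather than the optimal 2 pi because the real and the imaginary
part are estimated separately. *)
Lemma angular_integral_bound f (e : R) : ccont f -> (forall x, `|f x| <= e%:C) ->
  `|angular_integral f| <= (4%:R * pi * e)%:C.
Proof.
have b (h : R -> R) : continuous h -> (forall x, `|h x| <= e) ->
    `|\int[mu]_(x in D) h x| <= 2 * pi * e.
  move=> ch he; have ih := cont_integrable ch.
  have mD : measurable D by exact: measurable_itv.
  apply: (le_trans (le_normr_Rintegral mD ih)).
  apply: (@le_trans _ _ (\int[mu]_(x in D) cst e x)).
    apply: le_Rintegral => //.
    - apply: cont_integrable => x; apply: continuous_comp; [exact: ch|exact: norm_continuous].
    - by apply: cont_integrable; exact: cst_continuous.
  rewrite Rintegral_cst//= lebesgue_measure_itv/= lte_fin mulr_gt0 ?pi_gt0//= subr0.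
  by rewrite mulrC.
move=> [f1 f2] fe; apply: le_trans (normc_le_sum _) _; rewrite lecR /=.
have B1 := b _ f1 (fun x => (normc_le_ReIm (fe x)).1).
have B2 := b _ f2 (fun x => (normc_le_ReIm (fe x)).2).
apply: le_trans (lerD B1 B2) _.
by rewrite four_split.
Qed.

Lemma eq_angular_integral f g : f =1 g -> angular_integral f = angular_integral g.
Proof. by move=> /funext ->. Qed.

(** Orthogonality of the Fourier modes: for k <> 0 the mode has a 2 pi-periodic
primitive. *)
Lemma angular_integral_cis (c : R[i]) k :
  angular_integral (fun th => c * cis (k%:~R * th)) = if k == 0 then 2%:R * pi%:C * c else 0.
Proof.
have pi2 : 0 < 2 * pi :> R by rewrite mulr_gt0 ?pi_gt0.
have Rcst (x : R) : \int[mu]_(y in D) x = 2 * pi * x.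
  have mD : measurable D by exact: measurable_itv.
  rewrite Rintegral_cst//=.
  by rewrite /D /mu lebesgue_measure_itv/= lte_fin pi2 /= subr0 mulrC.
case: eqVneq => [->|k0].
  rewrite (@eq_angular_integral _ (fun=> c)); last by move=> x; rewrite mul0r cis0 mulr1.
  rewrite /angular_integral !Rcst.
  have -> : 2%:R * pi%:C = (2%:R * pi)%:C :> R[i] by rewrite rmorphM rmorph_nat.
  by case: c => x y; simpc.
have kR0 : k%:~R != 0 :> R by rewrite intr_eq0.
have F (u v : R) : \int[mu]_(x in D) (u * cos (k%:~R * x) + v * sin (k%:~R * x)) = 0.
  pose G x : R := k%:~R^-1 * (u * sin (k%:~R * x) - v * cos (k%:~R * x)).
  have dG (x : R) : is_derive x (1 : R) G (u * cos (k%:~R * x) + v * sin (k%:~R * x)).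
    apply: is_derive_eq.
    exact: trig_field.
  have Gc : continuous G.
    by move=> x; apply: differentiable_continuous; apply/derivable1_diffP; exact: ex_derive.
  have h1 : {within `[0, 2 * pi], continuous (fun x => u * cos (k%:~R * x) + v * sin (k%:~R * x))}.
    apply: continuous_subspaceT.
    apply: (@eq_continuous (fun x => complex.Re ((u -i* v) * cis (k%:~R * x)))) => [x|].
      by rewrite ReM /= mulNr opprK.
    by have [] := ccont_cisZ (u -i* v) k.
  have h2 : derivable_oo_LRcontinuous G 0 (2 * pi).
    split; first by move=> x _; exact: ex_derive.
      by apply: cvg_at_right_filter; exact: Gc.
    by apply: cvg_at_left_filter; exact: Gc.
  have h3 : {in `]0, 2 * pi[, derive1 G =1 (fun x => u * cos (k%:~R * x) + v * sin (k%:~R * x))}.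
    by move=> x _; rewrite derive1E; exact: derive_val.
  have GE := continuous_FTC2 pi2 h1 h2 h3.
  rewrite /Rintegral GE -EFinB /= /G !mulr0 sin0 cos0.
  have c1 : cos (k%:~R * (2 * pi)) = 1 :> R by have := cis_period k; rewrite /cis => -[].
  have s1 : sin (k%:~R * (2 * pi)) = 0 :> R by have := cis_period k; rewrite /cis => -[].
  by rewrite c1 s1 mulr0 subrr.
rewrite /angular_integral; apply/eqP; rewrite eq_complex /=; apply/andP; split; apply/eqP.
  rewrite -[RHS](F (complex.Re c) (- complex.Im c)).
  by apply: eq_Rintegral => x _; rewrite ReM /= mulNr.
rewrite -[RHS](F (complex.Im c) (complex.Re c)).
by apply: eq_Rintegral => x _; rewrite ImM /= addrC.
Qed.
End Circle.

(** * Contour integrals of Laurent polynomials *)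

Section Laurent.
Context {R : realType}.
Variables (r : R).
Hypothesis r0 : 0 < r.
Local Notation C := R[i].
Implicit Types (g : C -> C) (z : C) (k : int) (ls : seq (C * int)).

(** A Laurent polynomial, encoded by its list of (coefficient, exponent) pairs;
exponents may be repeated. *)
Definition laurent1 ls z : C := \sum_(p <- ls) p.1 * z ^ p.2.
Definition laurent1_integral ls : C := \sum_(p <- ls) p.1 *+ (p.2 == -1) * (2%:R * pi%:C * imag_unit).
(** Uniform limits of Laurent polynomials on the circle |z| = r. They are continuous
there, hence integrable over the angle. *)
Definition approx1 g := forall e : R, 0 < e -> exists ls, forall z, `|z| = r%:C -> `|g z - laurent1 ls z| <= e%:C.

Let h g th := g (circle_point r th) * (imag_unit * circle_point r th).

Let rC0 : r%:C != 0 :> C. Proof. by rewrite fmorph_eq0 gt_eqF. Qed.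

Let integrand_laurent1 ls th : h (laurent1 ls) th = \sum_(p <- ls) (p.1 * r%:C ^ (p.2 + 1) * imag_unit) * cis ((p.2 + 1)%:~R * th).
Proof.
rewrite /h /laurent1 mulr_suml; apply: eq_bigr => -[c k] _ /=.
rewrite /circle_point -/(cis th) -cisXz !expfzDr ?cis_neq0 ?rC0// !expr1z.
rewrite exprzMl ?unitfE ?cis_neq0//.
move: (r%:C ^ k) (r%:C) (cis th ^ k) (cis th) imag_unit => x y z u i; ring.
Qed.

Lemma ccont_sum (I : Type) (s : seq I) (f : I -> R -> C) :
  (forall i, ccont (f i)) -> ccont (fun th => \sum_(i <- s) f i th).
Proof.
move=> fc; elim: s => [|i s IH].
  have -> : (fun th => \sum_(i <- [::]) f i th) = fun=> 0 by apply/funext => th; rewrite big_nil.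
  by split; exact: cst_continuous.
have -> : (fun th => \sum_(j <- i :: s) f j th) = fun th => f i th + \sum_(j <- s) f j th.
  by apply/funext => th; rewrite big_cons.
exact: ccontD.
Qed.

Lemma angular_integral_sum (I : Type) (s : seq I) (f : I -> R -> C) :
  (forall i, ccont (f i)) ->
  angular_integral (fun th => \sum_(i <- s) f i th) = \sum_(i <- s) angular_integral (f i).
Proof.
move=> fc; elim: s => [|i s IH].
  rewrite big_nil -[RHS](_ : angular_integral (fun th => 0 * cis (0%:~R * th)) = 0).
    by apply: eq_angular_integral => x; rewrite big_nil mul0r.
  by rewrite angular_integral_cis eqxx mulr0.
rewrite big_cons -IH -angular_integralD//; last exact: ccont_sum.
by apply: eq_angular_integral => x; rewrite big_cons.
Qed.

Let ccont_integrand ls : ccont (h (laurent1 ls)).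
Proof.
rewrite (_ : h _ = fun th => \sum_(p <- ls) (p.1 * r%:C ^ (p.2 + 1) * imag_unit) * cis ((p.2 + 1)%:~R * th)).
  by apply: ccont_sum => p; exact: ccont_cisZ.
by apply/funext => th; exact: integrand_laurent1.
Qed.

Let angular_integral_laurent1 ls : angular_integral (h (laurent1 ls)) = laurent1_integral ls.
Proof.
rewrite (eq_angular_integral (integrand_laurent1 ls)) angular_integral_sum; last by move=> p; exact: ccont_cisZ.
apply: eq_bigr => -[c k] _ /=; rewrite angular_integral_cis addr_eq0.
case: eqVneq => [->|_]; last by rewrite mulr0n mul0r.
rewrite mulr1n subrr expr0z mulr1; move: imag_unit => i; ring.
Qed.

Let h_dist g ls e th : (forall z, `|z| = r%:C -> `|g z - laurent1 ls z| <= e%:C) ->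
  `|h g th - h (laurent1 ls) th| <= (e * r)%:C.
Proof.
move=> ge; rewrite /h -mulrBl normrM normrM norm_circle_point ?(ltW r0)//.
rewrite [`|imag_unit|]normc_def /= expr0n /= expr1n add0r sqrtr1 mul1r rmorphM /=.
apply: ler_wpM2r; first by rewrite ler0c ltW.
by apply: ge; rewrite norm_circle_point ?(ltW r0).
Qed.

(** Continuity of the contour integral for the uniform norm, stated against the explicit
integral of a Laurent polynomial: both exact values and bounds follow from it. *)
Lemma contour_integral_approx g ls (e : R) : approx1 g ->
  (forall z, `|z| = r%:C -> `|g z - laurent1 ls z| <= e%:C) ->
  `|contour_integral r g - laurent1_integral ls| <= (4%:R * pi * r * e)%:C.
Proof.
move=> ga ge; rewrite /contour_integral -[X in angular_integral X]/(h g) -angular_integral_laurent1.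
have hg : ccont (h g).
  apply: ccont_unif_limit => d d0; have [|ls' lsP] := ga (d / r); first by rewrite divr_gt0.
  exists (h (laurent1 ls')); first exact: ccont_integrand.
  by move=> th; have := h_dist th lsP; rewrite divfK ?gt_eqF.
have hN : ccont (fun th => - h (laurent1 ls) th).
  have -> : (fun th => - h (laurent1 ls) th) = h (laurent1 [seq (- p.1, p.2) | p <- ls]).
    apply/funext => th; rewrite !integrand_laurent1 big_map -sumrN.
    by apply: eq_bigr => p _ /=; rewrite !mulNr.
  exact: ccont_integrand.
have -> : angular_integral (h g) - angular_integral (h (laurent1 ls)) = angular_integral (fun th => h g th - h (laurent1 ls) th).
  rewrite -[in LHS](@eq_angular_integral _ (fun th => (h g th - h (laurent1 ls) th) + h (laurent1 ls) th)); last by move=> th; rewrite subrK.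
  by rewrite angular_integralD ?addrK//; first exact: ccontD.
have -> : 4%:R * pi * r * e = 4%:R * pi * (e * r) by rewrite mulrAC -mulrA.
apply: angular_integral_bound => [|th]; first exact: ccontD.
exact: h_dist.
Qed.

End Laurent.

(** * Iterated contour integrals and directional degrees *)

Section Torus.
Context {R : realType}.
Variables (r : R).
Hypothesis r0 : 0 < r.
Local Notation C := R[i].
Local Notation iter_int := (iterated_contour_integral r).

(** The shape in which equalities between integrals are obtained: both sides are within
a multiple of every e > 0 of the same Laurent polynomial integral. *)
Lemma small_eq0 (K : R) (z : C) : (forall e : R, 0 < e -> `|z| <= (K * e)%:C) -> z = 0.
Proof.
move=> H; apply/eqP; rewrite -normr_eq0; apply/eqP/le_anti; rewrite normr_ge0 andbT.
have zR : `|z| = (complex.Re `|z|)%:C by rewrite RRe_real// normr_real.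
rewrite zR lecR; apply/ler_addgt0Pr => e e0; rewrite add0r.
have K0 : 0 < `|K| + 1 by rewrite ltr_wpDl.
have := H (e / (`|K| + 1)); rewrite divr_gt0// => /(_ isT); rewrite zR lecR => /le_trans; apply.
rewrite mulrC -mulrA ler_piMr ?(ltW e0)// mulrC ler_pdivrMr// mul1r.
by rewrite (le_trans (ler_norm _))// lerDl.
Qed.

Definition monomial n (w : 'I_n -> C) (al : 'I_n -> int) : C := \prod_k w k ^ al k.
Definition laurent n (ps : seq (C * ('I_n -> int))) (w : 'I_n -> C) : C :=
  \sum_(p <- ps) p.1 * monomial w p.2.
(** Positivity of r is part of the predicate because in dimension 0 it does not follow
from the moduli of the coordinates. *)
Definition torus n (w : 'I_n -> C) := 0 < r /\ forall k, `|w k| = r%:C.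
(** Only the monomial with all exponents equal to -1 has a nonzero iterated integral. *)
Definition laurent_integral n (ps : seq (C * ('I_n -> int))) : C :=
  \sum_(p <- ps) p.1 *+ [forall k, p.2 k == -1] * (2%:R * pi%:C * imag_unit) ^+ n.
(** Uniform limits on the torus of Laurent polynomials all of whose exponent vectors
satisfy P; the weight conditions of [degle] are such restrictions. *)
Definition approx n (P : ('I_n -> int) -> bool) (F : ('I_n -> C) -> C) :=
  forall e : R, 0 < e -> exists2 ps, all (fun p => P p.2) ps &
    forall w, torus w -> `|F w - laurent ps w| <= e%:C.

Definition consw n (z : C) (w : 'I_n -> C) : 'I_n.+1 -> C :=
  fun k => if unlift ord0 k is Some k' then w k' else z.

Lemma torus_consw n z (w : 'I_n -> C) : `|z| = r%:C -> torus w -> torus (consw z w).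
Proof. by move=> hz [r_gt0 hw]; split=> // k; rewrite /consw; case: unlift. Qed.

Lemma monomial_consw n z (w : 'I_n -> C) al :
  monomial (consw z w) al = z ^ al ord0 * monomial w (fun k => al (lift ord0 k)).
Proof.
rewrite /monomial big_ord_recl /consw unlift_none; congr (_ * _).
by apply: eq_bigr => k _; rewrite liftK.
Qed.

Lemma forall_ord_recl n (P : pred 'I_n.+1) :
  [forall k, P k] = P ord0 && [forall k, P (lift ord0 k)].
Proof.
apply/forallP/andP => [H|[H0 /forallP H] k]; first by split=> //; apply/forallP.
by case: (unliftP ord0 k) => [j ->|->].
Qed.

(** The one analytic fact about iterated integrals, by induction on the number of
variables; the hypothesis that F is itself a limit of Laurent polynomials makes the
inner integrals limits of Laurent polynomials in the outer variable. *)
Lemma iter_laurent n (F : ('I_n -> C) -> C) ps (e : R) : approx xpredT F ->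
  (forall w, torus w -> `|F w - laurent ps w| <= e%:C) ->
  `|iter_int F - laurent_integral ps| <= ((4%:R * pi * r) ^+ n * e)%:C.
Proof.
elim: n F ps e => [|n IH] F ps e Fa Fe.
  rewrite expr0 mul1r /=.
  have -> : laurent_integral ps = laurent ps (fun=> 0).
    apply: eq_bigr => p _; rewrite expr0 mulr1 /monomial big_ord0 mulr1.
    by have -> : [forall k, p.2 k == -1] by apply/forallP; case.
  by apply: Fe; split=> //; case.
pose hd z ps : seq (C * ('I_n -> int)) := [seq (p.1 * z ^ p.2 ord0, fun k => p.2 (lift ord0 k)) | p <- ps].
have lauE z w qs : laurent qs (consw z w) = laurent (hd z qs) w.
  by rewrite /laurent big_map; apply: eq_bigr => p _; rewrite monomial_consw mulrA.
pose ct1 qs : seq (C * int) := [seq (p.1 *+ [forall k, p.2 (lift ord0 k) == -1] * (2%:R * pi%:C * imag_unit) ^+ n, p.2 ord0) | p : C * ('I_n.+1 -> int) <- qs].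
have ctE z qs : laurent_integral (hd z qs) = laurent1 (ct1 qs) z.
  rewrite /laurent_integral /laurent1 !big_map; apply: eq_bigr => p _ /=.
  by rewrite -mulrnAl mulrAC.
have app_z z : `|z| = r%:C -> approx xpredT (fun w => F (consw z w)).
  move=> hz d d0; have [qs _ qsP] := Fa _ d0; exists (hd z qs); first by rewrite all_predT.
  by move=> w hw; rewrite -lauE; apply: qsP; exact: torus_consw.
have key d qs : (forall w, torus w -> `|F w - laurent qs w| <= d%:C) -> forall z, `|z| = r%:C ->
  `|iter_int (fun w => F (consw z w)) - laurent1 (ct1 qs) z| <= ((4%:R * pi * r) ^+ n * d)%:C.
  move=> Fd z hz; rewrite -ctE; apply: IH; first exact: app_z.
  by move=> w hw; rewrite -lauE; apply: Fd; exact: torus_consw.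
have K0 : 0 < (4%:R * pi * r) ^+ n by rewrite exprn_gt0// !mulr_gt0// pi_gt0.
have ga : approx1 r (fun z => iter_int (fun w => F (consw z w))).
  move=> d d0; have [|qs _ qsP] := Fa (d / (4%:R * pi * r) ^+ n); first by rewrite divr_gt0.
  exists (ct1 qs) => z hz; have := key _ _ qsP z hz.
  by rewrite mulrC divfK ?gt_eqF.
have := contour_integral_approx r0 ga (key _ _ Fe).
rewrite exprS -[4%:R * pi * r * _ * e]mulrA; congr (`|_ - _| <= _).
rewrite /laurent1_integral /ct1 big_map /laurent_integral; apply: eq_bigr => p _ /=.
rewrite forall_ord_recl exprSr andbC.
by case: (p.2 ord0 == -1); case: [forall k, _]; rewrite ?mulr1n ?mulr0n ?mul0r ?mulr0n ?mul0r -?mulrA.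
Qed.

Let K n : R := (4%:R * pi * r) ^+ n.

Section Fixed.
Variable n : nat.
Implicit Types (F G : ('I_n -> C) -> C) (w : 'I_n -> C) (v : 'I_n -> int) (m : int).
Local Notation A := (approx xpredT).

(** The degree of F in the direction v is at most m, in the sense of uniform limits of
Laurent polynomials. *)
Definition degle v m := approx (fun al : 'I_n -> int => \sum_k v k * al k <= m).

Lemma approxW (P Q : ('I_n -> int) -> bool) F : (forall al, P al -> Q al) -> approx P F -> approx Q F.
Proof.
move=> PQ FP e e0; have [ps psP psF] := FP e e0; exists ps => //.
by apply: sub_all psP => p; exact: PQ.
Qed.

Lemma degle_approx v m F : degle v m F -> A F. Proof. exact: approxW. Qed.

Lemma degleW v m m' F : m <= m' -> degle v m F -> degle v m' F.
Proof. by move=> mm; apply: approxW => al h; exact: le_trans mm. Qed.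

Lemma eq_approx P F G : (forall w, torus w -> F w = G w) -> approx P F -> approx P G.
Proof.
by move=> FG FP e e0; have [ps psP psF] := FP e e0; exists ps => // w hw; rewrite -FG// psF.
Qed.

Lemma iter_bound F (e : R) : A F -> (forall w, torus w -> `|F w| <= e%:C) ->
  `|iter_int F| <= (K n * e)%:C.
Proof.
move=> FA Fe; have := @iter_laurent n F [::] e FA; rewrite /laurent_integral big_nil subr0; apply.
by move=> w hw; rewrite /laurent big_nil subr0 Fe.
Qed.

Lemma eq_iter F G : A F -> (forall w, torus w -> F w = G w) -> iter_int F = iter_int G.
Proof.
move=> FA FG; have GA := eq_approx FG FA.
apply/eqP; rewrite -subr_eq0; apply/eqP/(@small_eq0 (2%:R * K n)) => e e0.
have [ps _ psF] := FA e e0; have h1 := iter_laurent FA psF.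
have h2 : `|iter_int G - laurent_integral ps| <= (K n * e)%:C.
  by apply: iter_laurent => // w hw; rewrite -FG// psF.
rewrite -(subrKA (laurent_integral ps)) -mulrA mulr_natl rmorphMn /= mulr2n.
by apply: le_trans (ler_normD _ _) _; apply: lerD => //; rewrite distrC.
Qed.

Lemma laurent_cat ps qs w : laurent (ps ++ qs) w = laurent ps w + laurent qs w.
Proof. exact: big_cat. Qed.

Lemma approxD P F G : approx P F -> approx P G -> approx P (fun w => F w + G w).
Proof.
move=> FP GP e e0; have e2 : 0 < e / 2 by rewrite divr_gt0.
have [ps psP psF] := FP _ e2; have [qs qsP qsF] := GP _ e2.
exists (ps ++ qs) => [|w hw]; first by rewrite all_cat psP.
rewrite laurent_cat opprD addrACA [e]splitr rmorphD /=.
by apply: le_trans (ler_normD _ _) _; apply: lerD; [exact: psF|exact: qsF].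
Qed.

Lemma iterD F G : A F -> A G -> iter_int (fun w => F w + G w) = iter_int F + iter_int G.
Proof.
move=> FA GA; apply/eqP; rewrite -subr_eq0; apply/eqP/(@small_eq0 (4%:R * K n)) => e e0.
have [ps _ psF] := FA e e0; have [qs _ qsF] := GA e e0.
have h1 := iter_laurent FA psF; have h2 := iter_laurent GA qsF.
have h3 : `|iter_int (fun w => F w + G w) - laurent_integral (ps ++ qs)| <= (K n * (e + e))%:C.
  apply: iter_laurent => [|w hw]; first exact: approxD.
  rewrite laurent_cat opprD addrACA rmorphD /=.
  by apply: le_trans (ler_normD _ _) _; apply: lerD; [exact: psF|exact: qsF].
have -> : iter_int (fun w => F w + G w) - (iter_int F + iter_int G) =
  (iter_int (fun w => F w + G w) - laurent_integral (ps ++ qs)) - ((iter_int F - laurent_integral ps) + (iter_int G - laurent_integral qs)).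
  by rewrite /laurent_integral big_cat /=; ring.
have -> : 4%:R * K n * e = K n * (e + e) + (K n * e + K n * e) by ring.
rewrite !rmorphD /=; apply: le_trans (ler_normB _ _) _; apply: lerD => //.
by apply: le_trans (ler_normD _ _) _; apply: lerD.
Qed.

Lemma normrXz (z : C) (k : int) : `|z ^ k| = `|z| ^ k.
Proof. by case: k => m; rewrite ?NegzE -?exprnP -?exprnN ?normfV normrX. Qed.

Lemma laurent_bounded ps : exists2 M : R, 0 < M & forall w, torus w -> `|laurent ps w| <= M%:C.
Proof.
elim: ps => [|[c al] ps [M M0 HM]].
  by exists 1 => // w _; rewrite /laurent big_nil normr0 ler0c.
have [N N0 HN] : exists2 N : R, 0 <= N & forall w, torus w -> `|c * monomial w al| <= N%:C.
  have P0 : 0 <= `|c| * \prod_k `|r|%:C ^ al k.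
    by apply: mulr_ge0 => //; apply: prodr_ge0 => k _; rewrite exprz_ge0// ler0c.
  exists (complex.Re (`|c| * \prod_k `|r|%:C ^ al k)) => [|w hw].
    by rewrite -ler0c RRe_real// ger0_real.
  rewrite RRe_real ?ger0_real//.
  rewrite normrM /monomial normr_prod le_eqVlt; apply/orP; left; apply/eqP.
  by congr (_ * _); apply: eq_bigr => k _; rewrite normrXz hw.2 gtr0_norm ?hw.1.
exists (N + M) => [|w hw]; first by rewrite ltr_wpDl.
rewrite /laurent big_cons rmorphD /=; apply: le_trans (ler_normD _ _) _; apply: lerD; [exact: HN|exact: HM].
Qed.

Lemma approx_bounded F : A F -> exists2 M : R, 0 < M & forall w, torus w -> `|F w| <= M%:C.
Proof.
move=> FA; have [ps _ psF] := FA 1 ltr01; have [M M0 HM] := laurent_bounded ps.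
exists (1 + M) => [|w hw]; first by rewrite addr_gt0.
rewrite -(subrK (laurent ps w) (F w)) rmorphD /=.
by apply: le_trans (ler_normD _ _) _; apply: lerD; [exact: psF|exact: HM].
Qed.

Lemma torus_neq0 w k : torus w -> w k != 0.
Proof. by move=> [r_gt0 hw]; rewrite -normr_eq0 hw fmorph_eq0 gt_eqF. Qed.

Lemma monoD w al be : torus w -> monomial w (fun k => al k + be k) = monomial w al * monomial w be.
Proof.
by move=> hw; rewrite /monomial -big_split /=; apply: eq_bigr => k _; rewrite expfzDr// torus_neq0.
Qed.

Lemma approxM_exponents (P Q S : ('I_n -> int) -> bool) F G :
  (forall al be, P al -> Q be -> S (fun k => al k + be k)) ->
  approx P F -> approx Q G -> approx S (fun w => F w * G w).
Proof.
move=> PQS FP GQ e e0.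
have [M M0 HM] := approx_bounded (@approxW P xpredT F (fun _ _ => isT) FP).
have [qs qsQ qsG] := GQ (e / 2 / M) (ltac:(by rewrite !divr_gt0)).
have [N N0 HN] := laurent_bounded qs.
have [ps psP psF] := FP (e / 2 / N) (ltac:(by rewrite !divr_gt0)).
exists [seq (p.1 * q.1, fun k => p.2 k + q.2 k) | p <- ps, q <- qs] => [|w hw].
  have : all (fun p => true) ps by rewrite all_predT.
  elim: (ps) psP => //= p ps' IH /andP[pP /IH{}IH] _; rewrite all_cat IH ?all_predT// andbT.
  by elim: (qs) qsQ => //= q qs' IH' /andP[qQ /IH' ->]; rewrite andbT PQS.
have -> : laurent [seq (p.1 * q.1, fun k => p.2 k + q.2 k) | p <- ps, q <- qs] w = laurent ps w * laurent qs w.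
  rewrite /laurent big_allpairs_dep mulr_suml; apply: eq_bigr => p _; rewrite mulr_sumr.
  by apply: eq_bigr => q _ /=; rewrite monoD//; ring.
have -> : F w * G w - laurent ps w * laurent qs w = F w * (G w - laurent qs w) + (F w - laurent ps w) * laurent qs w by ring.
apply: le_trans (ler_normD _ _) _; rewrite [e]splitr rmorphD /= !normrM; apply: lerD.
  rewrite -[e / 2](@divfK _ M) ?gt_eqF// mulrC rmorphM /=.
  by apply: ler_pM => //; [exact: qsG|exact: HM].
rewrite -[e / 2](@divfK _ N) ?gt_eqF// rmorphM /=.
by apply: ler_pM => //; [exact: psF|exact: HN].
Qed.

Lemma degleM v m m' F G : degle v m F -> degle v m' G -> degle v (m + m') (fun w => F w * G w).
Proof.
apply: approxM_exponents => al be h1 h2.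
under eq_bigr do rewrite mulrDr.
by rewrite big_split lerD.
Qed.

Lemma approxM F G : A F -> A G -> A (fun w => F w * G w). Proof. exact: approxM_exponents. Qed.

Lemma degleD v m F G : degle v m F -> degle v m G -> degle v m (fun w => F w + G w). Proof. exact: approxD. Qed.

Lemma degle_mono v m c (al : 'I_n -> int) : \sum_k v k * al k <= m -> degle v m (fun w => c * monomial w al).
Proof.
move=> h e e0; exists [:: (c, al)]; first by rewrite /= h.
by move=> w _; rewrite /laurent big_cons big_nil addr0 subrr normr0 ler0c ltW.
Qed.

Lemma degle_cst v m c : 0 <= m -> degle v m (fun=> c).
Proof.
move=> m0; apply: (@eq_approx _ (fun w => c * monomial w (fun=> 0))) => [w _|].
  by rewrite /monomial big1 ?mulr1.
by apply: degle_mono; rewrite big1// => k _; rewrite mulr0.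
Qed.

Lemma degle_0 v m : degle v m (fun=> 0).
Proof. by move=> e e0; exists [::] => // w _; rewrite /laurent big_nil subr0 normr0 ler0c ltW. Qed.

Lemma approx_cst c : A (fun _ : 'I_n -> C => c). Proof. by apply: (@degle_approx (fun=> 0) 0); exact: degle_cst. Qed.

Lemma degle_Xz v m j (a : int) : v j * a <= m -> degle v m (fun w => w j ^ a).
Proof.
move=> h; apply: (@eq_approx _ (fun w => 1 * monomial w (fun k => if k == j then a else 0))) => [w _|].
  by rewrite mul1r /monomial (bigD1 j)//= eqxx big1 ?mulr1// => k /negPf ->.
apply: degle_mono; rewrite (bigD1 j)//= eqxx big1 ?addr0// => k /negPf ->.
by rewrite mulr0.
Qed.

Lemma degle_w v m j : v j <= m -> degle v m (fun w => w j).
Proof. by move=> h; apply: (@eq_approx _ (fun w => w j ^ 1)) => //; apply: degle_Xz; rewrite mulr1. Qed.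

Lemma degle_Z v m c F : degle v m F -> degle v m (fun w => c * F w).
Proof. by move=> h; rewrite -[m]add0r; apply: degleM => //; exact: degle_cst. Qed.

Lemma degle_N v m F : degle v m F -> degle v m (fun w => - F w).
Proof.
by move=> h; apply: (@eq_approx _ (fun w => -1 * F w)) => [w _|]; [rewrite mulN1r|exact: degle_Z].
Qed.

Lemma degle_sum (I : Type) (s : seq I) (P : pred I) v m (F : I -> ('I_n -> C) -> C) :
  (forall i, P i -> degle v m (F i)) -> degle v m (fun w => \sum_(i <- s | P i) F i w).
Proof.
move=> h; elim: s => [|i s IH].
  by apply: (@eq_approx _ (fun=> 0)); [move=> w _; rewrite big_nil|exact: degle_0].
case Pi: (P i).
  apply: (@eq_approx _ (fun w => F i w + \sum_(i <- s | P i) F i w)) => [w _|]; first by rewrite big_cons Pi.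
  by apply: degleD => //; exact: h.
by apply: (eq_approx _ IH) => w _; rewrite big_cons Pi.
Qed.

Lemma degle_prod (I : Type) (s : seq I) (P : pred I) v (m : I -> int) (F : I -> ('I_n -> C) -> C) :
  (forall i, P i -> degle v (m i) (F i)) -> degle v (\sum_(i <- s | P i) m i) (fun w => \prod_(i <- s | P i) F i w).
Proof.
move=> h; elim: s => [|i s IH].
  by rewrite big_nil; apply: (@eq_approx _ (fun=> 1)); [move=> w _; rewrite big_nil|exact: degle_cst].
case Pi: (P i).
  rewrite big_cons Pi; apply: (@eq_approx _ (fun w => F i w * \prod_(i <- s | P i) F i w)) => [w _|]; first by rewrite big_cons Pi.
  by apply: degleM => //; exact: h.
by rewrite big_cons Pi; apply: (eq_approx _ IH) => w _; rewrite big_cons Pi.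
Qed.

Lemma degle_prod0 (I : Type) (s : seq I) (P : pred I) v (F : I -> ('I_n -> C) -> C) :
  (forall i, P i -> degle v 0 (F i)) -> degle v 0 (fun w => \prod_(i <- s | P i) F i w).
Proof. by move=> h; have := @degle_prod I s P v (fun=> 0) F h; rewrite big1. Qed.

Lemma degle_lim v m F : (forall e : R, 0 < e -> exists2 G, degle v m G & forall w, torus w -> `|F w - G w| <= e%:C) -> degle v m F.
Proof.
move=> h e e0; have e2 : 0 < e / 2 by rewrite divr_gt0.
have [G GH FG] := h _ e2; have [ps psP psG] := GH _ e2; exists ps => // w hw.
rewrite -(subrKA (G w)) [e]splitr rmorphD /=.
by apply: le_trans (ler_normD _ _) _; apply: lerD; [exact: FG|exact: psG].
Qed.

Lemma iterZ c F : A F -> iter_int (fun w => c * F w) = c * iter_int F.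
Proof.
move=> FA; apply/eqP; rewrite -subr_eq0; apply/eqP/(@small_eq0 (2%:R * K n * complex.Re `|c|)) => e e0.
have [ps _ psF] := FA e e0; have h1 := iter_laurent FA psF.
have cR : `|c| = (complex.Re `|c|)%:C by rewrite RRe_real// normr_real.
have h2 : `|iter_int (fun w => c * F w) - laurent_integral [seq (c * p.1, p.2) | p <- ps]| <= (K n * (complex.Re `|c| * e))%:C.
  apply: iter_laurent => [|w hw]; first by apply: approxM => //; exact: approx_cst.
  rewrite /laurent big_map; under eq_bigr do rewrite -mulrA.
  by rewrite -mulr_sumr -mulrBr normrM rmorphM /= -cR ler_wpM2l// psF.
have -> : iter_int (fun w => c * F w) - c * iter_int F =
  (iter_int (fun w => c * F w) - laurent_integral [seq (c * p.1, p.2) | p <- ps]) - c * (iter_int F - laurent_integral ps).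
  rewrite mulrBr /laurent_integral big_map mulr_sumr.
  under eq_bigr do rewrite -mulrnAr -mulrA.
  by ring.
have -> : 2%:R * K n * complex.Re `|c| * e = K n * (complex.Re `|c| * e) + complex.Re `|c| * (K n * e) by ring.
rewrite rmorphD /=; apply: le_trans (ler_normB _ _) _; apply: lerD => //.
by rewrite normrM [X in _ <= X]rmorphM /= -cR ler_wpM2l.
Qed.

(** The exponent vector (-1, ..., -1) has weight - (v_1 + ... + v_n), so it cannot occur
in F. For v supported on one variable this is the usual deformation of one contour to 0
or to infinity. *)
Lemma iter_vanish v m F : m < - \sum_k v k -> degle v m F -> iter_int F = 0.
Proof.
move=> mv FH; apply: (@small_eq0 (K n)) => e e0; have [ps psP psF] := FH e e0.
have := iter_laurent (degle_approx FH) psF; suff -> : laurent_integral ps = 0 by rewrite subr0.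
rewrite /laurent_integral big_seq big1// => p pps.
case: forallP => [h|_]; last by rewrite mulr0n mul0r.
have := allP psP p pps; rewrite leNgt (lt_le_trans mv)// -sumrN.
by apply: ler_sum => k _; rewrite (eqP (h k)) mulrN1.
Qed.

Lemma iter_const c : iter_int (fun w : 'I_n -> C => c * \prod_k (w k)^-1) = c * (2%:R * pi%:C * imag_unit) ^+ n.
Proof.
apply/eqP; rewrite -subr_eq0; apply/eqP/(@small_eq0 (K n)) => e e0.
have h w : torus w -> `|c * \prod_k (w k)^-1 - laurent [:: (c, fun=> -1)] w| <= e%:C.
  move=> hw; rewrite /laurent big_cons big_nil addr0 /monomial /=.
  by under [X in _ - _ * X]eq_bigr do rewrite exprN1; rewrite subrr normr0 ler0c ltW.
have FA : A (fun w : 'I_n -> C => c * \prod_k (w k)^-1).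
  apply: (@eq_approx _ (fun w => c * monomial w (fun=> -1))) => [w _|].
    by rewrite /monomial; under eq_bigr do rewrite exprN1.
  by apply: (@degle_approx (fun=> 0) 0); apply: degle_mono; rewrite big1// => k _; rewrite mul0r.
have := iter_laurent FA h.
rewrite /laurent_integral big_cons big_nil addr0 /=.
by have -> : [forall k : 'I_n, (-1 : int) == -1] by apply/forallP.
Qed.

Lemma expr_small (rho d : R) : 0 <= rho < 1 -> 0 < d -> exists k : nat, rho ^+ k <= d.
Proof.
move=> /andP[rho0 rho1] d0; have h : (fun k : nat => rho ^+ k) @ \oo --> (0 : R).
  by apply: cvg_expr; rewrite ger0_norm.
move/cvgrPdist_le : h => /(_ d d0)[m _ hm]; exists m.
by have := hm m (leqnn m); rewrite /= sub0r normrN ger0_norm// exprn_ge0.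
Qed.

Lemma degle_exp v F (k : nat) : degle v 0 F -> degle v 0 (fun w => F w ^+ k).
Proof.
move=> FH; elim: k => [|m IH]; first by apply: (@eq_approx _ (fun=> 1)) => //; exact: degle_cst.
apply: (@eq_approx _ (fun w => F w * F w ^+ m)) => [w _|]; first by rewrite exprS.
by rewrite -[0]addr0; apply: degleM.
Qed.

(** Inverses enter through the geometric series, which converges uniformly when |F| <=
rho < 1 on the torus and does not raise the degree 0. *)
Lemma degle_geom v F (rho : R) : 0 <= rho < 1 -> degle v 0 F -> (forall w, torus w -> `|F w| <= rho%:C) ->
  degle v 0 (fun w => (1 - F w)^-1).
Proof.
move=> rho01 FH Fr; apply: degle_lim => e e0; have /andP[rho0 rho1] := rho01.
have [|m hm] := @expr_small rho (e * (1 - rho)) rho01; first by rewrite mulr_gt0// subr_gt0.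
exists (fun w => \sum_(i < m) F w ^+ i); first by apply: degle_sum => i _; exact: degle_exp.
move=> w hw; have F1 : (1 - rho)%:C <= `|1 - F w|.
  rewrite rmorphB rmorph1; apply: le_trans (lerB_dist _ _); rewrite normr1.
  by rewrite lerB// Fr.
have F0 : 0 < `|1 - F w| by apply: lt_le_trans F1; rewrite ltcR subr_gt0.
have E : (1 - F w)^-1 - \sum_(i < m) F w ^+ i = F w ^+ m / (1 - F w).
  apply: (mulIf (_ : 1 - F w != 0)); first by rewrite -normr_gt0.
  rewrite mulrBl mulVf ?divfK -?normr_gt0// mulrC.
  have -> : (1 - F w) * \sum_(i < m) F w ^+ i = 1 - F w ^+ m.
    by rewrite -[LHS]opprK -mulNr opprB -subrX1 opprB.
  by ring.
rewrite E normrM normfV normrX ler_pdivrMr//.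
apply: (@le_trans _ _ (rho%:C ^+ m)); first by rewrite lerXn2r ?nnegrE ?normr_ge0 ?ler0c ?rho0 ?Fr.
rewrite -rmorphXn /=; apply: (@le_trans _ _ (e * (1 - rho))%:C); first by rewrite lecR.
by rewrite rmorphM /= ler_wpM2l// ler0c ltW.
Qed.

End Fixed.
End Torus.

(** * The complex exponential *)

Section ComplexExp.
Context {R : realType}.
Local Notation C := R[i].

Lemma cexpD (x y : C) : cexp (x + y) = cexp x * cexp y.
Proof.
rewrite /cexp !raddfD /= expRD rmorphM /= -/(cis _) cisD /cis.
by rewrite mulrACA.
Qed.

Lemma cexp0 : cexp (0 : C) = 1.
Proof. by rewrite /cexp /= expR0 cos0 sin0 mul1r. Qed.

Lemma cexp_sum (I : Type) (s : seq I) (f : I -> C) :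
  cexp (\sum_(i <- s) f i) = \prod_(i <- s) cexp (f i).
Proof.
elim: s => [|i s IH]; first by rewrite !big_nil cexp0.
by rewrite !big_cons cexpD IH.
Qed.

Lemma cexpMn (x : C) k : cexp (x *+ k) = cexp x ^+ k.
Proof. by elim: k => [|k IH]; rewrite ?cexp0// mulrS cexpD IH exprS. Qed.

Lemma norm_cexp (z : C) : `|cexp z| = (expR (complex.Re z))%:C.
Proof. by rewrite normrM -/(cis _) norm_cis mulr1 ger0_norm// ler0c expR_ge0. Qed.

Lemma sin_mvt (y : R) : 0 < y -> exists2 c, 0 < c < y & sin y = cos c * y.
Proof.
move=> y0; have h1 x : x \in `]0, y[ -> is_derive x (1 : R) sin (cos x) by move=> _; exact: is_derive_sin.
have h2 : {within `[0, y], continuous (sin : R -> R)} by apply: continuous_subspaceT; exact: continuous_sin.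
have [c cP] := MVT y0 h1 h2.
by rewrite sin0 !subr0 => ->; exists c => //; move: cP; rewrite in_itv.
Qed.

Lemma cos_mvt (y : R) : 0 < y -> exists2 c, 0 < c < y & cos y - 1 = - sin c * y.
Proof.
move=> y0; have h1 x : x \in `]0, y[ -> is_derive x (1 : R) cos (- sin x) by move=> _; exact: is_derive_cos.
have h2 : {within `[0, y], continuous (cos : R -> R)} by apply: continuous_subspaceT; exact: continuous_cos.
have [c cP] := MVT y0 h1 h2.
by rewrite cos0 subr0 => ->; exists c => //; move: cP; rewrite in_itv.
Qed.

Lemma sin_mvt3 (y : R) : 0 < y -> exists2 c, 0 < c < y & sin y - y = (cos c - 1) * y.
Proof. by move=> y0; have [c cP E] := sin_mvt y0; exists c => //; rewrite E mulrBl mul1r. Qed.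

Lemma norm_sin_le (y : R) : `|sin y| <= `|y|.
Proof.
wlog y0 : y / 0 < y.
  move=> h; have [/h //|y0|<-] := ltgtP 0 y; last by rewrite sin0 normr0.
  by have := h (- y); rewrite sinN !normrN oppr_gt0; apply.
by have [c _ ->] := sin_mvt y0; rewrite normrM ler_piMl// ler_norml cos_geN1 cos_le1.
Qed.

Lemma norm_cos_sub1 (y : R) : `|cos y - 1| <= y ^+ 2.
Proof.
wlog y0 : y / 0 < y.
  move=> h; have [/h //|y0|<-] := ltgtP 0 y; last by rewrite cos0 subrr normr0 sqr_ge0.
  by have := h (- y); rewrite cosN sqrrN oppr_gt0; apply.
have [c /andP[c0 cy] ->] := cos_mvt y0; rewrite normrM normrN (gtr0_norm y0) expr2 ler_wpM2r ?(ltW y0)//.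
by rewrite (le_trans (norm_sin_le c))// gtr0_norm// ltW.
Qed.

Lemma norm_sin_sub (y : R) : `|y| <= 1 -> `|sin y - y| <= y ^+ 2.
Proof.
wlog y0 : y / 0 < y.
  move=> h; have [/h //|y0|<-] := ltgtP 0 y; last by rewrite sin0 subrr normr0 sqr_ge0.
  by have := h (- y); rewrite sinN sqrrN -opprD !normrN oppr_gt0; apply.
rewrite (gtr0_norm y0) => y1; have [c /andP[c0 cy] ->] := sin_mvt3 y0.
rewrite normrM (gtr0_norm y0) expr2 ler_wpM2r ?(ltW y0)//.
apply: (le_trans (norm_cos_sub1 c)); rewrite expr2.
by nra.
Qed.

Lemma expR_sub (x : R) : `|x| <= 2^-1 -> `|expR x - 1 - x| <= 2%:R * x ^+ 2.
Proof.
move=> x1; have xb : - 2^-1 <= x <= 2^-1 by rewrite -ler_norml.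
have h1 : 0 <= expR x - 1 - x by have := expR_ge1Dx x; lra.
rewrite ger0_norm//; have h2 := expR_ge1Dx (- x).
have e0 := expR_gt0 x; have e1 := expRxMexpNx_1 x.
have e2 : expR x * (1 - x) <= 1 by rewrite -[leRHS]e1 ler_wpM2l ?(ltW e0).
have [_ x2] := andP xb; have x3 : 0 <= x ^+ 2 * (1 - 2%:R * x) by rewrite mulr_ge0 ?sqr_ge0//; lra.
rewrite -subr_ge0 -(@pmulr_lge0 _ (1 - x)); last lra.
clear -e2 x3; rewrite !expr2 in x3 *; lra.
Qed.

(** The quadratic bound for the complex exponential, from the real mean value theorem
for each of exp, sin and cos; any constant would do in place of 10. *)
Lemma cexp_taylor (h : C) : `|h| <= (2^-1)%:C -> `|cexp h - 1 - h| <= (10%:R)%:C * `|h| ^+ 2.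
Proof.
move=> h1; have [hx hy] := normc_le_ReIm h1.
rewrite -add_Re2_Im2 -rmorphM; apply: le_trans (normc_le_sum _) _; rewrite lecR.
case: h h1 hx hy => x y /= _ hx hy; rewrite !mul0r !addr0 !subr0.
have ex := expR_sub hx; have cy := norm_cos_sub1 y.
have h21 : 2^-1 <= 1 :> R by lra.
have sy := @norm_sin_sub y (le_trans hy h21).
have sy1 := norm_sin_le y.
have ex1 : expR x <= 2%:R.
  have xb : - 2^-1 <= x <= 2^-1 by rewrite -ler_norml.
  have := expR_ge1Dx (- x); have := expRxMexpNx_1 x; have := expR_gt0 x; nra.
have e0 := expR_gt0 x.
have h1 : `|expR x * cos y - 1 - x| <= 2%:R * x ^+ 2 + 2%:R * y ^+ 2.
  have -> : expR x * cos y - 1 - x = (expR x - 1 - x) + expR x * (cos y - 1) by ring.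
  apply: le_trans (ler_normD _ _) _; apply: lerD => //.
  by rewrite normrM (gtr0_norm e0); apply: ler_pM => //; exact: ltW.
have h2 : `|expR x * sin y - y| <= 4%:R * (x ^+ 2 + y ^+ 2) + y ^+ 2.
  have -> : expR x * sin y - y = (expR x - 1) * sin y + (sin y - y) by ring.
  apply: le_trans (ler_normD _ _) _; apply: lerD => //.
  have ex2 : `|expR x - 1| <= 2%:R * `|x|.
    have -> : expR x - 1 = (expR x - 1 - x) + x by ring.
    apply: le_trans (ler_normD _ _) _; rewrite mulr_natl mulr2n lerD2r.
    apply: (le_trans ex); rewrite -real_normK ?num_real// expr2 mulrA ler_piMl//.
    by rewrite mulrC -ler_pdivlMr// mul1r.
  rewrite normrM; apply: (@le_trans _ _ (2%:R * `|x| * `|y|)); first exact: ler_pM.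
  have := sqr_ge0 (`|x| - `|y|).
  rewrite -[x ^+ 2]real_normK ?num_real// -[y ^+ 2]real_normK ?num_real//.
  by move: (normr_ge0 x) (normr_ge0 y); nra.
have := sqr_ge0 x; have := sqr_ge0 y; lra.
Qed.

Section Approx.
Variables (r : R).

Lemma normB_exp (x y : C) (M : R) (n : nat) : `|x| <= M%:C -> `|y| <= M%:C -> 1 <= M ->
  `|x ^+ n - y ^+ n| <= (n%:R * M ^+ n)%:C * `|x - y|.
Proof.
move=> xM yM M1; rewrite subrXX normrM mulrC ler_wpM2r//.
apply: le_trans (ler_norm_sum _ _ _) _; rewrite rmorphM rmorph_nat -[n in n%:R]card_ord -sum1_card.
rewrite natr_sum mulr_suml; apply: ler_sum => i _; rewrite mul1r normrM !normrX rmorphXn /=.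
have M0 : 0 <= M%:C by rewrite ler0c (le_trans ler01).
apply: (@le_trans _ _ (M%:C ^+ (n.-1 - i) * M%:C ^+ i)).
  by apply: ler_pM; rewrite ?exprn_ge0// lerXn2r ?nnegrE.
rewrite -exprD; apply: ler_weXn2l; first by rewrite -[1]/(1%:C) lecR.
by have := ltn_ord i; lia.
Qed.

(** The approximation (1 + c w / n)^n is used instead of the exponential series: it
needs only additivity and [cexp_taylor], and it is polynomial in w, hence of degree at
most 0 in every direction with v_j <= 0. *)
Lemma degle_cexp n (v : 'I_n -> int) (j : 'I_n) (c : C) : v j <= 0 ->
  degle r v 0 (fun w => cexp (c * w j)).
Proof.
move=> vj; apply: degle_lim => e e0.
pose B : R := complex.Re `|c| * `|r|.
have cR : `|c| = (complex.Re `|c|)%:C by rewrite RRe_real// normr_real.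
have B0 : 0 <= B by rewrite mulr_ge0// -ler0c -cR.
have wB w : torus r w -> `|c * w j| = B%:C.
  by move=> [r_gt0 hw]; rewrite normrM hw [X in X * _]cR -rmorphM /B (gtr0_norm r_gt0).
pose M : R := 10%:R * expR B * B ^+ 2.
have M0 : 0 <= M.
  by apply: mulr_ge0; [apply: mulr_ge0 => //; exact: expR_ge0|exact: exprn_ge0].
have [N hN] : exists N : nat, [/\ (0 < N)%N, B / N%:R <= 2^-1 & M / N%:R <= e].
  (* N must exceed both 2 B, for the range of the Taylor bound, and M / e, for the error *)
  pose x := 2%:R * B + M / e + 1.
  have Me : 0 <= M / e by apply: divr_ge0 => //; exact: ltW.
  have B2 : 0 <= 2%:R * B by apply: mulr_ge0.
  have x0 : 0 <= x by apply: addr_ge0 => //; exact: addr_ge0.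
  exists (Num.bound x); have := archi_boundP x0; set N := Num.bound x => xN.
  have xN1 : 2%:R * B <= N%:R.
    by apply: le_trans (ltW xN); rewrite /x -addrA lerDl addr_ge0.
  have xN2 : M / e <= N%:R.
    by apply: le_trans (ltW xN); rewrite /x addrAC lerDr addr_ge0.
  have N0 : 0 < N%:R :> R by apply: le_lt_trans xN.
  split; first by move: N0; rewrite ltr0n.
    by rewrite ler_pdivrMr// mulrC ler_pdivlMr// mulrC.
  by rewrite ler_pdivrMr// mulrC -ler_pdivrMr.
case: hN => N0 BN MN; have NR0 : 0 < N%:R :> R by rewrite ltr0n.
have NC0 : N%:R != 0 :> C by rewrite pnatr_eq0 -lt0n.
exists (fun w => (1 + c / N%:R * w j) ^+ N).
  apply: degle_exp; apply: degleD; first exact: degle_cst.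
  by apply: degle_Z; exact: degle_w.
move=> w hw; set h : C := c / N%:R * w j.
have hE : c * w j = h *+ N by rewrite /h -mulr_natl; field.
have hB : `|h| = (B / N%:R)%:C.
  apply: (mulfI NC0); rewrite -[X in X * `|h|](normr_nat C) -normrM mulr_natl -hE wB//.
  by rewrite -(rmorph_nat (real_complex R)) -rmorphM /= mulrC divfK ?gt_eqF.
have -> : cexp (c * w j) = cexp h ^+ N.
  by rewrite hE cexpMn.
have h2 : `|cexp h| <= (expR (B / N%:R))%:C.
  rewrite norm_cexp lecR ler_expR; have hB' : `|h| <= (B / N%:R)%:C by rewrite hB.
  by have [+ _] := normc_le_ReIm hB'; apply: le_trans; exact: ler_norm.
have h1 : `|1 + h| <= (expR (B / N%:R))%:C.
  apply: le_trans (ler_normD _ _) _; rewrite normr1 hB -[1]/(1%:C) -rmorphD lecR.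
  exact: expR_ge1Dx.
have e1 : 1 <= expR (B / N%:R) by rewrite -expR0 ler_expR divr_ge0.
apply: (le_trans (normB_exp N h2 h1 e1)).
rewrite -expRM_natl (_ : N%:R * (B / N%:R) = B); last by rewrite mulrC divfK ?gt_eqF.
rewrite mulrC opprD addrA.
have h3 : `|h| <= (2^-1)%:C by rewrite hB lecR.
have T := cexp_taylor h3; rewrite hB in T.
apply: (@le_trans _ _ ((10%:R)%:C * (B / N%:R)%:C ^+ 2 * (N%:R * expR B)%:C)).
  by rewrite ler_wpM2r// ler0c mulr_ge0// expR_ge0.
rewrite -rmorphXn -!rmorphM lecR; apply: le_trans MN; rewrite le_eqVlt; apply/orP; left; apply/eqP.
by rewrite /M; field; rewrite gt_eqF.
Qed.
End Approx.

End ComplexExp.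

(** * Countable Markov chains: backward equation and duality *)

Section Increments.
Context {R : realType}.

(** A mean value inequality without derivatives: uniform control of short increments is
summed along a subdivision of [0, T]. *)
Lemma increments_le (f : R -> R) (T K delta : R) : 0 < delta -> 0 <= T ->
  (forall s h, 0 <= s -> 0 < h < delta -> s + h <= T -> f (s + h) - f s <= K * h) ->
  f T - f 0 <= K * T.
Proof.
move=> d0; rewrite le_eqVlt => /predU1P[<- _|T0 H]; first by rewrite subrr mulr0.
have T1 : 0 <= T / delta by rewrite divr_ge0 ?ltW.
set N := Num.bound (T / delta); have TN : T / delta < N%:R := archi_boundP T1.
have N0 : 0 < N%:R :> R by exact: le_lt_trans TN.
pose h := T / N%:R; have h0 : 0 < h by rewrite divr_gt0.
have hd : h < delta by rewrite ltr_pdivrMr// mulrC -ltr_pdivrMr.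
have NT : N%:R * h = T by rewrite mulrC divfK ?gt_eqF.
suff H1 k : (k <= N)%N -> f (k%:R * h) - f 0 <= K * (k%:R * h) by have := H1 N (leqnn N); rewrite NT.
elim: k => [|k IH] kN; first by rewrite !mul0r subrr mulr0.
have E : k.+1%:R * h = k%:R * h + h by rewrite -addn1 natrD mulrDl mul1r.
have := H (k%:R * h) h; rewrite -E mulr_ge0 ?(ltW h0)// h0 hd -NT ler_pM2r// ler_nat => /(_ isT isT kN).
by have := IH (ltnW kN); rewrite E; lra.
Qed.

(** The same as constancy: a function whose short increments are uniformly o(h) does not
move. *)
Lemma increments_eq (f : R -> R[i]) (T : R) : 0 <= T ->
  (forall e : R, 0 < e -> exists2 delta, 0 < delta & forall s h, 0 <= s -> 0 < h < delta -> s + h <= T ->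
     `|f (s + h) - f s| <= (e * h)%:C) ->
  f T = f 0.
Proof.
move=> T0 H; apply/eqP; rewrite -subr_eq0 -normr_eq0.
have nR (z : R[i]) : `|z| = (complex.Re `|z|)%:C by rewrite RRe_real// normr_real.
rewrite nR fmorph_eq0 eq_le; apply/andP; split; last by rewrite -ler0c -nR.
apply/ler_addgt0Pr => e e0; rewrite add0r.
have [|d d0 Hd] := H (e / (T + 1)); first by rewrite divr_gt0// ltr_wpDl.
have := @increments_le (fun s => complex.Re `|f s - f 0|) T (e / (T + 1)) d d0 T0.
rewrite subrr normr0 subr0 => Hx; apply: (le_trans (Hx _)).
  move=> s h s0 hd sT; rewrite -lecR rmorphB /= -!nR; apply: le_trans (Hd s h s0 hd sT).
  by apply: le_trans (lerB_dist _ _) _; rewrite opprB addrA subrK.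
by rewrite mulrAC ler_pdivrMr ?ltr_wpDl// ler_wpM2l ?ltW// ltrDl.
Qed.

End Increments.

Section Markov.
Context {R : realType} {T : countType}.
Variables (rate : T -> T -> R) (nb : T -> seq T) (p : R -> T -> T -> R).
Hypotheses (tp : transition_function p) (jr : has_jump_rates rate p).
Hypothesis nb_uniq : forall x, uniq (nb x).
Hypothesis nb_irrefl : forall x, x \notin nb x.
Hypothesis rate_nb : forall x y, y \notin nb x -> rate x y = 0.
Hypothesis rate_ge0 : forall x y, 0 <= rate x y.

Let p_ge0 t x y : 0 <= t -> 0 <= p t x y. Proof. by case: tp => + _ _ _ => /(_ t x y). Qed.
Let p_sum t x : 0 <= t -> (\esum_(y in [set: T]) (p t x y)%:E = 1)%E. Proof. by case: tp => _ + _ _ => /(_ t x). Qed.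
Let p_0 x y : p 0 x y = (x == y)%:R. Proof. by case: tp => _ _ -> _. Qed.
Let p_D s t x z : 0 <= s -> 0 <= t -> ((p (s + t) x z)%:E = \esum_(y in [set: T]) (p s x y * p t y z)%:E)%E.
Proof. by case: tp => _ _ _; apply. Qed.

Lemma esum_split (f : T -> R) (s : seq T) : uniq s -> (forall y, 0 <= f y) ->
  (\esum_(y in [set: T]) (f y)%:E = (\sum_(y <- s) f y)%:E + \esum_(y in ~` [set` s]) (f y)%:E)%E.
Proof.
move=> us f0; rewrite (esumID [set` s]); last by move=> y _; rewrite lee_fin.
rewrite !setTI esum_fset; [|exact: finite_seq|by move=> y _; rewrite lee_fin].
by rewrite -fsbig_seq// sumEFin.
Qed.

Lemma sum_le1 t x (s : seq T) : uniq s -> 0 <= t -> \sum_(y <- s) p t x y <= 1.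
Proof.
move=> us t0; rewrite -lee_fin -(p_sum x t0) (@esum_split _ s)//; last by move=> y; exact: p_ge0.
by rewrite leeDl// esum_ge0// => y _; rewrite lee_fin p_ge0.
Qed.

Lemma transition_le1 t x y : 0 <= t -> p t x y <= 1.
Proof. by move=> t0; have := @sum_le1 t x [:: y] isT t0; rewrite big_seq1. Qed.

(** Truncating the Chapman-Kolmogorov sum to a finite set costs at most the probability
of having left this set. *)
Lemma chapman_kolmogorov_bounds h t x z (s : seq T) : uniq s -> 0 <= h -> 0 <= t ->
  let S := \sum_(y <- s) p h x y * p t y z in
  S <= p (h + t) x z <= S + (1 - \sum_(y <- s) p h x y).
Proof.
move=> us h0 t0; set S := \sum_(y <- s) p h x y * p t y z; rewrite /=.
have f0 y : 0 <= p h x y * p t y z by rewrite mulr_ge0 ?p_ge0.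
have g0 y : 0 <= p h x y by rewrite p_ge0.
have E1 := p_D x z h0 t0; have E2 := p_sum x h0.
rewrite (@esum_split _ s)// in E1; rewrite (@esum_split _ s)// in E2.
have BA : (\esum_(y in ~` [set` s]) (p h x y * p t y z)%:E <= \esum_(y in ~` [set` s]) (p h x y)%:E)%E.
  by apply: le_esum => y _; rewrite lee_fin ler_piMr// transition_le1.
have B0 : (0 <= \esum_(y in ~` [set` s]) (p h x y * p t y z)%:E)%E by apply: esum_ge0 => y _; rewrite lee_fin.
move: BA B0 E1 E2; case: (\esum_(y in ~` [set` s]) (p h x y * p t y z)%:E)%E => [b| |] //;
  case: (\esum_(y in ~` [set` s]) (p h x y)%:E)%E => [a| |] //.
rewrite !lee_fin => ba b0 [E1] [E2]; rewrite -/S in E1.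
by rewrite E1; lra.
Qed.

Definition exit_rate x := \sum_(y <- nb x) rate x y.
(** The backward generator, in the form that differentiates p in its starting point. *)
Definition generator (f : T -> R) x := \sum_(y <- nb x) rate x y * (f y - f x).

Lemma right_near (f : R -> R) (l : R) : f h @[h --> 0^'+] --> l ->
  forall e, 0 < e -> exists2 d, 0 < d & forall h, 0 < h < d -> `|f h - l| <= e.
Proof.
move=> /cvgrPdist_le fl e e0; have := fl e e0; rewrite near_withinE => -[d /= d0 Hd].
exists d => // h /andP[h0 hd]; rewrite distrC; apply: Hd => //=.
by rewrite sub0r normrN gtr0_norm.
Qed.

Let exit_cvg x : (1 - p h x x) / h @[h --> 0^'+] --> exit_rate x.
Proof.
have [_] := jr x.
rewrite (_ : \esum_(y in _) _ = (exit_rate x)%:E)%E; first by move/fine_cvgP => [].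
rewrite (esumID [set` nb x]); last by move=> y _; rewrite lee_fin.
rewrite [X in (_ + X)%E]esum1 ?adde0; last by move=> y [_ /= /negP yn]; rewrite rate_nb.
rewrite setIC (setIidl _).
  rewrite esum_fset; [|exact: finite_seq|by move=> y _; rewrite lee_fin].
  by rewrite -fsbig_seq// sumEFin.
by move=> y /= yn; apply: contraTN yn => /eqP ->; exact: nb_irrefl.
Qed.

Lemma near_jumps x e : 0 < e -> exists2 d, 0 < d & forall h, 0 < h < d ->
  `|(1 - p h x x) - h * exit_rate x| <= e * h /\
  forall y, y \in nb x -> `|p h x y - h * rate x y| <= e * h.
Proof.
move=> e0; have [d1 d10 H1] := right_near (@exit_cvg x) e0.
have [d2 d20 H2] : exists2 d, 0 < d & forall h, 0 < h < d -> forall y, y \in nb x -> `|p h x y - h * rate x y| <= e * h.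
  have := nb_irrefl x; elim: (nb x) => [|y s IH]; first by exists 1.
  rewrite in_cons negb_or => /andP[xy /IH[d d0 Hd]].
  have yx : y != x by rewrite eq_sym.
  have [d' d'0 Hd'] := right_near ((jr x).1 y yx) e0.
  exists (Num.min d d') => [|h /andP[h0]]; first by rewrite lt_min d0.
  rewrite lt_min => /andP[hd hd'] z; rewrite in_cons => /predU1P[->|]; last by apply: Hd; rewrite h0.
  have := Hd' h; rewrite h0 hd' => /(_ isT) B.
  have -> : p h x y - h * rate x y = (p h x y / h - rate x y) * h by rewrite mulrBl divfK ?gt_eqF// [h * _]mulrC.
  by rewrite normrM (gtr0_norm h0) ler_pM2r.
exists (Num.min d1 d2) => [|h /andP[h0]]; first by rewrite lt_min d10.
rewrite lt_min => /andP[hd1 hd2]; split; last by apply: H2; rewrite h0.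
have := H1 h; rewrite h0 hd1 => /(_ isT) B.
have -> : 1 - p h x x - h * exit_rate x = ((1 - p h x x) / h - exit_rate x) * h.
  by rewrite mulrBl divfK ?gt_eqF// [h * _]mulrC.
by rewrite normrM (gtr0_norm h0) ler_pM2r.
Qed.

(** The backward equation with an error that is uniform in time and in the target. The
rates are limits at time 0 only, and the semigroup property transports them to every
time. *)
Lemma backward_increments x e : 0 < e -> exists2 d, 0 < d & forall h t z, 0 < h < d -> 0 <= t ->
  `|p (t + h) x z - p t x z - h * generator (fun y => p t y z) x| <= e * h.
Proof.
move=> e0; pose k := (size (nb x)).+1%:R : R; have k0 : 0 < k by rewrite ltr0n.
pose e' := e / (2%:R * k); have e'0 : 0 < e' by rewrite divr_gt0// mulr_gt0.
have [d d0 Hd] := near_jumps x e'0; exists d => // h t z hd t0.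
have [A B] := Hd h hd; have h0 : 0 < h by case/andP: hd.
have := @chapman_kolmogorov_bounds h t x z (x :: nb x) _ (ltW h0) t0.
rewrite /= nb_irrefl nb_uniq => /(_ isT); rewrite !big_cons [h + t]addrC.
set S := \sum_(j <- nb x) _; set P := \sum_(j <- nb x) p h x j => /andP[L U].
have HS : `|S - h * \sum_(y <- nb x) rate x y * p t y z| <= (size (nb x))%:R * (e' * h).
  rewrite /S mulr_sumr -sumrB; apply: le_trans (ler_norm_sum _ _ _) _.
  rewrite mulr_natl -sum1_size -sumrMnr big_seq [leRHS]big_seq.
  apply: ler_sum => y yn; rewrite mulr1n mulrA -mulrBl normrM -[leRHS]mulr1.
  by apply: ler_pM => //; [exact: B|rewrite ger0_norm ?p_ge0 ?transition_le1].
have HP : `|P - h * exit_rate x| <= (size (nb x))%:R * (e' * h).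
  rewrite /P /exit_rate mulr_sumr -sumrB; apply: le_trans (ler_norm_sum _ _ _) _.
  rewrite mulr_natl -sum1_size -sumrMnr big_seq [leRHS]big_seq.
  by apply: ler_sum => y yn; rewrite mulr1n; exact: B.
have G : generator (fun y => p t y z) x = \sum_(y <- nb x) rate x y * p t y z - exit_rate x * p t x z.
  by rewrite /generator /exit_rate mulr_suml -sumrB; apply: eq_bigr => y _; rewrite mulrBr.
have kE : e * h = 2%:R * (e' * h) + 2%:R * ((size (nb x))%:R * (e' * h)).
  rewrite /e' /k -addn1 natrD; have n1 : (size (nb x))%:R + 1 != 0 :> R by rewrite natr1 pnatr_eq0.
  by field.
have C : `|((1 - p h x x) - h * exit_rate x) * p t x z| <= e' * h.
  by rewrite normrM -[leRHS]mulr1; apply: ler_pM => //; rewrite ger0_norm ?p_ge0 ?transition_le1.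
rewrite G kE; move: HS HP A C L U; rewrite !ler_norml.
set a := \sum_(y <- nb x) _ * _; set b := (size _)%:R * _; set c := e' * h.
move: (p h x x) (p t x z) (p (t + h) x z) (exit_rate x) => pxx pt pth ex.
by move=> /andP[? ?] /andP[? ?] /andP[? ?] /andP[? ?] ? ?; apply/andP; split; lra.
Qed.

(** States outside a set D closed under jumps cannot be reached from D when the exit
rates on D are bounded: on a time interval of length tau = 1 / (2 c) any bound for the
probability can be halved, hence it is 0, and the semigroup property extends this to all
times. *)
Lemma transition_unreachable (D : pred T) (c : R) z :
  (forall x, D x -> exit_rate x <= c) -> (forall x y, D x -> y \in nb x -> D y) ->
  ~~ D z -> forall t x, 0 <= t -> D x -> p t x z = 0.
Proof.
move=> Dc Dnb; pose c' := `|c| + 1; have c0 : 0 < c' by rewrite ltr_wpDl.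
have Dc' x : D x -> exit_rate x <= c'.
  by move=> /Dc /le_trans; apply; rewrite (le_trans (ler_norm c))// lerDl.
(* the factor by which a bound improves on [0, tau] is c' tau = 1 / 2 *)
pose tau := (2%:R * c')^-1; have tau0 : 0 < tau by rewrite invr_gt0 mulr_gt0.
have step z' (A : R) : ~~ D z' -> 0 <= A -> (forall t x, 0 <= t <= tau -> D x -> p t x z' <= A) ->
    forall t x, 0 <= t <= tau -> D x -> p t x z' <= A / 2%:R.
  move=> nDz A0 HA t x /andP[t0 tt] Dx; apply/ler_addgt0Pr => e e0.
  have et : 0 < e / tau by rewrite divr_gt0.
  have [d d0 Hd] := @backward_increments x (e / tau) et.
  have := @increments_le R (fun t => p t x z') t (c' * A + e / tau) d d0 t0.
  rewrite p_0; have -> : (x == z') = false by apply: contraNF nDz => /eqP <-.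
  rewrite subr0 => H; apply: le_trans (H _) _.
    move=> s h s0 hd st; have := Hd h s z' hd s0; rewrite ler_norml => /andP[_ U].
    have h0 : 0 < h by case/andP: hd.
    have G : generator (fun y => p s y z') x <= c' * A.
      apply: (@le_trans _ _ (exit_rate x * A)); last by rewrite ler_wpM2r// Dc'.
      rewrite /generator /exit_rate mulr_suml big_seq [leRHS]big_seq; apply: ler_sum => y yn.
      apply: ler_wpM2l => //; apply: (@le_trans _ _ (p s y z')); first by rewrite gerBl p_ge0.
      by apply: HA; [rewrite s0 (le_trans _ tt)// (le_trans _ st)// lerDl ltW|exact: Dnb yn].
    have := ler_wpM2l (ltW h0) G; move: U; move: (p (s + h) x z') (p s x z') (generator _ x) => ? ? ?.
    by rewrite mulrDl; lra.
  rewrite mulrDl lerD//.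
    rewrite mulrC mulrA ler_pdivlMr// mulrAC -[leRHS]mul1r ler_wpM2r//.
    by rewrite -mulrA [c' * _]mulrC -(ler_pM2r (_ : 0 < (2%:R * c')^-1)) ?invr_gt0 ?mulr_gt0// mulfK ?mul1r ?gt_eqF ?mulr_gt0.
  by rewrite mulrAC ler_pdivrMr// ler_wpM2l// ltW.
have small z' : ~~ D z' -> forall t x, 0 <= t <= tau -> D x -> p t x z' = 0.
  move=> nDz t x tt Dx; apply/le_anti; rewrite p_ge0 ?andbT; last by case/andP: tt.
  have H k : forall t x, 0 <= t <= tau -> D x -> p t x z' <= (2%:R^-1) ^+ k.
    elim: k => [|k IH] s y sP Dy; first by rewrite expr0 transition_le1//; case/andP: sP.
    by rewrite exprSr; apply: (step z' _ nDz) => //; rewrite exprn_ge0.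
  apply/ler_addgt0Pr => e e0; rewrite add0r.
  have h2 : 0 <= (2%:R^-1 : R) < 1 by apply/andP; split; lra.
  have [k hk] := expr_small h2 e0.
  by apply: le_trans hk; exact: H.
move=> nDz t x t0; have t1 : 0 <= t / tau by apply: divr_ge0 => //; exact: ltW.
have := archi_boundP t1; rewrite ltr_pdivrMr// => /ltW; move: (Num.Def.archi_bound (t / tau)) => N.
elim: N t t0 {t1} x => [|k IH] t t0 x.
  by rewrite mul0r => tl; apply: small => //; rewrite t0 (le_trans tl)// ltW.
have [tt _|tt tk] := leP t tau; first by apply: small => //; rewrite t0.
move=> Dx; have s0 : 0 <= t - tau by rewrite subr_ge0 ltW.
have : (p (tau + (t - tau)) x z)%:E = 0%E.
  rewrite (p_D _ _ (ltW tau0) s0) esum1// => y _.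
  case: (boolP (D y)) => Dy.
    by rewrite IH ?mulr0// lerBlDr (le_trans tk)// -addn1 natrD mulrDl mul1r.
  by rewrite (@small y)// ?mul0r// lexx ltW.
by rewrite addrC subrK => -[].
Qed.

Lemma eq_sum_support (V : nmodType) (s1 s2 : seq T) (f : T -> V) : uniq s1 -> uniq s2 ->
  (forall z, z \in s1 -> z \notin s2 -> f z = 0) -> (forall z, z \in s2 -> z \notin s1 -> f z = 0) ->
  \sum_(z <- s1) f z = \sum_(z <- s2) f z.
Proof.
move=> u1 u2 h1 h2; rewrite (bigID (mem s2)) /= [X in _ + X]big_seq_cond [X in _ + X]big1 ?addr0; last first.
  by move=> z /andP[]; exact: h1.
rewrite [RHS](bigID (mem s1)) /= [X in _ + X]big_seq_cond [X in _ + X]big1 ?addr0; last first.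
  by move=> z /andP[]; exact: h2.
rewrite -big_filter -[RHS]big_filter; apply: perm_big.
apply: uniq_perm; rewrite ?filter_uniq// => z.
by rewrite !mem_filter /= andbC.
Qed.

(** If v solves the forward equation on F, then the sum of v_y(s) p_(t - s)(y, z) over y
in F is constant in s, because its increments combine the forward increments of v and
the backward increments of p into an error of order e h. Leaving F has no effect as z is
then out of reach. *)
Lemma duality (F : seq T) (z : T) (v v' : T -> R -> R[i]) (t M d1 : R) : uniq F -> 0 <= t -> 0 < d1 ->
  (forall y, rate y y = 0) ->
  (forall y x s, y \in F -> x \in nb y -> x \notin F -> 0 <= s -> p s x z = 0) ->
  (forall y s, y \in F -> v' y s = \sum_(x <- F) (rate x y)%:C * v x s - (exit_rate y)%:C * v y s) ->
  (forall y s, y \in F -> 0 <= s <= t -> `|v y s| <= M%:C) ->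
  (forall y s h, y \in F -> 0 <= s -> 0 < h <= d1 -> s + h <= t -> `|v y (s + h) - v y s - h%:C * v' y s| <= (M * h ^+ 2)%:C) ->
  \sum_(y <- F) v y t * (p 0 y z)%:C = \sum_(y <- F) v y 0 * (p t y z)%:C.
Proof.
move=> uF t0 d10 rate0 out fwd vM v'M.
pose G s := \sum_(y <- F) v y s * (p (t - s) y z)%:C.
suff : G t = G 0 by rewrite /G subrr subr0.
apply: increments_eq => // e e0.
pose k := (size F).+1%:R : R; have k0 : 0 < k by rewrite ltr0n.
pose M' : R := `|M| + 1; have M'0 : 0 < M' by rewrite ltr_wpDl.
have MM : M <= M' by rewrite (le_trans (ler_norm M))// lerDl.
(* k counts the states, and each of them contributes two errors of size M' e1 h *)
pose e1 := e / (2%:R * k * M'); have e10 : 0 < e1 by rewrite divr_gt0// !mulr_gt0.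
have [d d0 Hd] : exists2 d, 0 < d & forall y, y \in F -> forall h s, 0 < h < d -> 0 <= s ->
    `|p (s + h) y z - p s y z - h * generator (fun x => p s x z) y| <= e1 * h.
  elim: (F) => [|y s [d d0 IH]]; first by exists 1.
  have [d' d'0 Hd'] := @backward_increments y e1 e10.
  exists (Num.min d d') => [|x]; first by rewrite lt_min d0.
  rewrite in_cons => /predU1P[->|xs] h u /andP[h0]; rewrite lt_min => /andP[hd hd'] u0.
    by apply: Hd' => //; rewrite h0.
  by apply: IH => //; rewrite h0.
exists (Num.min (Num.min d d1) e1) => [|s h s0 /andP[h0]]; first by rewrite !lt_min d0 d10.
rewrite !lt_min => /andP[/andP[hd h1] he] st.
pose u := t - (s + h); have u0 : 0 <= u by rewrite subr_ge0.
have us : t - s = u + h by rewrite /u; ring.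
have alg : \sum_(y <- F) (v' y s * (p u y z)%:C - v y s * (generator (fun x => p u x z) y)%:C) = 0.
  have genE y : y \in F -> generator (fun x => p u x z) y = \sum_(x <- F) rate y x * p u x z - exit_rate y * p u y z.
    move=> yF; rewrite -(@eq_sum_support _ (nb y) F)//.
    - by rewrite /generator /exit_rate mulr_suml -sumrB; apply: eq_bigr => x _; rewrite mulrBr.
    - by move=> x xn xF; rewrite (out y)// mulr0.
    - by move=> x xF xn; rewrite rate_nb// mul0r.
  rewrite big_seq (eq_bigr (fun y => \sum_(x <- F) (rate x y)%:C * v x s * (p u y z)%:C
      - \sum_(x <- F) (rate y x)%:C * v y s * (p u x z)%:C)); last first.
    move=> y yF; rewrite fwd// genE// -mulr_suml.
    have -> : \sum_(x <- F) (rate y x)%:C * v y s * (p u x z)%:C = v y s * (\sum_(x <- F) rate y x * p u x z)%:C.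
      rewrite rmorph_sum mulr_sumr; apply: eq_bigr => x _; rewrite rmorphM /=; ring.
    rewrite rmorphB rmorphM /=; ring.
  rewrite -big_seq sumrB [X in X - _]exchange_big /= subrr//.
have -> : G (s + h) - G s = \sum_(y <- F)
   ((v y (s + h) - v y s - h%:C * v' y s) * (p u y z)%:C
     - v y s * ((p (u + h) y z - p u y z - h * generator (fun x => p u x z) y)%:C)).
  rewrite /G -sumrB -[LHS]subr0 -[X in _ - X](mulr0 h%:C) -[X in h%:C * X]alg mulr_sumr -sumrB.
  apply: eq_bigr => y _; rewrite us -/u !rmorphB rmorphM /=; ring.
apply: le_trans (ler_norm_sum _ _ _) _.
apply: (@le_trans _ _ (\sum_(y <- F) (2%:R * M' * e1 * h)%:C)).
  rewrite big_seq [leRHS]big_seq; apply: ler_sum => y yF.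
  apply: le_trans (ler_normB _ _) _.
  have -> : 2%:R * M' * e1 * h = M' * e1 * h + M' * (e1 * h) by ring.
  rewrite [leRHS]rmorphD /=; apply: lerD; rewrite normrM.
    rewrite -[leRHS]mulr1; apply: ler_pM => //.
      apply: (le_trans (v'M y s h yF s0 _ st)); first by rewrite h0 ltW.
      rewrite lecR; apply: (@le_trans _ _ (M' * h ^+ 2)); first by rewrite ler_wpM2r// sqr_ge0.
      by rewrite expr2 mulrA ler_pM2r// ler_pM2l// ltW.
    by rewrite ger0_norm ?ler0c ?p_ge0// -[1]/(1%:C) lecR transition_le1.
  rewrite [leRHS]rmorphM /=; apply: ler_pM => //.
    by apply: (le_trans (vM y s yF _)); rewrite ?lecR// s0 (le_trans _ st)// lerDl ltW.
  rewrite (_ : `|_%:C| = (`|p (u + h) y z - p u y z - h * generator (fun x => p u x z) y|)%:C).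
    by rewrite lecR; apply: Hd => //; rewrite h0.
  by rewrite normc_def /= expr0n addr0 sqrtr_sqr.
rewrite -rmorph_sum /= lecR big_const_seq count_predT iter_addr_0.
have -> : 2%:R * M' * e1 * h = e * h / k by rewrite /e1; field; rewrite !gt_eqF.
rewrite -mulr_natr mulrAC ler_pdivrMr// ler_wpM2l ?mulr_ge0 ?(ltW e0) ?(ltW h0)//.
by rewrite ler_nat.
Qed.

End Markov.

(** * Products over windows and configurations on the ring *)

Section ProdExt.
Context {F : fieldType}.
Implicit Types (m n x y : int) (f h : int -> F).

Lemma prod_extE m n f : prod_ext m n f =
  if m <= n then \prod_(k < absz (n - m + 1)%R) f (m + k%:Z)
  else \prod_(k < absz (m - 1 - n)%R) (f (n + 1 + k%:Z))^-1.
Proof.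
rewrite /prod_ext; case: ifP => // mn; case: eqVneq => // ->.
by rewrite subrr big_ord0.
Qed.

Lemma prod_ext_recr m n f : f n != 0 -> prod_ext m n f = prod_ext m (n - 1) f * f n.
Proof.
move=> fn0; rewrite !prod_extE; case: (ltgtP m n) => mn.
- have -> : m <= n - 1 by lia.
  have -> : absz (n - m + 1)%R = (absz (n - 1 - m + 1)%R).+1 by lia.
  rewrite big_ord_recr /=; congr (_ * f _); lia.
- have -> : (m <= n - 1) = false by lia.
  have -> : absz (m - 1 - (n - 1))%R = (absz (m - 1 - n)%R).+1 by lia.
  rewrite big_ord_recl /= mulrC addr0 subrK mulVKf //.
  by apply: eq_bigr => k _; rewrite /bump /= add1n; congr (f _)^-1; lia.
- rewrite -mn.
  have -> : (m <= m - 1) = false by lia.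
  have -> : absz (m - m + 1)%R = 1%N by lia.
  have -> : absz (m - 1 - (m - 1))%R = 0%N by lia.
  by rewrite big_ord0 mul1r big_ord1 addr0.
Qed.

Lemma prod_ext1 m f : prod_ext m m f = f m.
Proof. by rewrite prod_extE lexx subrr big_ord1 addr0. Qed.

Variable L : nat.
Hypothesis hL : (0 < L)%N.

(** Both sides are products over a full period. *)
Lemma prod_window h x : (forall k, h (k + L%:Z) = h k) ->
  \prod_(i < L) h (x - i%:Z) = \prod_(1 <= i < L.+1) h i%:Z.
Proof.
move=> hp; have step z : \prod_(i < L) h (z + 1 - i%:Z) = \prod_(i < L) h (z - i%:Z).
  case: L hL hp => // l _ hp; rewrite big_ord_recl big_ord_recr /= mulrC; congr (_ * _).
    by apply: eq_bigr => k _; rewrite /bump /= add1n; congr h; lia.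
  by rewrite -[RHS]hp; congr h; lia.
have const z : \prod_(i < L) h (z - i%:Z) = \prod_(i < L) h (0 - i%:Z).
  elim/int_ind: z => // n IH; first by rewrite -IH -[RHS]step; apply: eq_bigr => i _; congr h; lia.
  by rewrite -IH -[LHS]step; apply: eq_bigr => i _; congr h; lia.
rewrite const -(const L%:Z) big_add1 /= big_nat_rev /= big_mkord.
by apply: eq_bigr => i _; congr h; have := ltn_ord i; lia.
Qed.

Lemma prod_ext_sub m n f (k : nat) : (forall i, f i != 0) ->
  prod_ext m n f = prod_ext m (n - k%:Z) f * \prod_(i < k) f (n - i%:Z).
Proof.
move=> f0; elim: k => [|k IH]; first by rewrite big_ord0 subr0 mulr1.
rewrite IH big_ord_recr /= prod_ext_recr// -mulrA [f _ * _]mulrC.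
by congr (prod_ext _ _ _ * _); lia.
Qed.

(** Shifting the upper end by a multiple of the period L extracts a power of the product
over one period: this absorbs the factor of D_l that involves the conductances. *)
Lemma prod_ext_shift m n f (l : int) : (forall i, f i != 0) -> (forall k, f (k + L%:Z) = f k) ->
  prod_ext m n f = prod_ext m (n - L%:Z * l) f * (\prod_(1 <= i < L.+1) f i%:Z) ^ l.
Proof.
move=> f0 fp; set P := \prod_(1 <= i < L.+1) _.
have P0 : P != 0 by rewrite prodf_seq_neq0; apply/allP => i _; exact: f0.
have st z : prod_ext m z f = prod_ext m (z - L%:Z) f * P.
  by rewrite (prod_ext_sub m z L)// prod_window.
elim/int_ind: l => [|k IH|k IH]; first by rewrite mulr0 subr0 expr0z mulr1.
  rewrite IH (st (n - L%:Z * k)) -mulrA -exprSz; congr (prod_ext _ _ _ * _); lia.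
rewrite IH; have := st (n - L%:Z * - k.+1%:Z).
have -> : n - L%:Z * - k.+1%:Z - L%:Z = n - L%:Z * - k%:Z by lia.
move=> ->; rewrite -mulrA; congr (_ * _).
by rewrite -[X in X * _]expr1z -expfzDr//; congr (P ^ _); lia.
Qed.

End ProdExt.

(** Turns a product over all ordered pairs into one over pairs i < j; used for the
antisymmetric factors of A and D. *)
Lemma prod_pairs (R : comPzSemiRingType) (n : nat) (F : 'I_n -> 'I_n -> R) :
  \prod_i \prod_j F i j = \prod_i F i i * \prod_(i < n) \prod_(j < n | (i < j)%N) (F i j * F j i).
Proof.
have E i : \prod_j F i j = F i i * (\prod_(j < n | (i < j)%N) F i j * \prod_(j < n | (j < i)%N) F i j).
  rewrite (bigD1 i)//= (bigID (fun j : 'I_n => (i < j)%N)) /=; congr (_ * (_ * _)); apply: eq_bigl => j.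
    by rewrite -val_eqE /=; lia.
  by rewrite -val_eqE /=; lia.
under eq_bigr do rewrite E; rewrite big_split /=; congr (_ * _).
under [RHS]eq_bigr do rewrite big_split /=.
rewrite !big_split /=; congr (_ * _).
by rewrite (exchange_big_dep xpredT).
Qed.

Section RingConfig.
Variables (N L : nat).
Implicit Types (x : {ffun 'I_N -> int}) (i j : 'I_N).

(** The two constraints on neighbours of the cyclic order propagate to all pairs. *)
Lemma ring_configP x : reflect
  ((forall i j, (i <= j)%N -> x j <= x i) /\ (forall i j, x i <= x j + L%:Z)) (ring_config L x).
Proof.
apply: (iffP andP) => [[/forallP H1 /forallP H2]|[H1 H2]].
  have adj i j : i.+1 = j -> x j <= x i.
    by move=> ij; have /forallP/(_ j)/implyP := H1 i; apply; apply/eqP.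
  have mono i j : (i <= j)%N -> x j <= x i.
    move=> ij.
    have H k (hk : (i + k < N)%N) : x (Ordinal hk) <= x i.
      elim: k hk => [|k IH] hk; first by rewrite (_ : Ordinal hk = i)//; apply: val_inj; rewrite /= addn0.
      have hk' : (i + k < N)%N by lia.
      by apply: le_trans (IH hk'); apply: adj; rewrite /= addnS.
    have hj : (i + (j - i) < N)%N by rewrite subnKC.
    by have := H _ hj; rewrite (_ : Ordinal hj = j)//; apply: val_inj; rewrite /= subnKC.
  split=> // i j; have N0 : (0 < N)%N by apply: leq_ltn_trans (ltn_ord i).
  have N1 : (N.-1 < N)%N by rewrite prednK.
  have /forallP/(_ (Ordinal N1))/implyP := H2 (Ordinal N0).
  rewrite /= prednK// eqxx => /(_ isT) H.
  have A := mono (Ordinal N0) i (leq0n _).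
  have B : x (Ordinal N1) <= x j by apply: mono; rewrite /= -ltnS prednK.
  by apply: le_trans A (le_trans H _); rewrite lerD2r.
split; apply/forallP => i; apply/forallP => j; apply/implyP => h; last exact: H2.
by apply: H1; rewrite -(eqP h).
Qed.

End RingConfig.

Section FiniteBoxes.
Context {N : nat}.
Implicit Types (i j : 'I_N) (l : {ffun 'I_N -> int}).

Definition bounded_vectors (M : int) : set {ffun 'I_N -> int} :=
  [set l | int_vectors N 0 l /\ forall j, l j <= M].

Lemma finite_ffun_box (M : nat) : finite_set [set l : {ffun 'I_N -> int} | forall j, (absz (l j) <= M)%N].
Proof.
pose f (h : {ffun 'I_N -> 'I_(M + M).+1}) : {ffun 'I_N -> int} := [ffun j => (h j)%:Z - M%:Z].
apply: (@sub_finite_set _ _ [set f x | x in [set: {ffun 'I_N -> 'I_(M + M).+1}]]); last exact/finite_image/finite_finset.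
move=> l /= hl; exists [ffun j => inord (absz (l j + M%:Z)%R)] => //.
apply/ffunP => j; rewrite !ffunE inordK; move: (hl j); move: (l j) => z hz; lia.
Qed.

(** The coordinates sum to 0, so an upper bound for each of them is also a lower bound.
*)
Lemma finite_bounded_vectors M : finite_set (bounded_vectors M).
Proof.
apply: sub_finite_set (finite_ffun_box (N * absz M)) => l /= [l0 lM] j.
have h1 : l j <= `|M|%N by have := lM j; lia.
have h2 : - l j <= (N * absz M)%N.
  have : \sum_i l i = 0 by exact: l0.
  rewrite (bigD1 j)//= => /eqP; rewrite addr_eq0 => /eqP ->; rewrite opprK.
  apply: (@le_trans _ _ (\sum_(i < N | i != j) (absz M)%:Z)).
    by apply: ler_sum => i _; have := lM i; lia.
  apply: (@le_trans _ _ (\sum_(i < N) (absz M)%:Z)).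
    by rewrite [leRHS](bigD1 j)//= lerDr.
  by rewrite sumr_const card_ord -mulr_natl natz PoszM.
have : (absz M <= N * absz M)%N by rewrite leq_pmull// (leq_ltn_trans _ (ltn_ord j)).
move: h1 h2; lia.
Qed.

End FiniteBoxes.

(** * Stacks of particles *)

Section Stacks.
Variables (N L : nat).
Hypothesis hL : (0 < L)%N.
Implicit Types (x : {ffun 'I_N -> int}) (i j : 'I_N).

Definition same_class (y z : int) : bool := (y == z %[mod L])%Z.

(** The only particle that can lie directly under i is its cyclic successor; this is
whether it does, so that the bottom particles are those with [~~ below x i]. *)
Definition below x i : bool := directly_above L x i (ordS i).

Lemma directly_above_ordS x i j : directly_above L x i j -> j = ordS i.
Proof.
move=> h; apply/val_inj; rewrite /=; case/orP: h => [/andP[/eqP h _]|/and3P[/eqP h /eqP h' _]].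
  by rewrite modn_small h.
by rewrite h h' modnn.
Qed.

Lemma is_top_ordS x i : is_top L x (ordS i) = ~~ below x i.
Proof.
apply/forallP/idP => [/(_ i)//|h k]; apply: contra h => h.
have ik : i = k by apply: (can_inj (@ordSK N)); exact: directly_above_ordS h.
by subst k.
Qed.

Lemma is_top_pred x j : is_top L x j = ~~ below x (ord_pred j).
Proof. by rewrite -is_top_ordS ord_predK. Qed.

Section Config.
Variables (x : {ffun 'I_N -> int}).
Hypothesis cx : ring_config L x.

Let mono i j : (i <= j)%N -> x j <= x i. Proof. by have /ring_configP[h _] := cx; exact: h. Qed.
Let wrap i j : x i <= x j + L%:Z. Proof. by have /ring_configP[_ h] := cx; exact: h. Qed.

Lemma belowP i : below x i = if (i.+1 < N)%N then x i == x (ordS i) else x (ordS i) == x i + L%:Z.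
Proof.
rewrite /below /directly_above /=; have iN := ltn_ord i.
case: ltnP => h; first by rewrite modn_small// eqxx (ltn_eqF h) /= orbF.
have E : i.+1 = N by lia.
have N0 : (N == 0%N) = false by lia.
by rewrite E modnn !eqxx N0.
Qed.

(** All positions lie in a window of length L, whose two ends are in the same class. *)
Lemma same_class_cases i j : same_class (x i) (x j) -> [\/ x i = x j, x i = x j + L%:Z | x j = x i + L%:Z].
Proof.
rewrite /same_class eqz_mod_dvd => /dvdzP[d E]; have h1 := wrap i j; have h2 := wrap j i.
have : (d <= 1) && (-1 <= d).
  have L0 : 0 < L%:Z by rewrite ltz_nat.
  by rewrite -(ler_pM2r L0) -[-1 <= d](ler_pM2r L0) -E; apply/andP; split; lia.
move=> /andP[d1 d2]; have [dE|[dE|dE]] : d = -1 \/ (d = 0 \/ d = 1) by lia.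
- by apply: Or33; move: E; rewrite dE; lia.
- by apply: Or31; move: E; rewrite dE; lia.
- by apply: Or32; move: E; rewrite dE; lia.
Qed.

(** The order of a stack, from the top: a stack that straddles the end of the ring has
its last particles, at position z, above its first ones, at z + L, which is why
positions are compared before indices. *)
Definition above_eq i j : bool := (x i < x j) || ((x i == x j) && (i <= j)%N).
(** The position of i in its stack, counted from the top. *)
Definition height i : nat := #|[pred j | same_class (x j) (x i) && above_eq j i]|.

Let last_ord i : exists2 j : 'I_N, j.+1 = N & (i <= j)%N.
Proof.
have N0 : (0 < N)%N by exact: leq_ltn_trans (ltn_ord i).
have h : (N.-1 < N)%N by rewrite prednK.
by exists (Ordinal h) => /=; [rewrite prednK|have := ltn_ord i; lia].
Qed.

Let next_ord i : (i.+1 < N)%N -> (ordS i = i.+1 :> nat).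
Proof. by move=> h; rewrite /= modn_small. Qed.

Let next_last i : i.+1 = N -> (ordS i = 0%N :> nat).
Proof. by move=> h; rewrite /= h modnn. Qed.

Lemma bottom_above_eq i j : ~~ below x i -> same_class (x j) (x i) -> above_eq j i.
Proof.
move=> nb sc; apply: contraT; rewrite /above_eq negb_or -leNgt => /andP[xij nji].
case/negP: nb; rewrite belowP.
have [last lastE il] := last_ord i; have lm := mono il.
have iN := ltn_ord i; have jN := ltn_ord j.
have [E|E|E] := same_class_cases sc.
- have ij : (i < j)%N by move: nji; rewrite E eqxx /= -ltnNge.
  have iN1 : (i.+1 < N)%N by lia.
  rewrite iN1; have h := next_ord iN1; rewrite eq_le -{1}E !mono ?h//.
- have h1 := wrap (ordS i) last; have jl : (j <= last)%N by lia.
  have z0 : (0 < N)%N by lia.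
  have h2 : x j <= x (Ordinal z0) by apply: mono.
  have h3 := wrap (Ordinal z0) last.
  case: ltnP => iN1.
    have h := next_ord iN1.
    have sl : x last <= x (ordS i) by apply: mono; rewrite h; lia.
    have si : x (ordS i) <= x i by apply: mono; rewrite h; lia.
    by apply/eqP; lia.
  have iE : i.+1 = N by lia.
  have -> : ordS i = Ordinal z0 by apply: val_inj; rewrite [LHS](next_last iE).
  by apply/eqP; lia.
- by move: xij; rewrite E; lia.
Qed.

Lemma height_bottom i : ~~ below x i -> height i = occupation L x (x i).
Proof.
move=> nb; apply: eq_card => j; rewrite !inE /same_class.
by case: (boolP (_ == _ %[mod _])%Z) => //= sc; exact: bottom_above_eq.
Qed.

Lemma height_next i : below x i -> height (ordS i) = (height i).+1.
Proof.
move=> bi; have scS : same_class (x (ordS i)) (x i).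
  move: bi; rewrite belowP /same_class; case: ltnP => _ /eqP.
    by move=> ->.
  by move=> ->; rewrite modzDr.
rewrite /height (cardD1 (ordS i)) !inE {1}/same_class eqxx /= {1}/above_eq eqxx leqnn orbT add1n; congr _.+1.
apply: eq_card => j; rewrite !inE.
have -> : same_class (x j) (x (ordS i)) = same_class (x j) (x i) by rewrite /same_class (eqP scS).
rewrite andbCA; case: (boolP (same_class (x j) (x i))) => //= sc.
have iN := ltn_ord i; have jN := ltn_ord j; have [last lastE il] := last_ord i.
move: bi; rewrite belowP /above_eq -val_eqE; case: ltnP => iN1 /eqP E.
  have jE : (j : nat) = i.+1 -> x j = x i.
    by move=> h; rewrite E; congr (x _); apply: val_inj; rewrite [RHS](next_ord iN1).
  rewrite -E /= modn_small//; move: jE; case: (ltgtP (x j) (x i)) => /= xji jE.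
  - by rewrite andbT; apply/eqP => h; move: (jE h) xji => ->; rewrite ltxx.
  - by rewrite andbF.
  - by lia.
have iE : i.+1 = N by lia.
have n0 := next_last iE.
have ji : (j <= i)%N by lia.
have xji : x i <= x j by apply: mono.
have jE : (j : nat) = 0%N -> x j = x i + L%:Z.
  by move=> h; rewrite -E; congr (x _); apply: val_inj; rewrite [RHS]n0.
rewrite E ji andbT [val (ordS i)]n0 n0 /=.
move: jE; have [F|F|F] := same_class_cases sc; rewrite F => jE.
- rewrite ltxx eqxx /=; case: (posnP j) => [/jE|_]; first by lia.
  by rewrite ltrDl ltz_nat hL.
- rewrite ltxx eqxx /= leqn0; case: eqP => //= _; lia.
- by move: xji; rewrite F; lia.
Qed.

Lemma height_top i : is_top L x i -> height i = 1%N.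
Proof.
rewrite is_top_pred belowP ord_predK => top.
rewrite /height (cardD1 i) !inE {1}/same_class eqxx /= {1}/above_eq eqxx leqnn orbT.
rewrite eq_card0// => j; rewrite !inE; apply/negbTE/negP => /and3P[ji sc].
have iN := ltn_ord i; have jN := ltn_ord j; have [last lastE il] := last_ord i.
have pE : (ord_pred i = (i + N).-1 %% N :> nat)%N by [].
move: ji; rewrite -val_eqE /= /above_eq => ji.
have lj : x last <= x j by apply: mono; lia.
case: (posnP i) => i0.
  have predE : ord_pred i = last.
    apply: val_inj; rewrite [LHS]pE i0 add0n modn_small; last by rewrite prednK//; lia.
    by have := lastE; rewrite /=; lia.
  move: top; rewrite predE lastE ltnn => /eqP top.
  case/orP => [xji|/andP[_]]; last by rewrite i0 leqn0; move: ji; rewrite i0 => /negbTE ->.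
  have [F|F|F] := same_class_cases sc; try lia.
  have xl := wrap i last; apply: top; lia.
have predE : (ord_pred i = i.-1 :> nat).
  by rewrite pE -subn1 -addnBAC// subn1 modnDr modn_small//; lia.
have pN : ((ord_pred i).+1 < N)%N by rewrite predE; lia.
move: top; rewrite pN => /eqP top.
have pi : x i <= x (ord_pred i) by apply: mono; rewrite predE; lia.
case/orP => [xji|/andP[/eqP xji lij]].
  have [F|F|F] := same_class_cases sc; try lia.
  have z0 : (0 < N)%N by lia.
  have h0 := wrap (Ordinal z0) last; have h1 : x (ord_pred i) <= x (Ordinal z0) by apply: mono.
  apply: top; lia.
have pj : x (ord_pred i) <= x j by apply: mono; rewrite predE; lia.
apply: top; lia.
Qed.

(** Undoing a jump: the particle moved back must be a bottom particle, as an arriving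
particle is placed at the bottom. *)
Lemma ring_config_unjump j : ~~ below x j -> ring_config L [ffun k => x k - (k == j)%:Z].
Proof.
rewrite belowP => nb; apply/ring_configP.
have jN := ltn_ord j; have [last lastE jl] := last_ord j.
split=> [i k ik|i k]; rewrite !ffunE.
  have h := mono ik; case: (eqVneq i j) => [ij|_]; last by case: (k == j); lia.
  subst i; case: (eqVneq k j) => [_|kj]; first lia.
  have jk : (j < k)%N by rewrite ltn_neqAle ik andbT eq_sym.
  have kN := ltn_ord k; have jN1 : (j.+1 < N)%N by lia.
  move: nb; rewrite jN1 => /eqP nb.
  have h1 : x (ordS j) <= x j by apply: mono; rewrite (next_ord jN1).
  have h2 : x k <= x (ordS j) by apply: mono; rewrite (next_ord jN1).
  by lia.
have h := wrap i k; case: (eqVneq k j) => [kj|_]; last by case: (i == j); lia.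
subst k; case: (eqVneq i j) => [_|ij]; first lia.
suff : x i != x j + L%:Z by lia.
apply/eqP => E.
have z0 : (0 < N)%N by lia.
have h0 : x i <= x (Ordinal z0) by apply: mono.
have h1 := wrap (Ordinal z0) last; have h2 : x last <= x j by apply: mono.
move: nb; case: ltnP => jN1 /eqP.
  have h3 : x (ordS j) <= x j by apply: mono; rewrite (next_ord jN1).
  have h4 : x last <= x (ordS j) by apply: mono; rewrite (next_ord jN1); lia.
  by lia.
have jE : j.+1 = N by lia.
have -> : ordS j = Ordinal z0 by apply: val_inj; rewrite [LHS](next_last jE).
by lia.
Qed.

(** A particle that comes from the site behind was the top one there, so undoing a jump
gives a configuration from which the jump is possible. *)
Lemma is_top_unjump j : is_top L [ffun k => x k - (k == j)%:Z] j.
Proof.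
rewrite is_top_pred; apply/negP; rewrite /below ord_predK /directly_above !ffunE eqxx => h.
have jN := ltn_ord j; case: (eqVneq (ord_pred j) j) h => [pj|pj].
  by rewrite pj eqn_leq ltnn /= => /and3P[_ _ /eqP]; lia.
move=> /orP[/andP[/eqP h1 /eqP h2]|/and3P[_ _ /eqP h]].
  by have := mono (ltnW (eq_leq h1)); lia.
by have := wrap j (ord_pred j); lia.
Qed.

Lemma ring_config_jump j : is_top L x j -> ring_config L (jump x j).
Proof.
rewrite is_top_pred belowP ord_predK => top; apply/ring_configP.
have jN := ltn_ord j; have [last lastE jl] := last_ord j.
have pE : (ord_pred j = (j + N).-1 %% N :> nat)%N by [].
have predE : (0 < j)%N -> (ord_pred j = j.-1 :> nat).
  by move=> j0; rewrite pE -subn1 -addnBAC// subn1 modnDr modn_small//; lia.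
have pred0 : (j = 0%N :> nat) -> ord_pred j = last.
  move=> j0; apply: val_inj; rewrite [LHS]pE j0 add0n modn_small; last by rewrite prednK//; lia.
  by have := lastE; rewrite /=; lia.
split=> [i k ik|i k]; rewrite !ffunE.
  have h := mono ik; case: (eqVneq k j) => [kj|_]; last by case: (i == j); lia.
  subst k; case: (eqVneq i j) => [_|ij]; first lia.
  have ij' : (i < j)%N by rewrite ltn_neqAle ij.
  have j0 : (0 < j)%N by lia.
  have pN : ((ord_pred j).+1 < N)%N by rewrite predE; lia.
  move: top; rewrite pN => /eqP top.
  have h1 : x j <= x (ord_pred j) by apply: mono; rewrite predE; lia.
  have h2 : x (ord_pred j) <= x i by apply: mono; rewrite predE; lia.
  by lia.
have h := wrap i k; case: (eqVneq i j) => [ij|_]; last by case: (k == j); lia.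
subst i; case: (eqVneq k j) => [_|kj]; first lia.
suff : x j != x k + L%:Z by lia.
apply/eqP => E.
have z0 : (0 < N)%N by lia.
have h2 : x last <= x k by apply: mono; have := ltn_ord k; lia.
have h1 := wrap (Ordinal z0) last; have h0 : x j <= x (Ordinal z0) by apply: mono.
case: (posnP j) => j0.
  by move: top; rewrite (pred0 j0) lastE ltnn => /eqP; have := wrap j last; lia.
have pN : ((ord_pred j).+1 < N)%N by rewrite predE; lia.
move: top; rewrite pN => /eqP top.
have h3 : x j <= x (ord_pred j) by apply: mono; rewrite predE; lia.
have h4 : x (ord_pred j) <= x (Ordinal z0) by apply: mono.
by lia.
Qed.

Lemma below_jump j : ~~ below (jump x j) j.
Proof.
apply/negP; rewrite /below /directly_above !ffunE eqxx => h.
have jN := ltn_ord j; case: (eqVneq (ordS j) j) h => [pj|pj].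
  by rewrite pj eqn_leq ltnn /= => /and3P[_ _ /eqP]; lia.
move=> /orP[/andP[/eqP h1 /eqP h2]|/and3P[_ _ /eqP h]].
  by have := mono (ltnW (eq_leq h1)); lia.
by have := wrap (ordS j) j; lia.
Qed.

End Config.

Section StackSums.
Variables (F : fieldType) (z : F).
Hypothesis z1 : z != 1.

(** The q-integer [k]_q, over an arbitrary field so that it can be taken at q and at its
image in the complex numbers. *)
Definition qnum (k : nat) : F := (1 - z ^+ k) / (1 - z).

Lemma qnum1 : qnum 1 = 1.
Proof. by rewrite /qnum expr1 divff// subr_eq0 eq_sym. Qed.

Lemma qnumS k : qnum k.+1 = 1 + z * qnum k.
Proof. by rewrite /qnum exprS; field; rewrite subr_eq0 eq_sym. Qed.

(** When quantities decrease by the factor z on going up one level, the sum over a stack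
of n particles is [n]_z times the value at the bottom. The proof is an Abel summation in
the height counted from the top: height_(i+1) = height_i + 1 turns into [h + 1]_z = 1 +
z [h]_z. *)
Lemma stack_sum x (B : 'I_N -> F) : ring_config L x ->
  (forall i, below x i -> B i = z * B (ordS i)) ->
  \sum_i B i = \sum_(i | ~~ below x i) qnum (occupation L x (x i)) * B i.
Proof.
move=> cx hB; have ordS_inj : injective (@ordS N) := can_inj (@ordSK N).
have E1 : \sum_i qnum (height x i) * B i = \sum_i B i + \sum_(i | below x i) qnum (height x i) * B i.
  rewrite (reindex_inj ordS_inj) [X in _ = X + _](reindex_inj ordS_inj) /=.
  rewrite [RHS]addrC (big_mkcond (below x)) -big_split; apply: eq_bigr => i _ /=.
  case: (boolP (below x i)) => bi; last by rewrite height_top ?is_top_ordS// qnum1 mul1r add0r.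
  by rewrite height_next// qnumS (hB i bi); ring.
move: E1; rewrite (bigID (below x)) /= addrC => /addIr <-.
by apply: eq_bigr => i bi; rewrite height_bottom.
Qed.

(** Rates are attached to top particles and the forward equation to bottom ones;
quantities constant along stacks do not see the difference. *)
Lemma top_bottom_sum x (phi : 'I_N -> F) : (forall i, below x i -> phi (ordS i) = phi i) ->
  \sum_(j | is_top L x j) phi j = \sum_(i | ~~ below x i) phi i.
Proof.
move=> h; have ordS_inj : injective (@ordS N) := can_inj (@ordSK N).
rewrite (reindex_inj ordS_inj) /=; under eq_bigl do rewrite is_top_ordS.
apply: (@addrI _ (\sum_(i | below x i) phi i)).
transitivity (\sum_i phi i); last by rewrite (bigID (below x)).
rewrite [RHS](reindex_inj ordS_inj) [RHS](bigID (below x)) /=; congr (_ + _).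
by apply: eq_bigr => i /h.
Qed.

End StackSums.

Section Weights.
Variables (R : realType) (q : R).
Hypothesis hq : 0 < q < 1.

Lemma occupation_same n (x : {ffun 'I_n -> int}) (k h : int) : same_class k h -> occupation L x k = occupation L x h.
Proof. by move=> /eqP kh; apply: eq_card => j; rewrite !inE kh. Qed.

Lemma occupation_lift n (x : {ffun 'I_n -> int}) (j : 'I_n) (k : int) :
  occupation L x k = (occupation L [ffun h => x (lift j h)] k + same_class (x j) k)%N.
Proof.
rewrite /occupation -!sum1_card big_mkcond (bigD1_ord j)//= addnC; congr (_ + _)%N.
  by rewrite [RHS]big_mkcond; apply: eq_bigr => h _; rewrite !inE ffunE.
Qed.

(** Adding one particle in the class of z multiplies W by the q-integer of the new
occupation of this class. *)
Lemma weight_insert n m (x : {ffun 'I_n -> int}) (V : {ffun 'I_m -> int}) (z : int) :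
  (forall k, occupation L x k = (occupation L V k + same_class z k)%N) ->
  weight L q x = weight L q V * qnum q (occupation L V z).+1.
Proof.
move=> H; pose i0 := (absz ((z - 1) %% L)%Z).+1.
have L0 : L%:Z != 0 by lia.
have m0 := modz_ge0 (z - 1) L0; have m1 := @ltz_pmod (z - 1) L%:Z (ltac:(lia)).
have i0z : i0%:Z = ((z - 1) %% L)%Z + 1 by rewrite /i0; lia.
have i0c : same_class z i0%:Z by rewrite /same_class i0z modzDml subrK.
have i0in : i0 \in index_iota 1 L.+1 by rewrite mem_index_iota; lia.
have uniq_i0 (i : nat) : i \in index_iota 1 L.+1 -> same_class z i%:Z -> i = i0.
  rewrite mem_index_iota => /andP[i1 iL]; rewrite /same_class (eqP i0c) eqz_mod_dvd => /dvdzP[d E].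
  have : (d < 1) && (-1 < d).
    have L1 : 0 < L%:Z by lia.
    by rewrite -(ltr_pM2r L1) -[-1 < d](ltr_pM2r L1) -E; apply/andP; split; lia.
  move=> /andP[d1 d2]; have d0 : d = 0 by clear -d1 d2; lia.
  by move: E => /eqP; rewrite d0 mul0r subr_eq0 => /eqP[->].
rewrite /weight !(bigD1_seq i0) ?iota_uniq//= H i0c addn1.
rewrite /q_factorial big_nat_recr//= -/(q_factorial q _) (occupation_same V i0c) /qnum.
rewrite mulrAC; congr (_ * _ * _).
rewrite big_seq_cond [RHS]big_seq_cond; apply: eq_bigr => i /andP[iin ii0].
rewrite H; case: (boolP (same_class z i%:Z)) => [/(uniq_i0 _ iin) E|_]; last by rewrite addn0.
by rewrite E eqxx in ii0.
Qed.

(** The two configurations have the same other particles, so both weights come from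
[weight_insert] applied to the common remainder. *)
Lemma weight_unjump x j : let x' := [ffun k => x k - (k == j)%:Z] in
  weight L q x * (1 - q ^+ occupation L x' (x j - 1)) = weight L q x' * (1 - q ^+ occupation L x (x j)).
Proof.
move=> x'; pose V := [ffun h => x (lift j h)].
have V' : [ffun h => x' (lift j h)] = V.
  by apply/ffunP => h; rewrite !ffunE eq_sym (negPf (neq_lift _ _)) subr0.
have x'j : x' j = x j - 1 by rewrite ffunE eqxx.
have o1 k := occupation_lift x j k; have o2 k := occupation_lift x' j k.
rewrite -/V in o1; rewrite V' x'j in o2.
rewrite (weight_insert o1) (weight_insert o2) o1 o2 /same_class !eqxx !addn1 /qnum.
set A := 1 - q ^+ _; set B := 1 - q ^+ _; ring.
Qed.

Lemma weight_gt0 n (x : {ffun 'I_n -> int}) : 0 < weight L q x.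
Proof.
case/andP: hq => q0 q1; apply: prodr_gt0 => i _; rewrite /q_factorial big_seq; apply: prodr_gt0 => k.
rewrite mem_index_iota => /andP[k0 _]; rewrite divr_gt0 ?subr_gt0// exprn_ilt1// ?(ltW q0)//.
by rewrite -lt0n.
Qed.

End Weights.
End Stacks.

(** * Permutations preserving the stacks *)

Section StabSum.
Variables (L : nat).
Hypothesis hL : (0 < L)%N.
Context {R : realType}.
Variables (q : R).
Hypothesis hq : 0 < q < 1.

Let q1 : q != 1. Proof. by case/andP: hq => _ h; rewrite lt_eqF. Qed.

(** Permutations of n + 1 points with prescribed value k at 0 are the liftings of the
permutations of n points. *)
Lemma perm_recl_bij n (k : 'I_n.+1) : {on [pred s : 'S_n.+1 | s ord0 == k], bijective (lift_perm ord0 k)}.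
Proof.
pose d (s : 'S_n.+1) (h : 'I_n) : 'I_n := odflt h (unlift (s ord0) (s (lift ord0 h))).
have dK (s : 'S_n.+1) h : lift (s ord0) (d s h) = s (lift ord0 h).
  rewrite /d; case: unliftP => [? -> //|/perm_inj/eqP].
  by rewrite eq_sym (negPf (neq_lift _ _)).
have d_inj (s : 'S_n.+1) : injective (d s).
  by move=> h1 h2 /(congr1 (lift (s ord0))); rewrite !dK => /perm_inj/lift_inj.
exists (fun s => perm (@d_inj s)) => [s _|s /eqP sk].
  apply/permP => h; rewrite permE; apply: (@lift_inj _ k).
  by have := dK (lift_perm ord0 k s) h; rewrite lift_perm_id lift_perm_lift.
apply/permP => h; case: (unliftP ord0 h) => [h' ->|->]; last by rewrite lift_perm_id sk.
by rewrite lift_perm_lift permE -sk dK.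
Qed.

(** Particles of a class occupy an interval of indices; this is achieved by sorting and
makes inversions within a class easy to count. *)
Definition contiguous n (x : {ffun 'I_n -> int}) := forall i j k : 'I_n,
  (i <= j)%N -> (j <= k)%N -> same_class L (x i) (x k) -> same_class L (x i) (x j).

Definition stab n (x : {ffun 'I_n -> int}) (s : 'S_n) := [forall i, same_class L (x (s i)) (x i)].

Definition inv_weight n (x : {ffun 'I_n -> int}) (s : 'S_n) : R :=
  \prod_(i < n) \prod_(j < n | (i < j)%N) (if same_class L (x i) (x j) && (s j < s i)%N then - q else 1).

Lemma sum_geom (m : nat) : \sum_(k < m) q ^+ k = qnum q m.
Proof.
by apply: (mulfI (_ : 1 - q != 0)); rewrite ?subr_eq0 1?eq_sym// mulrC /qnum mulrCA mulfV ?subr_eq0 1?eq_sym// mulr1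
  mulrC -[1 - q]opprB mulNr -subrX1 opprB.
Qed.

(** With signs cancelled, this is the generating function of inversions on a product of
symmetric groups, by induction on the number of points: the image k of the first point
contributes q^k, and k runs over the first class, giving its q-integer. *)
Lemma stab_sum n (x : {ffun 'I_n -> int}) : contiguous x ->
  \sum_(s : 'S_n | stab x s) (-1) ^+ s * inv_weight x s = weight L q x.
Proof.
elim: n x => [|n IH] x cont.
  rewrite (big_pred1 1%g) => [|s].
    rewrite odd_perm1 expr0 mul1r /inv_weight big_ord0 /weight big1// => i _.
    by rewrite /q_factorial (_ : occupation _ _ _ = 0%N) ?big_geq//; apply: eq_card0; case.
  rewrite /= (_ : s = 1%g); last by apply/permP; case.
  by rewrite eqxx; apply/forallP; case.
pose x' : {ffun 'I_n -> int} := [ffun h => x (lift ord0 h)].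
have cont' : contiguous x'.
  move=> i j k ij jk; rewrite !ffunE; apply: cont => /=; rewrite /bump /=; lia.
pose A := [pred k : 'I_n.+1 | same_class L (x ord0) (x k)].
have lowA (k h : 'I_n.+1) : k \in A -> (h <= k)%N -> h \in A by move=> kA hk; apply: (cont _ _ k).
have xlift (k : 'I_n.+1) (h : 'I_n) : k \in A -> (x (lift k h) %% L)%Z = (x' h %% L)%Z.
  rewrite inE ffunE => kA; case: (leqP k h) => kh.
    suff -> : lift k h = lift ord0 h by [].
    by apply: val_inj; rewrite /= /bump kh.
  have h1 : lift k h \in A by apply: lowA kA _; rewrite /= /bump; lia.
  have h2 : lift ord0 h \in A by apply: lowA kA _; rewrite /= /bump /=; lia.
  by move: h1 h2; rewrite !inE /same_class => /eqP <- /eqP <-.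
have stabE (k : 'I_n.+1) (s : 'S_n) : k \in A -> stab x (lift_perm ord0 k s) = stab x' s.
  move=> kA; apply/forallP/forallP => H i.
    have := H (lift ord0 i); rewrite lift_perm_lift /same_class xlift//.
    by rewrite [x' i]ffunE.
  case: (unliftP ord0 i) => [h ->|->]; last by rewrite lift_perm_id /same_class eq_sym.
  by rewrite lift_perm_lift /same_class xlift//; have := H h; rewrite /same_class [x' h]ffunE.
have inv0 (k : 'I_n.+1) (s : 'S_n) : k \in A -> stab x' s ->
    inv_weight x (lift_perm ord0 k s) = (- q) ^+ k * inv_weight x' s.
  move=> kA /forallP st; rewrite /inv_weight big_ord_recl; congr (_ * _).
    rewrite big_mkcond big_ord_recl /= mul1r.
    under eq_bigr do rewrite lift_perm_id lift_perm_lift.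
    rewrite (eq_bigr (fun h : 'I_n => if (lift k (s h) < k)%N then - q else 1)); last first.
      move=> h _; case: (ltnP (lift k (s h)) k) => lk; last by rewrite andbF.
      have : lift k (s h) \in A by apply: lowA kA _; exact: ltnW.
      rewrite inE /same_class xlift// andbT (eqP (st h)) ffunE => ->.
      by [].
    transitivity (\prod_(h < n) (if (lift k h < k)%N then - q else 1)).
      by rewrite [RHS](reindex_inj (@perm_inj _ s)).
    have kn : (k <= n)%N by rewrite -ltnS.
    rewrite -big_mkcond /= (eq_bigl (fun h : 'I_n => (h < k)%N)); last first.
      by move=> h; rewrite /= /bump; case: leqP => ? /=; lia.
    by rewrite -(big_ord_widen n (fun=> - q) kn) prodr_const card_ord.
  apply: eq_bigr => i _; rewrite big_mkcond big_ord_recl /= mul1r [RHS]big_mkcond.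
  apply: eq_bigr => j _; rewrite !lift_perm_lift !ffunE /= /bump.
  rewrite (_ : (1 + i < 1 + j)%N = (i < j)%N) ?ltn_add2l//.
  by rewrite (_ : ((k <= s j) + s j < (k <= s i) + s i)%N = (s j < s i)%N)//; lia.
rewrite (partition_big (fun s : 'S_n.+1 => s ord0) (mem A)) /=; last first.
  by move=> s /forallP/(_ ord0); rewrite inE /same_class eq_sym.
have V k : k \in A -> \sum_(s : 'S_n.+1 | stab x s && (s ord0 == k)) (-1) ^+ s * inv_weight x s
    = q ^+ k * weight L q x'.
  move=> kA; rewrite -(IH _ cont') mulr_sumr (reindex (lift_perm ord0 k)) /=; last first.
    by have := perm_recl_bij k; apply: subon_bij => s /andP[].
  apply: eq_big => [s|s]; first by rewrite lift_perm_id eqxx andbT stabE.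
  rewrite lift_perm_id eqxx andbT stabE// => st; rewrite inv0//.
  rewrite odd_lift_perm /= signr_addb [(- q) ^+ k]exprNn -[(-1) ^+ nat_of_ord k]signr_odd.
  have := sqrr_sign R (odd k); move: ((-1) ^+ odd k) ((-1) ^+ s) (q ^+ k) (inv_weight x' s) => y z t u y2.
  by transitivity (y ^+ 2 * (t * (z * u))); [ring|rewrite y2 mul1r].
rewrite (eq_bigr _ V) -mulr_suml.
have H0 := occupation_lift L x ord0.
rewrite (weight_insert hL hq H0) mulrC; congr (_ * _).
have cardA : #|A| = (occupation L x' (x ord0)).+1.
  have -> : (occupation L x' (x ord0)).+1 = occupation L x (x ord0).
    by rewrite H0 /same_class eqxx addn1.
  by apply: eq_card => k; rewrite !inE /same_class eq_sym.
have AE k : (k \in A) = (k < #|A|)%N.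
  have cardlt (m : nat) : (m <= n.+1)%N -> #|[pred h : 'I_n.+1 | (h < m)%N]| = m.
    by move=> mn; rewrite -sum1_card -[RHS]card_ord -[RHS]sum1_card (big_ord_widen n.+1 (fun=> 1%N) mn).
  apply/idP/idP => [kA|].
    rewrite -(cardlt k.+1)//; apply: subset_leq_card; apply/fintype.subsetP => h.
    by rewrite inE ltnS; exact: lowA kA.
  apply: contraTT => kA; rewrite -leqNgt -[leqRHS](cardlt k (ltnW (ltn_ord k))).
  apply: subset_leq_card; apply/fintype.subsetP => h hA; rewrite inE ltnNge.
  by apply: contra kA; exact: lowA hA.
rewrite -cardA -sum_geom (big_ord_widen n.+1 (fun k => q ^+ k)); last first.
  by rewrite -[leqRHS](card_ord n.+1) max_card.
by apply: eq_bigl => k; rewrite AE.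
Qed.

Lemma sort_perm (n : nat) (le : rel 'I_n) : total le -> transitive le ->
  exists t : 'S_n, forall i j : 'I_n, (i < j)%N -> le (t i) (t j).
Proof.
move=> tot tr; pose s := sort le (enum 'I_n).
have us : uniq s by rewrite sort_uniq enum_uniq.
have ss : size s = n by rewrite size_sort size_enum_ord.
have inj : injective (fun i : 'I_n => nth i s i).
  move=> i j; rewrite (set_nth_default j) ?ss// => /eqP.
  by rewrite nth_uniq ?ss// => /eqP/val_inj.
exists (perm inj) => i j ij; rewrite !permE (set_nth_default j) ?ss//.
by apply: (sorted_ltn_nth tr) => //; rewrite ?inE ?ss//; exact: sort_sorted.
Qed.

(** For a symmetric f the product runs over unordered pairs. *)
Lemma prod_pairs_perm (n : nat) (f : 'I_n -> 'I_n -> R) (t : 'S_n) : (forall i j, f i j = f j i) ->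
  \prod_(i < n) \prod_(j < n | (i < j)%N) f i j = \prod_(i < n) \prod_(j < n | (i < j)%N) f (t i) (t j).
Proof.
move=> sym; pose F i j := if ((t^-1)%g i < (t^-1)%g j)%N then f i j else 1.
transitivity (\prod_i \prod_j F i j).
  rewrite prod_pairs [X in _ = X * _]big1 ?mul1r => [|i _]; last by rewrite /F ltnn.
  apply: eq_bigr => i _; apply: eq_bigr => j ij; rewrite /F.
  have nij : (t^-1)%g i != (t^-1)%g j :> nat.
    by rewrite (inj_eq val_inj) (inj_eq perm_inj) -val_eqE /= ltn_eqF.
  by case: ltngtP nij => // _ _; rewrite ?mulr1 ?mul1r.
rewrite (reindex_inj (@perm_inj _ t)); apply: eq_bigr => i _.
rewrite (reindex_inj (@perm_inj _ t)) [RHS]big_mkcond; apply: eq_bigr => j _.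
by rewrite /F !permK.
Qed.

Section ConfigStab.
Variables (N : nat) (X : {ffun 'I_N -> int}).
Hypothesis cX : ring_config L X.

(** The exponent left at the initial time: for the vector l solving x_(s^-1 j) - L l_j =
x_j, the exponent [ainv] is a difference of two such numbers, see [sum_coef_initial]. *)
Definition height_diff (i j : 'I_N) : int := ((X i - X j) %/ L)%Z + (j < i)%N%:Z.

Let mono (i j : 'I_N) : (i <= j)%N -> X j <= X i. Proof. by have /ring_configP[h _] := cX; exact: h. Qed.
Let wrap (i j : 'I_N) : X i <= X j + L%:Z. Proof. by have /ring_configP[_ h] := cX; exact: h. Qed.

(** Within a class the relative position in the stack is all that remains. *)
Lemma height_diff_same (i j : 'I_N) : i != j -> same_class L (X i) (X j) ->
  height_diff i j = (above_eq X j i)%:Z.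
Proof.
move=> ij sc; have L0 : L%:Z != 0 by lia.
rewrite /height_diff /above_eq; have nij : (i : nat) != j by [].
case: (ltnP j i) => ji.
  have h := mono (ltnW ji); have [E|E|E] := same_class_cases hL cX sc; rewrite E.
  - by rewrite subrr div0z eqxx ltxx /= ltnW.
  - by lia.
  - have -> : X i - (X i + L%:Z) = -1 * L%:Z + 0 by ring.
    by rewrite divzMDl// div0z; lia.
have h := mono ji; have nji : (j <= i)%N = false by lia.
rewrite nji; have [E|E|E] := same_class_cases hL cX sc; rewrite E.
- by rewrite subrr div0z ltxx eqxx.
- have -> : X j + L%:Z - X j = 1 * L%:Z + 0 by ring.
  by rewrite divzMDl// div0z; lia.
- by lia.
Qed.

Lemma height_diff_other (i j : 'I_N) : ~~ same_class L (X i) (X j) -> height_diff i j = 0.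
Proof.
move=> sc; have L0 : L%:Z != 0 by lia.
have n1 : X i != X j by apply: contra sc => /eqP ->; rewrite /same_class.
have n2 : X i != X j + L%:Z by apply: contra sc => /eqP ->; rewrite /same_class modzDr.
have n3 : X j != X i + L%:Z by apply: contra sc => /eqP ->; rewrite /same_class modzDr.
have w1 := wrap i j; have w2 := wrap j i.
rewrite /height_diff; case: (ltnP j i) => ji.
  have h := mono (ltnW ji).
  have -> : X i - X j = -1 * L%:Z + (X i - X j + L%:Z) by ring.
  by rewrite divzMDl// divz_small//; apply/andP; split; lia.
have h := mono ji.
by rewrite divz_small//; apply/andP; split; lia.
Qed.

Lemma above_eq_total (i j : 'I_N) : above_eq X i j || above_eq X j i.
Proof. by rewrite /above_eq; case: (ltgtP (X i) (X j)) => //= _; exact: leq_total. Qed.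

Lemma above_eq_anti (i j : 'I_N) : above_eq X i j -> above_eq X j i -> i = j.
Proof.
rewrite /above_eq; case: (ltgtP (X i) (X j)) => //= _ ij ji.
by apply: val_inj; apply/eqP; rewrite eqn_leq ij.
Qed.

Lemma above_eq_trans : transitive (above_eq X).
Proof.
move=> j i k; rewrite /above_eq => /orP[ij|/andP[/eqP -> ij]] /orP[jk|/andP[/eqP <- jk]].
- by rewrite (lt_trans ij jk).
- by rewrite ij.
- by rewrite jk.
- by rewrite eqxx (leq_trans ij jk) orbT.
Qed.

Let neg_above (i j : 'I_N) : i != j -> above_eq X j i = ~~ above_eq X i j.
Proof.
move=> ij; have := above_eq_total i j; case: (boolP (above_eq X i j)) => //= h _.
by apply/negP => h'; move: ij; rewrite (above_eq_anti h h') eqxx.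
Qed.

(** Reordering the particles by class and then by height in the stack turns the
exponents into inversions of a permutation within the classes, to which [stab_sum]
applies. *)
Lemma config_stab_sum :
  \sum_(s : 'S_N | stab X s) (-1) ^+ s *
    \prod_(i < N) \prod_(j < N | (i < j)%N) (- q) ^+ absz (height_diff (s i) (s j) - height_diff i j)%R
  = weight L q X.
Proof.
pose c (i : 'I_N) := (X i %% L)%Z.
pose le (i j : 'I_N) := (c i < c j) || ((c i == c j) && above_eq X i j).
have tot : total le.
  by move=> i j; rewrite /le; case: (ltgtP (c i) (c j)) => //= _; exact: above_eq_total.
have tr : transitive le.
  move=> j i k; rewrite /le => /orP[ij|/andP[/eqP -> ij]] /orP[jk|/andP[/eqP <- jk]].
  - by rewrite (lt_trans ij jk).
  - by rewrite ij.
  - by rewrite jk.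
  - by rewrite eqxx (above_eq_trans ij jk) orbT.
have [t ht] := sort_perm tot tr.
pose x' : {ffun 'I_N -> int} := [ffun i => X (t i)].
have cle (i j : 'I_N) : (i <= j)%N -> c (t i) <= c (t j).
  rewrite leq_eqVlt => /orP[/eqP/val_inj -> //|/ht].
  by rewrite /le => /orP[/ltW|/andP[/eqP ->]].
have cont : contiguous x'.
  move=> i j k ij jk; rewrite /same_class !ffunE => /eqP E.
  by have h1 := cle _ _ ij; have h2 := cle _ _ jk; apply/eqP/le_anti; rewrite -/(c _) -/(c _) h1 /c E.
have occ k : occupation L x' k = occupation L X k.
  rewrite /occupation -!sum1_card [RHS](reindex_inj (@perm_inj _ t)).
  by apply: eq_bigl => i; rewrite !inE ffunE.
have -> : weight L q X = weight L q x' by apply: eq_bigr => i _; rewrite occ.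
rewrite -stab_sum// (reindex_inj (@conjg_inj _ t)).
have conjE (s : 'S_N) i : (s ^ t)%g (t i) = t (s i) by rewrite !permM permK.
have stabE (s : 'S_N) : stab X (s ^ t)%g = stab x' s.
  apply/forallP/forallP => H i; first by have := H (t i); rewrite conjE !ffunE.
  by have := H ((t^-1)%g i); rewrite !ffunE -conjE permKV.
apply: eq_big => [s|s]; rewrite stabE// => st; rewrite odd_permJ; congr (_ * _).
have cs (i j : 'I_N) : same_class L (X ((s ^ t)%g i)) (X ((s ^ t)%g j)) = same_class L (X i) (X j).
  move: st; rewrite -stabE => /forallP st; rewrite /same_class.
  by rewrite (eqP (st i)) (eqP (st j)).
rewrite (prod_pairs_perm t); last first.
  move=> i j; case: (eqVneq i j) => [->//|ij]; congr (_ ^+ _).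
  have sij : (s ^ t)%g i != (s ^ t)%g j by rewrite (inj_eq perm_inj).
  case: (boolP (same_class L (X i) (X j))) => sc.
    have sc' : same_class L (X j) (X i) by rewrite /same_class eq_sym.
    rewrite !height_diff_same ?cs// 1?eq_sym// (neg_above ij) (neg_above sij).
    by case: above_eq; case: above_eq.
  have sc' : ~~ same_class L (X j) (X i) by rewrite /same_class eq_sym.
  by rewrite !height_diff_other ?cs.
apply: eq_bigr => i _; apply: eq_bigr => j ij; rewrite !conjE !ffunE.
have tij : t i != t j by rewrite (inj_eq perm_inj) -val_eqE /= ltn_eqF.
have sij : t (s i) != t (s j) by rewrite !(inj_eq perm_inj) -val_eqE /= ltn_eqF.
have cs' : same_class L (X (t (s i))) (X (t (s j))) = same_class L (X (t i)) (X (t j)).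
  by rewrite -!conjE cs.
case: (boolP (same_class L (X (t i)) (X (t j)))) => sc; last by rewrite !height_diff_other ?cs'.
have ab (k h : 'I_N) : same_class L (X (t k)) (X (t h)) -> (k < h)%N -> above_eq X (t k) (t h).
  by move=> /eqP kh /ht; rewrite /le /c kh ltxx eqxx.
rewrite !height_diff_same ?cs'// (neg_above tij) (ab i j sc ij).
case: (ltngtP (s j) (s i)) => sji.
- have sc2 : same_class L (X (t (s j))) (X (t (s i))) by move: cs'; rewrite sc /same_class eq_sym.
  by rewrite (ab _ _ sc2 sji).
- by rewrite (neg_above sij) (ab _ _ _ sji) ?cs'.
- by move: sij; rewrite (val_inj sji) eqxx.
Qed.

End ConfigStab.

End StabSum.

(** * Normal form of the integrand *)

Section Tazrp.
Context {R : realType}.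
Variables (N L : nat) (q : R) (a : int -> R) (r : R).
Hypotheses (hL : (0 < L)%N) (hq : 0 < q < 1) (ha : forall k, 0 < a k)
  (a_periodic : forall k, a (k + L%:Z) = a k) (hr : forall k, conductance_b q a k < r).
Local Notation C := R[i].
Implicit Types (w : 'I_N -> C) (i j : 'I_N) (s : 'S_N) (l X Y : {ffun 'I_N -> int}) (v : 'I_N -> int).

Local Notation b k := (conductance_b q a k)%:C.
Local Notation iter_int := (iterated_contour_integral r).

(** The factor attached to one site; for a fixed z it is L-periodic in k. *)
Definition site (z : C) (k : int) : C := b k / (b k - z).
Definition qdiff w i j : C := q%:C * w i - w j.
(** The only way in which two variables interact in A and D. *)
Definition rho w i j : C := qdiff w j i / qdiff w i j.

(** The end point x'_j of the site product in the variable w_j, once the part of D_l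
that involves the conductances has been absorbed by moving particles around the ring. *)
Definition apos X s l j : int := X (s^-1%g j) - L%:Z * l j.
(** The exponent e_ij of [rho w i j], for i < j: the winding numbers contribute l_i -
l_j, through D, and an inversion of s contributes 1, through A. *)
Definition ainv s l i j : int := l i - l j + ((s^-1)%g j < (s^-1)%g i)%N%:Z.

(** The integrand without the time-dependent factor, which only enters as a test
function below. *)
Definition integrand Y X s l w : C :=
  A_coef q s w * \prod_j prod_ext (Y (s j)) (X j) (site (w (s j))) * D_coef L q a l w.

Lemma conductance_b_gt0 k : 0 < conductance_b q a k.
Proof. by case/andP: hq => q0 q1; rewrite mulr_gt0// subr_gt0. Qed.

Lemma radius_gt0 : 0 < r. Proof. exact: lt_trans (conductance_b_gt0 0) (hr 0). Qed.

Lemma b_neq0 (k : int) : b k != 0. Proof. by rewrite fmorph_eq0 gt_eqF// conductance_b_gt0. Qed.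

Lemma b_periodic (k : int) : b (k + L%:Z) = b k.
Proof. by rewrite /conductance_b a_periodic. Qed.

Lemma b_sub_neq0 w k (x : int) : torus r w -> b x - w k != 0.
Proof.
move=> [_ hw]; rewrite subr_eq0; apply: contraTneq (hr x) => E.
by rewrite -leNgt -lecR -(hw k) -E ger0_norm// ler0c ltW// conductance_b_gt0.
Qed.

Lemma site_neq0 w k (x : int) : torus r w -> site (w k) x != 0.
Proof. by move=> hw; rewrite mulf_neq0 ?b_neq0// invr_eq0 b_sub_neq0. Qed.

Lemma site_periodic (z : C) (x : int) : site z (x + L%:Z) = site z x.
Proof. by rewrite /site b_periodic. Qed.

Lemma qdiff_neq0 w i j : torus r w -> qdiff w i j != 0.
Proof.
move=> [r0 hw]; rewrite subr_eq0; apply: contraTneq (hq) => E.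
have := congr1 Num.norm E; rewrite normrM !hw ger0_norm; last by rewrite ler0c; case/andP: hq => /ltW.
rewrite -rmorphM => /complexI /eqP; rewrite -subr_eq0 -{2}[r]mul1r -mulrBl mulf_eq0 (gt_eqF r0) orbF subr_eq0.
by move/eqP ->; rewrite ltxx andbF.
Qed.

Lemma rho_neq0 w i j : torus r w -> rho w i j != 0.
Proof. by move=> hw; rewrite mulf_neq0 ?invr_eq0 ?qdiff_neq0. Qed.

Lemma rhoV w i j : rho w j i = (rho w i j)^-1.
Proof. by rewrite /rho invf_div. Qed.

Lemma rho_diag w i : torus r w -> rho w i i = 1.
Proof. by move=> hw; rewrite /rho divff// qdiff_neq0. Qed.

Lemma prodf_exprz (I : Type) (t : seq I) (F : I -> C) (z : int) :
  (\prod_(i <- t) F i) ^ z = \prod_(i <- t) F i ^ z.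
Proof.
elim: t => [|i t IH]; first by rewrite !big_nil exp1rz.
by rewrite !big_cons expfzMl IH.
Qed.

Lemma A_coef_rho s w : torus r w ->
  A_coef q s w = (-1) ^+ s * \prod_(i < N) \prod_(j < N | (i < j)%N) rho w i j ^ ((s^-1)%g j < (s^-1)%g i)%N%:Z.
Proof.
move=> hw; rewrite /A_coef; congr (_ * _).
pose F i j := if ((s^-1)%g i < (s^-1)%g j)%N then qdiff w i j else 1.
have num : \prod_(i < N) \prod_(j < N | (i < j)%N) qdiff w (s i) (s j) =
    \prod_(i < N) \prod_(j < N | (i < j)%N) (F i j * F j i).
  have := prod_pairs F; rewrite [X in X * _]big1 ?mul1r => [<-|i _]; last by rewrite /F ltnn.
  rewrite [RHS](reindex_inj (@perm_inj _ s)); apply: eq_bigr => i _.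
  rewrite [RHS](reindex_inj (@perm_inj _ s)) big_mkcond; apply: eq_bigr => j _.
  by rewrite /F !permK.
transitivity ((\prod_(i < N) \prod_(j < N | (i < j)%N) qdiff w (s i) (s j)) *
  (\prod_(i < N) \prod_(j < N | (i < j)%N) (qdiff w i j)^-1)).
  by rewrite -big_split; apply: eq_bigr => i _; rewrite -big_split.
rewrite num -big_split; apply: eq_bigr => i _; rewrite -big_split; apply: eq_bigr => j ij /=.
have nij : (s^-1)%g i != (s^-1)%g j :> nat.
  by rewrite (inj_eq val_inj) (inj_eq perm_inj) -val_eqE /= ltn_eqF.
rewrite /F /rho; case: ltngtP nij => // _ _ /=; last by rewrite mul1r expr1z.
by rewrite mulr1 expr0z divff// qdiff_neq0.
Qed.

Lemma D_coef_rho l w : torus r w ->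
  D_coef L q a l w = (\prod_j (\prod_(1 <= i < L.+1) (b i%:Z - w j)) ^ l j) *
    \prod_(i < N) \prod_(j < N | (i < j)%N) rho w i j ^ (l i - l j).
Proof.
move=> hw; rewrite /D_coef.
transitivity (\prod_j ((\prod_(1 <= i < L.+1) (b i%:Z - w j)) ^ l j * \prod_k rho w j k ^ l j)).
  by apply: eq_bigr => j _; rewrite -prodf_exprz; exact: expfzMl.
rewrite big_split; congr (_ * _).
rewrite (prod_pairs (fun j k => rho w j k ^ l j)) big1 ?mul1r => [|i _]; last by rewrite rho_diag// exp1rz.
apply: eq_bigr => i _; apply: eq_bigr => j _.
by rewrite [rho w j i]rhoV exprz_inv -expfzDr ?rho_neq0.
Qed.

Let integrand_reassoc (x r1 r2 y z : C) : x * r1 * y * (z * r2) = x * (r1 * r2) * (y * z).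
Proof. ring. Qed.

(** The normal form on which every later argument works: the term (s, l) is described by
the end points [apos] and the exponents [ainv] alone. The power of the product of the b
disappears when the coordinates of l sum to 0. *)
Lemma integrandE Y X s l w : torus r w -> integrand Y X s l w =
  (-1) ^+ s * (\prod_(i < N) \prod_(j < N | (i < j)%N) rho w i j ^ ainv s l i j)
  * (\prod_(1 <= i < L.+1) b i%:Z) ^ (\sum_j l j)
  * \prod_j prod_ext (Y j) (apos X s l j) (site (w j)).
Proof.
move=> hw; rewrite /integrand A_coef_rho// D_coef_rho//.
have -> : \prod_j prod_ext (Y (s j)) (X j) (site (w (s j))) = \prod_j prod_ext (Y j) (X ((s^-1)%g j)) (site (w j)).
  by rewrite [RHS](reindex_inj (@perm_inj _ s)); apply: eq_bigr => j _; rewrite permK.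
set B := \prod_(1 <= i < L.+1) _.
have beta j : prod_ext (Y j) (X ((s^-1)%g j)) (site (w j)) * (\prod_(1 <= i < L.+1) (b i%:Z - w j)) ^ l j =
    B ^ l j * prod_ext (Y j) (apos X s l j) (site (w j)).
  rewrite (prod_ext_shift hL _ _ (l j)); [|by move=> x; exact: site_neq0|by move=> x; exact: site_periodic].
  rewrite -/(apos X s l j) -mulrA -expfzMl -big_split /= mulrC; congr (_ ^ _ * _).
  by apply: eq_bigr => x _; rewrite /site divfK// b_sub_neq0.
have -> : B ^ (\sum_j l j) = \prod_j B ^ l j.
  have B0 : B != 0 by rewrite prodf_seq_neq0; apply/allP => x _; exact: b_neq0.
  by elim/big_ind2: _ => [|x1 x2 y1 y2 <- <-|//]; rewrite ?expr0z// expfzDr.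
have key : (\prod_j prod_ext (Y j) (X ((s^-1)%g j)) (site (w j))) * \prod_j (\prod_(1 <= i < L.+1) (b i%:Z - w j)) ^ l j =
    (\prod_j B ^ l j) * \prod_j prod_ext (Y j) (apos X s l j) (site (w j)).
  by rewrite -!big_split; apply: eq_bigr => j _; exact: beta.
have -> : \prod_(i < N) \prod_(j < N | (i < j)%N) rho w i j ^ ainv s l i j =
    (\prod_(i < N) \prod_(j < N | (i < j)%N) rho w i j ^ ((s^-1)%g j < (s^-1)%g i)%N%:Z) *
    \prod_(i < N) \prod_(j < N | (i < j)%N) rho w i j ^ (l i - l j).
  rewrite -big_split; apply: eq_bigr => i _; rewrite -big_split; apply: eq_bigr => j _ /=.
  by rewrite /ainv expfzDr ?rho_neq0// mulrC.
rewrite -[RHS]mulrA -key; exact: integrand_reassoc.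
Qed.

Lemma degle_qdiff v i j : degle r v (Num.max (v i) (v j)) (fun w => qdiff w i j).
Proof.
apply: degleD; first by apply: degle_Z; apply: degle_w; rewrite le_max lexx.
by apply: degle_N; apply: degle_w; rewrite le_max lexx orbT.
Qed.

(** The variable of larger weight is factored out, and the rest is a geometric series of
ratio of modulus q. *)
Lemma degle_qdiffV v i j : v i <= v j -> degle r v (- v j) (fun w => (qdiff w i j)^-1).
Proof.
move=> vij; have r0 := radius_gt0.
have h : degle r v 0 (fun w => (1 - q%:C * (w i * w j ^ -1))^-1).
  apply: (@degle_geom _ _ _ _ _ q); first by case/andP: hq => /ltW -> ->.
    apply: degle_Z; apply: (degleW (_ : v i + - v j <= 0)); first by rewrite subr_le0.
    by apply: degleM; [exact: degle_w|apply: degle_Xz; rewrite mulrN1].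
  move=> w hw; rewrite exprN1 !normrM normfV !hw.2 divff ?mulr1; last by rewrite fmorph_eq0 gt_eqF.
  by rewrite ger0_norm// ler0c; case/andP: hq => /ltW.
rewrite -[- v j]addr0.
apply: (eq_approx _ (degleM (_ : degle r v (- v j) (fun w => - w j ^ -1)) h)) => [w hw|].
  rewrite exprN1 /qdiff; have wj := torus_neq0 j hw.
  have -> : q%:C * w i - w j = - w j * (1 - q%:C * (w i * (w j)^-1)) by field.
  by rewrite invfM invrN.
by apply: degle_N; apply: degle_Xz; rewrite mulrN1.
Qed.

(** Numerator and denominator are dominated by the same variable. *)
Lemma degle_rho v i j : v i <= v j -> degle r v 0 (fun w => rho w i j).
Proof.
move=> vij; rewrite -(subrr (v j)); apply: degleM; last exact: degle_qdiffV.
by have := degle_qdiff v j i; rewrite (max_l vij).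
Qed.

Lemma degle_site_geom v j (x : int) : 0 <= v j -> degle r v 0 (fun w => (1 - b x * w j ^ (-1))^-1).
Proof.
move=> vj; have b0 := conductance_b_gt0 x; have r0 := radius_gt0.
apply: (@degle_geom _ _ _ _ _ (conductance_b q a x / r)).
- by rewrite divr_ge0 ?(ltW b0) ?(ltW r0)//= ltr_pdivrMr// mul1r.
- by apply: degle_Z; apply: degle_Xz; rewrite mulrN1 oppr_le0.
- move=> w hw; rewrite exprN1 normrM normfV hw.2 ger0_norm ?ler0c ?(ltW b0)//.
  by rewrite [leRHS]rmorphM /= fmorphV.
Qed.

Lemma degle_site v j (x : int) : 0 <= v j -> degle r v (- v j) (fun w => site (w j) x).
Proof.
move=> vj; have h := degle_site_geom x vj.
rewrite -[- v j]addr0.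
apply: (eq_approx _ (degleM (_ : degle r v (- v j) (fun w => - b x * w j ^ -1)) h)) => [w hw|].
  rewrite exprN1 /site; have wj := torus_neq0 j hw; have bw := b_sub_neq0 j x hw.
  have -> : b x - w j = - w j * (1 - b x * (w j)^-1) by field.
  by rewrite invfM invrN mulrA mulrN mulNr.
by apply: degle_Z; apply: degle_Xz; rewrite mulrN1.
Qed.

Lemma degle_siteV v j (x m : int) : 0 <= m -> v j <= m -> degle r v m (fun w => (site (w j) x)^-1).
Proof.
move=> m0 vj; apply: (@eq_approx _ _ _ _ (fun w => (b x)^-1 * (b x + - w j))) => [w hw|].
  by rewrite /site invf_div mulrC.
by apply: degle_Z; apply: degleD; [exact: degle_cst|apply: degle_N; exact: degle_w].
Qed.

Lemma degle_prod_ext v j (y x : int) : 0 <= v j ->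
  degle r v (- (x - y + 1) * v j) (fun w => prod_ext y x (site (w j))).
Proof.
move=> vj; case: (leP y x) => yx.
  apply: (@eq_approx _ _ _ _ (fun w => \prod_(k < absz (x - y + 1)%R) site (w j) (y + k%:Z))) => [w _|].
    by rewrite prod_extE yx.
  have := @degle_prod _ r _ _ (index_enum 'I_(absz (x - y + 1)%R)) xpredT v (fun=> - v j) (fun k w => site (w j) (y + k%:Z)).
  have nE : (absz (x - y + 1)%R : int) = x - y + 1 by lia.
  rewrite sumr_const card_ord -[_ *+ _]mulr_natl natz nE mulrN -mulNr.
  by apply=> k _; exact: degle_site.
apply: (@eq_approx _ _ _ _ (fun w => \prod_(k < absz (y - 1 - x)%R) (site (w j) (x + 1 + k%:Z))^-1)) => [w _|].
  by rewrite prod_extE leNgt yx.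
have := @degle_prod _ r _ _ (index_enum 'I_(absz (y - 1 - x)%R)) xpredT v (fun=> v j) (fun k w => (site (w j) (x + 1 + k%:Z))^-1).
have nE : (absz (y - 1 - x)%R : int) = - (x - y + 1) by lia.
rewrite sumr_const card_ord -[_ *+ _]mulr_natl natz nE.
by apply=> k _; apply: degle_siteV.
Qed.

(** If x < y the product is a polynomial in w_j, so that lowering the weight of w_j
costs nothing. *)
Lemma degle_prod_ext_lt v j (y x : int) : v j <= 0 -> x < y ->
  degle r v 0 (fun w => prod_ext y x (site (w j))).
Proof.
move=> vj xy; apply: (@eq_approx _ _ _ _ (fun w => \prod_(k < absz (y - 1 - x)%R) (site (w j) (x + 1 + k%:Z))^-1)) => [w _|].
  by rewrite prod_extE leNgt xy.
by apply: degle_prod0 => k _; exact: degle_siteV.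
Qed.

Lemma degle_rho_exprz v i j (e : int) : (0 < e -> v i <= v j) -> (e < 0 -> v j <= v i) ->
  degle r v 0 (fun w => rho w i j ^ e).
Proof.
case: e => [[|m]|m] h1 h2.
- by apply: (@eq_approx _ _ _ _ (fun=> 1)) => [w _|]; [rewrite expr0z|exact: degle_cst].
- by apply: (@eq_approx _ _ _ _ (fun w => rho w i j ^+ m.+1)) => //; apply: degle_exp; apply: degle_rho; exact: h1.
- apply: (@eq_approx _ _ _ _ (fun w => rho w j i ^+ m.+1)) => [w _|].
    by rewrite NegzE -exprnN rhoV exprVn.
  by apply: degle_exp; apply: degle_rho; exact: h2.
Qed.

(** * Vanishing of the integrals *)

(** Degree at most 0 in w_m for the direction opposite to w_m, separately for each m:
only nonnegative powers of each variable occur. This is what is needed of the functions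
that multiply the integrand. *)
Definition entire (g : ('I_N -> C) -> C) := forall m : 'I_N, degle r (fun k => - (k == m)%:Z) 0 g.

Lemma degle_integrand Y X s l v d :
  (forall i j, (i < j)%N -> (0 < ainv s l i j -> v i <= v j) /\ (ainv s l i j < 0 -> v j <= v i)) ->
  (forall j, degle r v (d j) (fun w => prod_ext (Y j) (apos X s l j) (site (w j)))) ->
  degle r v (\sum_j d j) (integrand Y X s l).
Proof.
move=> Hv Hd; set B := \prod_(1 <= i < L.+1) b i%:Z.
have h : degle r v (\sum_j d j) (fun w => ((-1) ^+ s * B ^ (\sum_j l j)) *
  ((\prod_(i < N) \prod_(j < N | (i < j)%N) rho w i j ^ ainv s l i j)
  * \prod_j prod_ext (Y j) (apos X s l j) (site (w j)))); last first.
  apply: eq_approx h => w hw.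
  by rewrite integrandE// -!mulrA; congr (_ * _); rewrite mulrCA.
apply: degle_Z; rewrite -[\sum_j d j]add0r; apply: degleM; last exact: degle_prod.
apply: degle_prod0 => i _; apply: degle_prod0 => j ij.
by have [h1 h2] := Hv i j ij; exact: degle_rho_exprz.
Qed.

Lemma approx_integrand Y X s l : approx r xpredT (integrand Y X s l).
Proof.
apply: (degle_approx (v := fun=> 0) (m := \sum_(j < N) 0)).
apply: degle_integrand => [i j _|j]; first by [].
by have := degle_prod_ext (Y j) (apos X s l j) (lexx 0 : 0 <= (fun _ : 'I_N => 0) j); rewrite mulr0.
Qed.

(** If the exponents at m have the right signs, no factor [rho] prevents the contour of
w_m from shrinking to 0, and the site product is a polynomial in w_m, so the integral is
0. *)
Lemma inner_vanish Y X s l (m : 'I_N) g :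
  (forall j, (m < j)%N -> 0 <= ainv s l m j) -> (forall i, (i < m)%N -> ainv s l i m <= 0) ->
  apos X s l m < Y m -> entire g -> iter_int (fun w => integrand Y X s l w * g w) = 0.
Proof.
move=> H1 H2 Hm /(_ m) gm.
apply: (iter_vanish radius_gt0 (v := fun k => - (k == m)%:Z) (m := \sum_(j < N) 0 + 0)).
  rewrite addr0 sumr_const mul0rn sumrN opprK (bigD1 m)//= eqxx big1 ?addr0// => k /negPf -> //.
apply: degleM gm; apply: degle_integrand => [i j ij|j].
  case: (eqVneq i m) => [im|im]; case: (eqVneq j m) => [jm|jm] //.
  - by subst i; have := H1 j ij; rewrite leNgt => h; split=> // h'; rewrite h' in h.
  - by subst j; have := H2 i ij; rewrite leNgt => h; split=> // h'; rewrite h' in h.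
case: (eqVneq j m) => [->|jm]; first by apply: degle_prod_ext_lt => //; rewrite eqxx.
have := @degle_prod_ext (fun k => - (k == m)%:Z) j (Y j) (apos X s l j).
by rewrite /= (negPf jm) oppr0 mulr0; apply.
Qed.

(** The index m that minimises first l_(j0) - l_i + [s^-1 i < s^-1 j0] and then i has
exponents of the right sign for [inner_vanish]; hence the claim holds at m, and since
both configurations have width at most L it is transported from m to j0. *)
Lemma dominance Y X s l g : ring_config L X -> ring_config L Y -> entire g ->
  iter_int (fun w => integrand Y X s l w * g w) != 0 -> forall j, Y j <= apos X s l j.
Proof.
move=> /ring_configP[X1 X2] /ring_configP[Y1 Y2] gE nz j0.
pose p i := (s^-1)%g i; pose key i := l j0 - l i + (p i < p j0)%N%:Z.
(* m is the smallest index among the minimisers of key *)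
have [m1 _ Hm1] := @Order.TotalTheory.arg_minP _ _ _ j0 xpredT key isT.
have [m /eqP km Hm] := @arg_minnP _ m1 [pred i | key i == key m1] (fun i => val i) (eqxx _).
have kmin i : key m <= key i by rewrite km; exact: Hm1.
have kmin' i : (i < m)%N -> key m < key i.
  move=> im; rewrite lt_neqAle kmin andbT; apply: contraTneq im => E.
  by rewrite -leqNgt; apply: Hm; rewrite inE -km E.
have in1 j : (m < j)%N -> 0 <= ainv s l m j.
  by move=> mj; have := kmin j; rewrite /key /ainv -/(p _) -/(p _); lia.
have in2 i : (i < m)%N -> ainv s l i m <= 0.
  by move=> im; have := kmin' i im; rewrite /key /ainv -/(p _) -/(p _); lia.
have Hap : Y m <= apos X s l m.
  by rewrite leNgt; apply: contra_neqN nz => h; exact: (inner_vanish in1 in2 h gE).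
move: Hap; rewrite /apos -/(p m) -/(p j0) => Hap.
have k0 : key m <= 0 by have := kmin j0; rewrite /key ltnn; lia.
have Xm : X (p m) <= X (p j0) + L%:Z * (p m < p j0)%N%:Z.
  case: ltnP => h /=; first by rewrite mulr1.
  by rewrite mulr0 addr0 X1.
have Ym : Y j0 <= Y m - L%:Z * key m.
  case: (ltgtP (key m) 0) k0 => // [k0 _|k0 _].
    have := Y2 j0 m; have : L%:Z * key m <= L%:Z * -1 by rewrite ler_wpM2l//; lia.
    lia.
  rewrite k0 mulr0 subr0; apply: Y1; rewrite leqNgt; apply/negP => /kmin'.
  by rewrite k0 /key ltnn; lia.
apply: (le_trans Ym); rewrite /key; move: Hap Xm; set t := (_ < _)%N%:Z; lia.
Qed.

(** * The sum over permutations and vectors as a linear functional *)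

Lemma entire_cst (c : C) : entire (fun=> c).
Proof. by move=> m; exact: degle_cst. Qed.

Lemma entireM g1 g2 : entire g1 -> entire g2 -> entire (fun w => g1 w * g2 w).
Proof. by move=> h1 h2 m; rewrite -[0]addr0; apply: degleM; [exact: h1|exact: h2]. Qed.

Lemma entireD g1 g2 : entire g1 -> entire g2 -> entire (fun w => g1 w + g2 w).
Proof. by move=> h1 h2 m; apply: degleD; [exact: h1|exact: h2]. Qed.

Lemma entire_coord j : entire (fun w => w j).
Proof. by move=> m; apply: degle_w; case: (j == m). Qed.

Lemma entire_prod (F : 'I_N -> ('I_N -> C) -> C) : (forall j, entire (F j)) -> entire (fun w => \prod_j F j w).
Proof. by move=> h m; apply: degle_prod0 => j _; exact: h. Qed.

Definition exp_factor (t : R) w : C := \prod_j cexp (- w j * t%:C).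

Lemma entire_exp_factor t : entire (exp_factor t).
Proof.
apply: entire_prod => j m; have h : degle r (fun k => - (k == m)%:Z) 0 (fun w => cexp (- t%:C * w j)).
  by apply: degle_cexp; rewrite /=; case: (j == m).
by apply: eq_approx h => w _; rewrite mulNr mulrC mulNr.
Qed.

Lemma entire_approx g : (0 < N)%N -> entire g -> approx r xpredT g.
Proof. by move=> N0 /(_ (Ordinal N0)); exact: degle_approx. Qed.

(** The integral of one term (s, l) against the test function g. *)
Definition coef Y X s l (g : ('I_N -> C) -> C) : C := iter_int (fun w => integrand Y X s l w * g w).

(** The sum over s and l as a functional of the test functions, which may depend on s
since w_(s i) will be inserted. *)
Definition total Y X (g : 'S_N -> ('I_N -> C) -> C) : C :=
  \sum_s \sum_(l \in int_vectors N 0) coef Y X s l (g s).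

Definition vector_bound Y X : int := \sum_j (`|X j| + `|Y j|).

(** By [dominance] the vector l is bounded above in terms of X and Y, and it sums to 0.
*)
Lemma coef_support Y X s l g : ring_config L X -> ring_config L Y -> entire g -> int_vectors N 0 l ->
  coef Y X s l g != 0 -> bounded_vectors (vector_bound Y X) l.
Proof.
move=> cX cY gE l0 nz; split=> // j; have := dominance cX cY gE nz j; rewrite /apos.
have h1 : `|X (s^-1%g j)| <= \sum_j `|X j| by rewrite (bigD1 (s^-1%g j))//= lerDl sumr_ge0.
have h2 : `|Y j| <= \sum_j `|Y j| by rewrite (bigD1 j)//= lerDl sumr_ge0.
rewrite /vector_bound big_split /= => h3.
case: (lerP (l j) 0) => lj; first by rewrite (le_trans lj)// addr_ge0// sumr_ge0.
have h4 : l j <= L%:Z * l j by rewrite ler_peMl// ?ltW//; lia.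
move: (ler_norm (X (s^-1%g j))) (ler_norm (- Y j)); rewrite normrN.
move: h1 h2 h3 h4; move: (\sum_i `|X i|) (\sum_i `|Y i|) (X _) (Y j) (L%:Z * l j) (l j) => ? ? ? ? ? ?.
lia.
Qed.

Lemma fsum_bounded (M : int) (F : {ffun 'I_N -> int} -> C) :
  (forall l, int_vectors N 0 l -> F l != 0 -> bounded_vectors M l) ->
  \sum_(l \in int_vectors N 0) F l = \sum_(l \in bounded_vectors M) F l.
Proof.
move=> HF.
apply/esym/fsbig_widen => [l []//|l [/= l0 nl]]; apply/eqP.
by apply/negPn/negP => Fl; apply: nl; exact: HF.
Qed.

Section Linearity.
Variables (Y X : {ffun 'I_N -> int}).
Hypotheses (cX : ring_config L X) (cY : ring_config L Y) (N0 : (0 < N)%N).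

Lemma coefD s l g1 g2 : entire g1 -> entire g2 ->
  coef Y X s l (fun w => g1 w + g2 w) = coef Y X s l g1 + coef Y X s l g2.
Proof.
move=> h1 h2; rewrite /coef -(iterD radius_gt0).
- apply: (eq_iter radius_gt0) => [|w hw]; last by rewrite mulrDr.
  by apply: approxM_exponents (approx_integrand _ _ _ _) _ => //; apply: approxD; exact: entire_approx.
- by apply: approxM_exponents (approx_integrand _ _ _ _) _ => //; exact: entire_approx.
- by apply: approxM_exponents (approx_integrand _ _ _ _) _ => //; exact: entire_approx.
Qed.

Lemma approx_coef s l g : entire g -> approx r xpredT (fun w => integrand Y X s l w * g w).
Proof. by move=> h; apply: approxM_exponents (approx_integrand _ _ _ _) _ => //; exact: entire_approx. Qed.

Lemma coefZ s l g (c : C) : entire g -> coef Y X s l (fun w => c * g w) = c * coef Y X s l g.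
Proof.
move=> h; rewrite /coef -(iterZ radius_gt0); last exact: approx_coef.
apply: (eq_iter radius_gt0) => [|w hw]; last by rewrite mulrCA.
by apply: approx_coef; apply: entireM => //; exact: entire_cst.
Qed.

Lemma eq_coef s l g1 g2 : entire g1 -> (forall w, torus r w -> g1 w = g2 w) -> coef Y X s l g1 = coef Y X s l g2.
Proof.
by move=> h g12; apply: (eq_iter radius_gt0) => [|w hw]; [exact: approx_coef|rewrite g12].
Qed.

Lemma totalE g : (forall s, entire (g s)) ->
  total Y X g = \sum_s \sum_(l \in bounded_vectors (vector_bound Y X)) coef Y X s l (g s).
Proof.
by move=> h; apply: eq_bigr => s _; apply: fsum_bounded => l l0; exact: coef_support.
Qed.

Lemma eq_total g1 g2 : (forall s, entire (g1 s)) -> (forall s w, torus r w -> g1 s w = g2 s w) ->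
  total Y X g1 = total Y X g2.
Proof.
move=> h g12; apply: eq_bigr => s _; apply: eq_fsbigr => l _; apply: eq_coef => //; exact: g12.
Qed.

Lemma totalD g1 g2 : (forall s, entire (g1 s)) -> (forall s, entire (g2 s)) ->
  total Y X (fun s w => g1 s w + g2 s w) = total Y X g1 + total Y X g2.
Proof.
move=> h1 h2; rewrite !totalE// -?big_split; last by move=> s; exact: entireD.
apply: eq_bigr => s _; rewrite -fsbig_split /=; last exact: finite_bounded_vectors.
by apply: eq_fsbigr => l _; exact: coefD.
Qed.

Lemma totalZ (c : C) g : (forall s, entire (g s)) ->
  total Y X (fun s w => c * g s w) = c * total Y X g.
Proof.
move=> h; rewrite /total mulr_sumr; apply: eq_bigr => s _; rewrite mulr_fsumr.
by apply: eq_fsbigr => l _; exact: coefZ.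
Qed.

Lemma total_sum (I : Type) (t : seq I) (g : I -> 'S_N -> ('I_N -> C) -> C) : (forall z s, entire (g z s)) ->
  total Y X (fun s w => \sum_(z <- t) g z s w) = \sum_(z <- t) total Y X (g z).
Proof.
move=> h; have hs u s : entire (fun w => \sum_(z <- u) g z s w) by move=> m; apply: degle_sum => z _; exact: h.
elim: t => [|z t IH].
  have -> : total Y X (fun s w => \sum_(z <- [::]) g z s w) = total Y X (fun s w => 0 * 1).
    by apply: eq_total => [s|s w _]; [exact: (hs [::] s)|rewrite big_nil mul0r].
  by rewrite totalZ ?mul0r ?big_nil// => s; exact: entire_cst.
rewrite big_cons -IH -totalD//.
apply: eq_total => [s|s w _]; last by rewrite big_cons.
exact: (hs (z :: t) s).
Qed.

End Linearity.

(** * Exchange of two particles of a stack *)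

Lemma prod_pair1 (F : 'I_N -> 'I_N -> C) (i0 j0 : 'I_N) (z : C) : i0 != j0 ->
  ((i0 < j0)%N -> F i0 j0 = z) -> ((j0 < i0)%N -> F j0 i0 = z) ->
  (forall i j, (i, j) != (i0, j0) -> (i, j) != (j0, i0) -> F i j = 1) ->
  \prod_(i < N) \prod_(j < N | (i < j)%N) F i j = z.
Proof.
wlog ij : i0 j0 / (i0 < j0)%N.
  move=> H n h1 h2 h3; case: (ltngtP i0 j0) => h; first exact: (H i0 j0).
    by apply: (H j0 i0) => //; [rewrite eq_sym|move=> i j ? ?; exact: h3].
  by rewrite (val_inj h) eqxx in n.
move=> _ /(_ ij) <- _ h3.
rewrite (bigD1 i0)//= (bigD1 j0)//= [X in _ * X * _]big1 ?mulr1; last first.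
  move=> j /andP[i0j jj0]; apply: h3; rewrite xpair_eqE ?eqxx//=.
  by apply/negP => /andP[_ /eqP jE]; move: i0j; rewrite jE ltnn.
rewrite big1 ?mulr1// => i ii0; rewrite big1// => j ij'.
apply: h3; first by rewrite xpair_eqE (negPf ii0).
by apply/negP; rewrite xpair_eqE => /andP[/eqP iE /eqP jE]; move: ij'; rewrite iE jE ltnNge ltnW.
Qed.

Section Exchange.
Variables (Y X : {ffun 'I_N -> int}) (i j : 'I_N).
Hypothesis above : directly_above L X i j.

Let c : int := (i.+1 != j)%N%:Z.

Let above_cases : (i.+1 = j :> nat /\ X i = X j /\ c = 0) \/
  [/\ i.+1 = N, j = 0%N :> nat, X j = X i + L%:Z & c = 1].
Proof.
case/orP: above => [/andP[/eqP h1 /eqP h2]|/and3P[/eqP h1 /eqP h2 /eqP h3]].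
  by left; rewrite /c h1 eqxx.
by right; rewrite /c h2.
Qed.

Let neq_ij : i != j.
Proof.
apply/eqP => ij; subst j; case: above_cases => [[h _]|[_ _ h _]]; first lia.
by move: h hL; lia.
Qed.

Let X_ij : X j = X i + L%:Z * c.
Proof. by case: above_cases => [[_ [-> ->]]|[_ _ -> ->]]; rewrite ?mulr0 ?addr0 ?mulr1. Qed.

Definition exch_perm s : 'S_N := (tperm i j * s)%g.
Definition exch_shift s : {ffun 'I_N -> int} := [ffun k => c * ((k == s i)%:Z - (k == s j)%:Z)].
(** When i is the last particle and j the first one of a straddling stack, their
positions differ by L, and the winding numbers of the two variables compensate this;
otherwise l does not change. *)
Definition exch_vec s l : {ffun 'I_N -> int} := [ffun k => l k + exch_shift s k].

Let exch_permV s k : ((exch_perm s)^-1)%g k = tperm i j ((s^-1)%g k).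
Proof. by rewrite /exch_perm invMg permM tpermV. Qed.

Let s_eq s k (h : 'I_N) : (k == s h) = ((s^-1)%g k == h).
Proof. by rewrite -(inj_eq (@perm_inj _ s) ((s^-1)%g k)) permKV. Qed.

Lemma sum_exch_shift s : \sum_k exch_shift s k = 0.
Proof.
under eq_bigr do rewrite ffunE.
rewrite -mulr_sumr sumrB.
have one (h : 'I_N) : \sum_(k < N) (k == h)%:Z = 1.
  by rewrite (bigD1 h)//= eqxx big1 ?addr0// => k /negPf ->.
by rewrite !one subrr mulr0.
Qed.

(** The end points are unchanged because x_j = x_i + L c. *)
Lemma exch_apos s l k : apos X (exch_perm s) (exch_vec s l) k = apos X s l k.
Proof.
rewrite /apos exch_permV !ffunE !s_eq; have X_ij' := X_ij.
case: tpermP => [->|->|/eqP/negPf -> /eqP/negPf ->].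
- by rewrite eqxx (negPf neq_ij) X_ij'; lia.
- by rewrite eqxx eq_sym (negPf neq_ij) X_ij'; lia.
- by rewrite subrr mulr0 addr0.
Qed.

(** The exponents change only for the pair of variables that is exchanged, by one unit.
*)
Lemma exch_ainv s l h k : h != k -> ainv (exch_perm s) (exch_vec s l) h k =
  ainv s l h k + ((h == s i) && (k == s j))%:Z - ((h == s j) && (k == s i))%:Z.
Proof.
move=> hk; have pk : (s^-1)%g h != (s^-1)%g k by rewrite (inj_eq perm_inj).
rewrite /ainv !exch_permV !ffunE !s_eq.
move: ((s^-1)%g h) ((s^-1)%g k) pk (l h) (l k) => u u' uu lh lk.
have nij := neq_ij; have AC : (i.+1 = j :> nat /\ c = 0) \/ [/\ i.+1 = N, j = 0%N :> nat & c = 1].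
  by case: above_cases => [[? [_ ?]]|[? ? _ ?]]; [left|right].
have Hi := ltn_ord i; have Hj := ltn_ord j; have Hu := ltn_ord u; have Hu' := ltn_ord u'.
have E (x y : 'I_N) : (x == y) = ((x : nat) == (y : nat)) by rewrite val_eqE.
move: nij uu; rewrite !E.
case: AC => [[ij ->]|[iN j0 ->]];
  (case: tpermP => [->|->|/eqP + /eqP]; case: tpermP => [->|->|/eqP + /eqP]; rewrite ?E; lia).
Qed.

Let exch_reassoc (x y z u v : C) : - x * (y * z) * u * v = - (x * y * u * v * z).
Proof. ring. Qed.

(** The involution on pairs (s, l) changes the sign and multiplies the term by one
factor [rho]. *)
Lemma exch_integrand s l w : torus r w ->
  integrand Y X (exch_perm s) (exch_vec s l) w = - (integrand Y X s l w * rho w (s i) (s j)).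
Proof.
move=> hw; rewrite !integrandE//.
have -> : \sum_k exch_vec s l k = \sum_k l k.
  under eq_bigr do rewrite ffunE.
  by rewrite big_split /= sum_exch_shift addr0.
under [X in _ * X = _]eq_bigr do rewrite exch_apos.
have -> : (-1) ^+ (exch_perm s) = - (-1) ^+ s :> C.
  by rewrite /exch_perm odd_permM odd_tperm neq_ij; case: (odd_perm s) => /=; rewrite ?expr0 ?expr1 ?opprK.
have sij : s i != s j by rewrite (inj_eq perm_inj).
have -> : \prod_(h < N) \prod_(k < N | (h < k)%N) rho w h k ^ ainv (exch_perm s) (exch_vec s l) h k =
   (\prod_(h < N) \prod_(k < N | (h < k)%N) rho w h k ^ ainv s l h k) * rho w (s i) (s j).
  have E : \prod_(h < N) \prod_(k < N | (h < k)%N)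
     rho w h k ^ (((h == s i) && (k == s j))%:Z - ((h == s j) && (k == s i))%:Z) = rho w (s i) (s j).
    apply: (prod_pair1 sij) => [lt|lt|h k].
    - by rewrite !eqxx (negPf sij) /= subr0 expr1z.
    - by rewrite eq_sym (negPf sij) /= !eqxx sub0r -exprz_inv expr1z -rhoV.
    - by rewrite !xpair_eqE => /negPf -> /negPf ->; rewrite subrr expr0z.
  rewrite -[X in _ * X]E -big_split; apply: eq_bigr => h _.
  rewrite -big_split; apply: eq_bigr => k hk /=.
  have hk' : h != k by rewrite -val_eqE /= ltn_eqF.
  by rewrite exch_ainv// -addrA expfzDr ?rho_neq0.
exact: exch_reassoc.
Qed.

Hypotheses (cX : ring_config L X) (cY : ring_config L Y) (N0 : (0 < N)%N).

(** On each pair (s, l) and its image the two terms cancel after insertion of w_(s i) -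
q w_(s j), the denominator of [rho] up to sign. *)
Lemma total_exchange g : entire g ->
  total Y X (fun s w => g w * w (s i)) = q%:C * total Y X (fun s w => g w * w (s j)).
Proof.
move=> gE; have gi k : entire (fun w => g w * w k) by apply: entireM => //; exact: entire_coord.
have gN k : entire (fun w => - q%:C * (g w * w k)) by apply: entireM => //; exact: entire_cst.
pose D s l := coef Y X s l (fun w => g w * w (s i) + - q%:C * (g w * w (s j))).
have D_anti s l : D (exch_perm s) (exch_vec s l) = - D s l.
  rewrite /D -[RHS]mulN1r /coef -[RHS](iterZ radius_gt0); last first.
    by apply: approx_coef => //; apply: entireD.
  apply: (eq_iter radius_gt0); first by apply: approx_coef => //; apply: entireD.
  move=> w hw; rewrite exch_integrand// /exch_perm !permM tpermL tpermR /rho.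
  have d1 : qdiff w (s i) (s j) != 0 by exact: qdiff_neq0.
  move: (integrand Y X s l w) (g w) d1 => I0 G0; rewrite /qdiff.
  by move: (w (s i)) (w (s j)) (q%:C) => x y z d1; field.
have S0 : total Y X (fun s w => g w * w (s i) + - q%:C * (g w * w (s j))) = 0.
  set S := total _ _ _.
  have : S = - S.
    rewrite {1}/S /total (reindex_inj (mulgI (tperm i j))).
    rewrite /S /total -sumrN; apply: eq_bigr => s _.
    have bij : set_bij (int_vectors N 0) (int_vectors N 0) (exch_vec s).
      split=> [l /= l0|l1 l2 _ _ /ffunP E|l l0].
      - rewrite /int_vectors /= -[RHS]l0; under eq_bigr do rewrite ffunE.
        by rewrite big_split /= sum_exch_shift addr0.
      - by apply/ffunP => k; have := E k; rewrite !ffunE => /addIr.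
      - exists [ffun k => l k - exch_shift s k].
          rewrite /int_vectors /= -[RHS]l0; under eq_bigr do rewrite ffunE.
          by rewrite sumrB sum_exch_shift subr0.
        by apply/ffunP => k; rewrite !ffunE subrK.
    rewrite (reindex_fsbig _ _ _ _ bij) -[RHS]mulN1r mulr_fsumr.
    by apply: eq_fsbigr => l _; rewrite mulN1r; exact: D_anti.
  move/eqP; rewrite -subr_eq0 opprK -mulr2n -mulr_natl mulf_eq0 pnatr_eq0 /=.
  by move/eqP.
move: S0; rewrite totalD// totalZ// mulNr => /eqP; rewrite subr_eq0 => /eqP //.
Qed.

End Exchange.

(** * Forward equation *)

Section Forward.
Variables (Y : {ffun 'I_N -> int}).
Hypotheses (cY : ring_config L Y) (N0 : (0 < N)%N).

Definition prefactor X : C := (\prod_(k < N) (- 1 / b (X k))) * (1 / (2 * pi%:C * imag_unit) ^+ N).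

Lemma LambdaE X t l s : Lambda L q a r Y X t l s = prefactor X * coef Y X s l (exp_factor t).
Proof.
rewrite /Lambda /prefactor /coef; congr (_ * iter_int _); apply/funext => w.
rewrite big_split /= /integrand /exp_factor [X in _ = _ * X](reindex_inj (@perm_inj _ s)) /=.
by rewrite mulrA mulrAC.
Qed.

Lemma u_termE X t l : u_term L q a r Y X t l = prefactor X * \sum_s coef Y X s l (exp_factor t).
Proof. by rewrite /u_term mulr_sumr; apply: eq_bigr => s _; exact: LambdaE. Qed.

Lemma u_term_support X t l : ring_config L X -> int_vectors N 0 l -> u_term L q a r Y X t l != 0 ->
  bounded_vectors (vector_bound Y X) l.
Proof.
move=> cX l0; rewrite u_termE => nz.
have : exists s, coef Y X s l (exp_factor t) != 0.
  apply/existsP; apply: contraNT nz; rewrite negb_exists => /forallP h.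
  by rewrite big1 ?mulr0// => s _; apply/eqP; have := h s; rewrite negbK.
by case=> s; apply: coef_support => //; exact: entire_exp_factor.
Qed.

Lemma u_totalE X t : ring_config L X -> u_total L q a r Y X t = prefactor X * total Y X (fun=> exp_factor t).
Proof.
move=> cX; rewrite /u_total (@fsum_bounded (vector_bound Y X)); last first.
  by move=> l l0; exact: u_term_support.
rewrite totalE//; last by move=> s; exact: entire_exp_factor.
under eq_fsbigr do rewrite u_termE.
rewrite -mulr_fsumr; congr (_ * _).
have fB := @finite_bounded_vectors N (vector_bound Y X).
by rewrite fsbig_finite// exchange_big /=; apply: eq_bigr => s _; rewrite fsbig_finite.
Qed.

(** The time derivative of the formula: the exponential factor brings down minus the sum
of the variables. *)
Definition u_deriv X t : C := prefactor X * total Y X (fun s w => exp_factor t w * - \sum_j w j).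

Definition unjump X i : {ffun 'I_N -> int} := [ffun k => X k - (k == i)%:Z].

Let unjump_field (A p1 P D u z : C) : u != 0 -> u - z != 0 ->
  A * (p1 * P) * D = A * (p1 * (u / (u - z)) * P) * D * (u^-1 * (u - z)).
Proof. by move=> u0 uz; field; rewrite u0. Qed.

Lemma integrand_unjump X s l w i : torus r w ->
  integrand Y (unjump X i) s l w = integrand Y X s l w * ((b (X i))^-1 * (b (X i) - w (s i))).
Proof.
move=> hw; rewrite /integrand (bigD1 i)//= [in RHS](bigD1 i)//= ffunE eqxx.
rewrite (@prod_ext_recr _ _ (X i)); last exact: site_neq0.
rewrite (eq_bigr (fun k => prod_ext (Y (s k)) (X k) (site (w (s k))))); last first.
  by move=> k ki; rewrite ffunE (negPf ki) subr0.
by apply: unjump_field; [exact: b_neq0|exact: b_sub_neq0].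
Qed.

Lemma prefactor_unjump X i : b (X i - 1) * prefactor (unjump X i) = b (X i) * prefactor X.
Proof.
rewrite /prefactor (bigD1 i)//= [in RHS](bigD1 i)//= ffunE eqxx.
rewrite (eq_bigr (fun k => -1 / b (X k))); last by move=> k ki; rewrite ffunE (negPf ki) subr0.
by rewrite !mulrA; congr (_ * _ * _); rewrite !mulrN1 !mulNr ![b _ * _]mulrC !mulVf ?b_neq0.
Qed.

Local Notation E := exp_factor.

Definition uval X t : C := prefactor X * total Y X (fun=> E t).

(** Moving particle i one step back divides the integrand by b / (b - w_(s i)), so the
insertion of w_(s i) is a combination of two values of the formula. *)
Lemma bottom_term X i t : ring_config L X -> ring_config L (unjump X i) ->
  prefactor X * (- total Y X (fun s w => E t w * w (s i))) =
  b (X i - 1) * uval (unjump X i) t - b (X i) * uval X t.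
Proof.
move=> cX cX'; have eE := @entire_exp_factor t.
have eEw s : entire (fun w => E t w * w (s i)) by apply: entireM => //; exact: entire_coord.
rewrite /uval; have -> : total Y (unjump X i) (fun=> E t) = total Y X (fun s w => E t w + - (b (X i))^-1 * (E t w * w (s i))).
  apply: eq_bigr => s _; apply: eq_fsbigr => l _; apply: (eq_iter radius_gt0).
    exact: approx_coef.
  move=> w hw; rewrite integrand_unjump//; have b0 := b_neq0 (X i).
  by move: (integrand _ _ _ _ _) (E t w) (w (s i)) (b (X i)) b0 => x y z u u0; field.
rewrite totalD// ?totalZ//; last by move=> s; apply: entireM => //; exact: entire_cst.
rewrite mulrA prefactor_unjump; have b0 := b_neq0 (X i).
by move: (total _ _ _) (total _ _ _) (prefactor X) (b (X i)) b0 => x y z u u0; field.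
Qed.

(** The exchange relation collapses the sum of the inserted variables to the bottom
particles of the stacks, for which [bottom_term] applies. Up to the weight this is the
forward equation of the chain. *)
Lemma u_deriv_forward X t : ring_config L X -> u_deriv X t =
  \sum_(i | ~~ below L X i) qnum q%:C (occupation L X (X i)) *
    (b (X i - 1) * uval (unjump X i) t - b (X i) * uval X t).
Proof.
move=> cX; have eE := @entire_exp_factor t.
have eEw (j : 'I_N) s : entire (fun w => E t w * w (s j)) by apply: entireM => //; exact: entire_coord.
pose B i := - total Y X (fun s w => E t w * w (s i)).
have q1 : q%:C != 1 :> C.
  by rewrite -[1]/(1%:C) (inj_eq (@complexI R)) lt_eqF//; case/andP: hq.
have hB i : below L X i -> B i = q%:C * B (ordS i).
  by move=> bi; rewrite /B mulrN (total_exchange bi).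
have S := stack_sum hL q1 cX hB.
transitivity (prefactor X * \sum_i B i); last first.
  rewrite S mulr_sumr; apply: eq_bigr => i bi; rewrite mulrCA; congr (_ * _).
  by rewrite /B bottom_term//; exact: ring_config_unjump.
rewrite /u_deriv; congr (_ * _); rewrite sumrN -total_sum//.
rewrite -mulN1r -totalZ//; last by move=> s m; apply: degle_sum => i _; exact: (eEw i s m).
apply: eq_total => // [s|s w _].
  apply: entireM => //; have h : entire (fun w => -1 * \sum_j w j).
    by apply: entireM; [exact: entire_cst|move=> m; apply: degle_sum => j _; exact: (entire_coord j m)].
  by move=> m; apply: eq_approx (h m) => w _; rewrite mulN1r.
rewrite mulrN mulN1r -mulr_sumr [in LHS](reindex_inj (@perm_inj _ s)) //.
Qed.

(** Summing the inequalities y_j <= x'_j over j, the shifts L l_j cancel. *)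
Lemma uval_support X t : ring_config L X -> uval X t != 0 -> \sum_j Y j <= \sum_j X j.
Proof.
move=> cX; rewrite mulf_eq0 negb_or => /andP[_ nz].
have [s [l l0 cl]] : exists s, exists2 l, int_vectors N 0 l & coef Y X s l (E t) != 0.
  apply: contrapT => h; case/negP: nz; apply/eqP; rewrite /total big1// => s _.
  by apply: fsbig1 => l l0; apply/eqP/negPn/negP => nz; apply: h; exists s, l.
have D := dominance cX cY (@entire_exp_factor t) cl.
have : \sum_j Y j <= \sum_j apos X s l j by apply: ler_sum => j _; exact: D.
rewrite sumrB -mulr_sumr (l0 : \sum_j l j = 0) mulr0 subr0.
have -> // : \sum_j X j = \sum_j X ((s^-1)%g j).
by rewrite (reindex_inj (@perm_inj _ (s^-1)%g)).
Qed.

Local Notation support_list X := (finmap.enum_fset (fset_set (bounded_vectors (vector_bound Y X)))).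

(** A quantitative form of differentiability with bounded second derivative, stable
under finite sums and sufficient for [duality]. *)
Definition quad_incr (T d1 : R) (f f' : R -> C) := exists M : R, forall t h,
  0 <= t -> 0 < h <= d1 -> t + h <= T -> `|f (t + h) - f t - h%:C * f' t| <= (M * h ^+ 2)%:C.

Lemma quad_incr_sum (I : Type) (s : seq I) T d1 (f f' : I -> R -> C) :
  (forall z, quad_incr T d1 (f z) (f' z)) ->
  quad_incr T d1 (fun t => \sum_(z <- s) f z t) (fun t => \sum_(z <- s) f' z t).
Proof.
move=> H; elim: s => [|z s [M HM]].
  by exists 0 => t h _ _ _; rewrite !big_nil mulr0 !subr0 normr0 mul0r.
have [K HK] := H z; exists (K + M) => t h t0 h0 hT; rewrite !big_cons mulrDl rmorphD /=.
apply: le_trans (lerD (HK t h t0 h0 hT) (HM t h t0 h0 hT)); apply: le_trans (ler_normD _ _).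
rewrite le_eqVlt; apply/orP; left; apply/eqP; congr (`|_|).
move: (f z (t + h)) (f z t) (f' z t) (\sum_(_ <- _) _) (\sum_(_ <- _) _) (\sum_(_ <- _) _) => *.
ring.
Qed.

Lemma quad_incrZ (c : C) T d1 (f f' : R -> C) : quad_incr T d1 f f' ->
  quad_incr T d1 (fun t => c * f t) (fun t => c * f' t).
Proof.
move=> [M HM]; exists (complex.Re `|c| * M) => t h t0 h0 hT.
have cR : `|c| = (complex.Re `|c|)%:C by rewrite RRe_real// normr_real.
rewrite mulrCA -!mulrBr normrM -mulrA [leRHS]rmorphM /= -cR ler_wpM2l//.
exact: HM.
Qed.

Let d1 : R := (2%:R * N%:R * r)^-1.

Lemma norm_exp_factor (T t : R) w : torus r w -> 0 <= t <= T -> `|E t w| <= (expR (N%:R * (r * T)))%:C.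
Proof.
move=> [r0 hw] /andP[t0 tT]; rewrite /exp_factor -cexp_sum norm_cexp lecR ler_expR.
rewrite raddf_sum; apply: (@le_trans _ _ (\sum_(j < N) r * T)).
  apply: ler_sum => j _; apply: (le_trans (ler_norm _)).
  have h : `|- w j * t%:C| <= (r * T)%:C.
    rewrite normrM normrN hw rmorphM /= ler_wpM2l ?ler0c ?(ltW r0)//.
    by rewrite ger0_norm ?ler0c// lecR.
  by have [] := normc_le_ReIm h.
by rewrite sumr_const card_ord mulr_natl.
Qed.

Lemma exp_factorD t h w : E (t + h) w = E t w * cexp (h%:C * - \sum_j w j).
Proof.
rewrite /exp_factor mulrN mulr_sumr -sumrN cexp_sum -big_split; apply: eq_bigr => j _ /=.
by rewrite -cexpD rmorphD /= mulrDr; congr (cexp (_ + _)); rewrite mulNr mulrC.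
Qed.

Lemma norm_sum_torus w : torus r w -> `|- \sum_j w j| <= (N%:R * r)%:C.
Proof.
move=> [r0 hw]; rewrite normrN; apply: le_trans (ler_norm_sum _ _ _) _.
under eq_bigr do rewrite hw.
by rewrite sumr_const card_ord -rmorphMn mulr_natl.
Qed.

Lemma coef_bounded X s l (T : R) : exists M : R, forall t, 0 <= t <= T -> `|coef Y X s l (E t)| <= M%:C.
Proof.
have [K K0 HK] := approx_bounded (@approx_integrand Y X s l).
exists ((4%:R * pi * r) ^+ N * (K * expR (N%:R * (r * T)))) => t ht.
apply: (iter_bound radius_gt0); first by apply: approx_coef => //; exact: entire_exp_factor.
move=> w hw; rewrite normrM rmorphM /=; apply: ler_pM => //; [exact: HK|exact: norm_exp_factor].
Qed.

Lemma entire_sumN : entire (fun w => - \sum_j w j).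
Proof.
move=> m; apply: degle_N; apply: degle_sum => j _; exact: (entire_coord j m).
Qed.

(** The restriction of the step to h <= 1 / (2 N r) keeps the argument of the
exponential in the range of [cexp_taylor]. *)
Lemma coef_quad_incr X s l (T : R) : quad_incr T d1 (fun t => coef Y X s l (E t))
  (fun t => coef Y X s l (fun w => E t w * - \sum_j w j)).
Proof.
have [K K0 HK] := approx_bounded (@approx_integrand Y X s l).
have r0 := radius_gt0; have NR : 0 < N%:R :> R by rewrite ltr0n.
pose S : R := N%:R * r; have S0 : 0 < S by rewrite mulr_gt0.
exists ((4%:R * pi * r) ^+ N * (K * (expR (N%:R * (r * T)) * (10%:R * S ^+ 2)))) => t h t0 /andP[h0 hd] hT.
have eE := @entire_exp_factor.
have eES (u : R) : entire (fun w => E u w * - \sum_j w j) by apply: entireM => //; exact: entire_sumN.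
have eZ (c : C) g : entire g -> entire (fun w => c * g w) by move=> hg; apply: entireM => //; exact: entire_cst.
have -> : coef Y X s l (E (t + h)) - coef Y X s l (E t) - h%:C * coef Y X s l (fun w => E t w * - \sum_j w j) =
  coef Y X s l (fun w => E (t + h) w + (-1 * E t w + - h%:C * (E t w * - \sum_j w j))).
  rewrite coefD//; last by apply: entireD; exact: eZ.
  by rewrite coefD ?coefZ//; [rewrite mulN1r mulNr addrA|exact: eZ|exact: eZ].
rewrite -mulrA; apply: (iter_bound radius_gt0).
  by apply: approx_coef => //; apply: entireD => //; apply: entireD; exact: eZ.
move=> w hw; rewrite exp_factorD.
set z := - \sum_j w j; set e := cexp _.
have -> : E t w * e + (-1 * E t w + - h%:C * (E t w * z)) = E t w * (e - 1 - h%:C * z) by ring.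
rewrite normrM -mulrA rmorphM /=; apply: ler_pM => //; first exact: HK.
rewrite normrM -mulrA rmorphM /=; apply: ler_pM => //.
  by apply: norm_exp_factor; rewrite // t0 (le_trans _ hT)// lerDl ltW.
have hz : `|h%:C * z| <= (h * S)%:C.
  rewrite normrM rmorphM /= ger0_norm ?ler0c ?(ltW h0)// ler_wpM2l ?ler0c ?(ltW h0)//.
  exact: norm_sum_torus.
apply: (@le_trans _ _ ((10%:R)%:C * `|h%:C * z| ^+ 2)).
  apply: cexp_taylor; apply: (le_trans hz); rewrite lecR.
  apply: (@le_trans _ _ (d1 * S)); first by rewrite ler_pM2r.
  by rewrite /d1 /S le_eqVlt; apply/orP; left; apply/eqP; field; rewrite !gt_eqF.
rewrite [leRHS](_ : _ = (10%:R)%:C * ((h * S)%:C ^+ 2)).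
  by rewrite ler_wpM2l ?ler0c// lerXn2r ?nnegrE// ler0c mulr_ge0 ?ltW.
by rewrite -rmorphXn -rmorphM; congr (_%:C); ring.
Qed.

Lemma uval_quad_incr X (T : R) : ring_config L X -> quad_incr T d1 (uval X) (u_deriv X).
Proof.
move=> cX; apply: quad_incrZ.
have eE := @entire_exp_factor.
have eES (u : R) : entire (fun w => E u w * - \sum_j w j) by apply: entireM => //; exact: entire_sumN.
have fB := @finite_bounded_vectors N (vector_bound Y X).
have h : quad_incr T d1 (fun t => \sum_s \sum_(l <- support_list X) coef Y X s l (E t))
   (fun t => \sum_s \sum_(l <- support_list X) coef Y X s l (fun w => E t w * - \sum_j w j)).
  by apply: quad_incr_sum => s; apply: quad_incr_sum => l; exact: coef_quad_incr.
have [M HM] := h; exists M => t u t0 u0 hT; have := HM t u t0 u0 hT.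
have R1 (g : ('I_N -> C) -> C) : entire g -> total Y X (fun=> g) =
   \sum_s \sum_(l <- support_list X) coef Y X s l g.
  by move=> eg; rewrite totalE//; apply: eq_bigr => s _; rewrite fsbig_finite.
by rewrite !R1.
Qed.

Lemma uval_bounded X (T : R) : ring_config L X -> exists M : R, forall t, 0 <= t <= T -> `|uval X t| <= M%:C.
Proof.
move=> cX; have fB := @finite_bounded_vectors N (vector_bound Y X).
have bsum (I : Type) (s : seq I) (f : I -> R -> C) :
    (forall z, exists M : R, forall t, 0 <= t <= T -> `|f z t| <= M%:C) ->
    exists M : R, forall t, 0 <= t <= T -> `|\sum_(z <- s) f z t| <= M%:C.
  move=> H; elim: s => [|z s [M HM]]; first by exists 0 => t _; rewrite big_nil normr0.
  have [K HK] := H z; exists (K + M) => t ht; rewrite big_cons rmorphD /=.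
  by apply: le_trans (ler_normD _ _) _; apply: lerD; [exact: HK|exact: HM].
have [M HM] := bsum _ (index_enum _) (fun s t => \sum_(l <- support_list X) coef Y X s l (E t))
  (fun s => bsum _ _ (fun l t => coef Y X s l (E t)) (fun l => coef_bounded X s l T)).
have cR : `|prefactor X| = (complex.Re `|prefactor X|)%:C by rewrite RRe_real// normr_real.
exists (complex.Re `|prefactor X| * M) => t ht; rewrite normrM rmorphM /= -cR ler_wpM2l//.
have -> : total Y X (fun=> E t) = \sum_s \sum_(l <- support_list X) coef Y X s l (E t).
  rewrite totalE//; last by move=> s; exact: entire_exp_factor.
  by apply: eq_bigr => s _; rewrite fsbig_finite.
exact: HM.
Qed.

End Forward.

(** * Initial condition *)

Section Initial.
Variables (Y : {ffun 'I_N -> int}).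
Hypotheses (cY : ring_config L Y) (N0 : (0 < N)%N).

Lemma exp_factor0 w : exp_factor 0 w = 1.
Proof. by rewrite /exp_factor big1// => j _; rewrite mulr0 cexp0. Qed.

(** At t = 0 the direction v = (1, ..., 1), in which the factors [rho] have degree 0,
bounds the sum of the x'_j - y_j by 0, while each of them is nonnegative by [dominance].
*)
Lemma coef_initial_nonzero X s l : ring_config L X -> int_vectors N 0 l ->
  coef Y X s l (exp_factor 0) != 0 -> forall j, apos X s l j = Y j.
Proof.
move=> cX l0 nz; have D := dominance cX cY (@entire_exp_factor 0) nz.
have S : \sum_j (apos X s l j - Y j) <= 0.
  rewrite leNgt; apply: contra_neqN nz => h.
  rewrite /coef -(eq_iter radius_gt0 (approx_integrand Y X s l)) => [|w hw]; last by rewrite exp_factor0 mulr1.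
  apply: (iter_vanish radius_gt0 (v := fun=> 1) (m := \sum_j - (apos X s l j - Y j + 1) * 1)).
    have -> : \sum_j - (apos X s l j - Y j + 1) * 1 = - \sum_j (apos X s l j - Y j) - \sum_(j < N) 1.
      by rewrite -!sumrN -big_split; apply: eq_bigr => j _ /=; rewrite mulr1 opprD.
    by rewrite gtrDr oppr_lt0.
  by apply: degle_integrand => // j; exact: degle_prod_ext.
have A j : apos X s l j - Y j = 0.
  have h i : true -> 0 <= apos X s l i - Y i by rewrite subr_ge0.
  have S0 : \sum_j (apos X s l j - Y j) = 0 by apply/le_anti; rewrite S sumr_ge0.
  exact: (psumr_eq0P h S0).
by move=> j; apply/eqP; rewrite -subr_eq0 A.
Qed.

(** For each i a counting argument gives j with l_j + [j < i] < [s^-1 j <= i]: both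
sides summed over j give i and i + 1. For this j the equation x_(s^-1 j) - L l_j = y_j
yields x_i <= y_i, and the coordinate sums agree. *)
Lemma apos_eq_config X s l : ring_config L X -> int_vectors N 0 l ->
  (forall j, apos X s l j = Y j) -> X = Y.
Proof.
move=> /ring_configP[X1 X2] l0 E; have /ring_configP[Y1 Y2] := cY.
have le i : X i <= Y i.
  have [j hj] : exists j, l j + (j < i)%N%:Z < ((s^-1)%g j <= i)%N%:Z.
    apply/existsP; apply: contraT; rewrite negb_exists => /forallP h.
    have count (m : nat) : (m <= N)%N -> \sum_(j < N) (j < m)%N%:Z = m%:Z.
      elim: N m => [|n IH] [|m] // mN; rewrite ?big_ord0 ?big_ord_recl//=.
        by rewrite add0r big1.
      by rewrite (IH m)// intS.
    have : \sum_j (((s^-1)%g j <= i)%N%:Z) <= \sum_j (l j + (j < i)%N%:Z).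
      by apply: ler_sum => j _; have := h j; rewrite -leNgt.
    rewrite big_split /= (l0 : \sum_j l j = 0) add0r count; last exact: ltnW.
    have -> : \sum_(j < N) ((s^-1)%g j <= i)%N%:Z = \sum_(j < N) (j < i.+1)%N%:Z.
      by rewrite [RHS](reindex_inj (@perm_inj _ (s^-1)%g)).
    by rewrite count//; lia.
  have Ej := E j; rewrite /apos in Ej.
  have h1 : X i <= X ((s^-1)%g j) + L%:Z * (1 - ((s^-1)%g j <= i)%N%:Z).
    case: (leqP ((s^-1)%g j) i) => h /=; first by rewrite subrr mulr0 addr0 X1.
    by rewrite subr0 mulr1.
  have h2 : Y j - L%:Z * (j < i)%N%:Z <= Y i.
    case: (ltnP j i) => h /=; first by rewrite mulr1 lerBlDr.
    by rewrite mulr0 subr0 Y1.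
  have h3 : L%:Z * (l j + (j < i)%N%:Z) <= L%:Z * (((s^-1)%g j <= i)%N%:Z - 1) by apply: ler_wpM2l => //; lia.
  lia.
have S : \sum_i X i = \sum_i Y i.
  under [RHS]eq_bigr do rewrite -E /apos.
  rewrite sumrB -mulr_sumr (l0 : \sum_j l j = 0) mulr0 subr0.
  by rewrite [LHS](reindex_inj (@perm_inj _ (s^-1)%g)).
apply/ffunP => i; apply/eqP; rewrite eq_sym -subr_eq0; apply/eqP.
have h k : true -> 0 <= Y k - X k by rewrite subr_ge0.
have S0 : \sum_k (Y k - X k) = 0 by rewrite sumrB S subrr.
exact: (psumr_eq0P h S0).
Qed.

(** F is the constant c up to terms of negative degree for v: the constant is then the
only part of F seen by the integral of F / (w_1 ... w_N). *)
Definition leads v (c : C) (F : ('I_N -> C) -> C) := degle r v (-1) (fun w => F w - c).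

Lemma leads_degle v c F : leads v c F -> degle r v 0 F.
Proof.
move=> h; have h' : degle r v 0 (fun w => (F w - c) + c).
  by apply: degleD; [exact: degleW h|exact: degle_cst].
by apply: eq_approx h' => w _; rewrite subrK.
Qed.

Lemma leadsM v c1 c2 F1 F2 : leads v c1 F1 -> leads v c2 F2 -> leads v (c1 * c2) (fun w => F1 w * F2 w).
Proof.
move=> h1 h2; have h : degle r v (-1) (fun w => (F1 w - c1) * F2 w + c1 * (F2 w - c2)).
  by apply: degleD; [rewrite -[-1]addr0; apply: degleM h1 (leads_degle h2)|exact: degle_Z].
by apply: eq_approx h => w _; rewrite mulrBl mulrBr addrA subrK.
Qed.

Lemma leads1 v c : leads v c (fun=> c).
Proof. by apply: (@eq_approx _ _ _ _ (fun=> 0)) => [w _|]; [rewrite subrr|exact: degle_0]. Qed.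

Lemma leads_prod v (I : Type) (t : seq I) (P : pred I) (c : I -> C) (F : I -> ('I_N -> C) -> C) :
  (forall z, P z -> leads v (c z) (F z)) ->
  leads v (\prod_(z <- t | P z) c z) (fun w => \prod_(z <- t | P z) F z w).
Proof.
move=> h; elim: t => [|z t IH].
  by rewrite big_nil; apply: (eq_approx _ (leads1 v 1)) => w _; rewrite big_nil.
rewrite big_cons; case: (boolP (P z)) => Pz.
  by apply: (eq_approx _ (leadsM (h z Pz) IH)) => w _; rewrite big_cons Pz.
by apply: (eq_approx _ IH) => w _; rewrite big_cons (negPf Pz).
Qed.

(** The factor tends to - q^-1 or - q according to which of the two variables dominates;
the weights are chosen so that it is the latter for positive exponents and the former
for negative ones. *)
Lemma leads_rho v i j : v i < v j -> leads v (- q%:C) (fun w => rho w i j).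
Proof.
move=> vij; have h : degle r v (-1) (fun w => (q%:C ^+ 2 - 1) * (w i * (qdiff w i j)^-1)).
  apply: degle_Z; apply: (degleW (_ : v i + - v j <= -1)); first by lia.
  by apply: degleM; [exact: degle_w|apply: degle_qdiffV; exact: ltW].
apply: eq_approx h => w hw; have d := qdiff_neq0 i j hw; rewrite /rho.
have d' : qdiff w j i = q%:C * w j - w i by [].
move: d; rewrite d' /qdiff; move: (w i) (w j) (q%:C) => x y z d; field.
exact: d.
Qed.

Lemma leads_rho_exprz v i j (e : int) : (0 < e -> v i < v j) -> (e < 0 -> v j < v i) ->
  leads v ((- q%:C) ^+ absz e) (fun w => rho w i j ^ e).
Proof.
have lX c F m : leads v c F -> leads v (c ^+ m) (fun w => F w ^+ m).
  move=> h; elim: m => [|m IH]; first by rewrite expr0; apply: (eq_approx _ (leads1 v 1)).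
  by rewrite exprS; apply: (eq_approx _ (leadsM h IH)) => w _; rewrite exprS.
case: e => [[|m]|m] h1 h2.
- by rewrite expr0; apply: (eq_approx _ (leads1 v 1)) => w _; rewrite expr0z.
- by apply: lX; apply: leads_rho; exact: h1.
- apply: (eq_approx _ (lX _ _ m.+1 (leads_rho (h2 isT)))) => w _.
  by rewrite NegzE -exprnN rhoV exprVn.
Qed.

Lemma leads_geom v j (x : int) : 0 < v j -> leads v 1 (fun w => (1 - b x * w j ^ (-1))^-1).
Proof.
move=> vj; have h0 := degle_site_geom x (ltW vj).
have h : degle r v (-1) (fun w => b x * w j ^ (-1) * (1 - b x * w j ^ (-1))^-1).
  by rewrite -[-1]addr0; apply: degleM h0; apply: degle_Z; apply: degle_Xz; rewrite mulrN1; lia.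
apply: eq_approx h => w hw; have wj := torus_neq0 j hw; have bw := b_sub_neq0 j x hw.
have nz : 1 - b x * w j ^ (-1) != 0.
  rewrite exprN1 subr_eq0 eq_sym -(inj_eq (mulIf wj)) divfK// mul1r -subr_eq0; exact: bw.
by apply: (mulIf nz); rewrite mulrBl divfK// mul1r mulVf// opprB addrC subrK.
Qed.

(** The weights decrease strictly with s^-1 j + N l_j, which orders the variables
lexicographically by (l_j, s^-1 j); every [rho] to the power e_ij then leads with
(-q)^|e_ij|, so only the leading term of the integrand is of the form c / (w_1 ... w_N).
*)
Lemma coef_initial_value s l : int_vectors N 0 l -> (forall j, apos Y s l j = Y j) ->
  prefactor Y * coef Y Y s l (exp_factor 0) =
  (-1) ^+ s * \prod_(i < N) \prod_(j < N | (i < j)%N) (- q%:C) ^+ absz (ainv s l i j).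
Proof.
move=> l0 E; set c := \prod_(i < N) _.
pose p j : int := (nat_of_ord ((s^-1)%g j))%:Z + N%:Z * l j.
(* the constant makes all weights positive, as the site factors require *)
pose v j : int := \sum_i `|p i| + 1 - p j.
have vpos j : 0 < v j.
  have : `|p j| <= \sum_i `|p i| by rewrite (bigD1 j)//= lerDl sumr_ge0.
  by have := ler_norm (p j); rewrite /v; move: (\sum_i `|p i|) `|p j| (p j) => *; lia.
have Hv i j : (i < j)%N -> (0 < ainv s l i j -> v i < v j) /\ (ainv s l i j < 0 -> v j < v i).
  move=> ij; have nij : (s^-1)%g i != (s^-1)%g j :> nat.
    by rewrite (inj_eq val_inj) (inj_eq perm_inj) -val_eqE /= ltn_eqF.
  have hi := ltn_ord ((s^-1)%g i); have hj := ltn_ord ((s^-1)%g j).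
  rewrite /v /ainv !ltrD2l !ltrN2 /p; move: nij hi hj.
  move: ((s^-1)%g i : nat) ((s^-1)%g j : nat) (l i) (l j) => u u' li lj nij hi hj.
  have [d|[d|d]] : li <= lj - 1 \/ (li = lj \/ lj + 1 <= li) by lia.
  - have : N%:Z * li <= N%:Z * (lj - 1) by rewrite ler_wpM2l.
    by split; lia.
  - by rewrite d; split; lia.
  - have : N%:Z * (lj + 1) <= N%:Z * li by rewrite ler_wpM2l.
    by split; lia.
pose G w : C := (\prod_(i < N) \prod_(j < N | (i < j)%N) rho w i j ^ ainv s l i j) *
   \prod_j (1 - b (Y j) * w j ^ (-1))^-1.
have Glead : leads v c G.
  rewrite -[c]mulr1; apply: leadsM.
    by apply: leads_prod => i _; apply: leads_prod => j ij; have [? ?] := Hv i j ij; exact: leads_rho_exprz.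
  have := @leads_prod v _ (index_enum _) xpredT (fun=> 1) (fun j w => (1 - b (Y j) * w j ^ (-1))^-1).
  by rewrite big1//; apply=> j _; exact: leads_geom.
set K : C := (-1) ^+ s * \prod_j - b (Y j).
have IE w : torus r w -> integrand Y Y s l w * exp_factor 0 w =
    (K * c) * \prod_k (w k)^-1 + K * ((\prod_k (w k)^-1) * (G w - c)).
  move=> hw; rewrite exp_factor0 mulr1 integrandE// (l0 : \sum_j l j = 0) expr0z mulr1.
  have -> : \prod_j prod_ext (Y j) (apos Y s l j) (site (w j)) =
     (\prod_j - b (Y j)) * (\prod_k (w k)^-1) * \prod_j (1 - b (Y j) * w j ^ (-1))^-1.
    rewrite -!big_split; apply: eq_bigr => j _ /=; rewrite E prod_ext1 /site exprN1.
    have wj := torus_neq0 j hw; have bw := b_sub_neq0 j (Y j) hw.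
    have -> : b (Y j) - w j = - w j * (1 - b (Y j) * (w j)^-1) by move: wj; move: (w j) (b (Y j)) => x y x0; field.
    by rewrite invfM invrN mulrA mulrN !mulNr.
  rewrite /K /G.
  move: ((-1) ^+ s : C) (\prod_(i < N) _) (\prod_j - b (Y j)) (\prod_k (w k)^-1) (\prod_j _) => x1 x2 x3 x4 x5.
  ring.
have Adeg : degle r v (- (\sum_k v k) - 1) (fun w => K * ((\prod_k (w k)^-1) * (G w - c))).
  apply: degle_Z; apply: degleM Glead.
  rewrite -sumrN; apply: degle_prod => k _.
  by apply: (@eq_approx _ _ _ _ (fun w => w k ^ (-1))) => [w _|]; [rewrite exprN1|apply: degle_Xz; rewrite mulrN1].
have A1 : approx r xpredT (fun w : 'I_N -> C => (K * c) * \prod_k (w k)^-1).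
  apply: (degle_approx (v := v) (m := - \sum_k v k)); apply: degle_Z.
  rewrite -sumrN; apply: degle_prod => k _.
  by apply: (@eq_approx _ _ _ _ (fun w => w k ^ (-1))) => [w _|]; [rewrite exprN1|apply: degle_Xz; rewrite mulrN1].
have -> : coef Y Y s l (exp_factor 0) = K * c * (2%:R * pi%:C * imag_unit) ^+ N.
  rewrite /coef (eq_iter radius_gt0 _ IE); last by apply: approx_coef => //; exact: entire_exp_factor.
  rewrite (iterD radius_gt0 A1 (degle_approx Adeg)) (iter_const radius_gt0).
  by rewrite (iter_vanish radius_gt0 _ Adeg) ?addr0//; lia.
(* the normalisation of the formula cancels the value of the integral of 1 / (w_1 ... w_N) *)
have Z0 : (2%:R * pi%:C * imag_unit : C) ^+ N != 0.
  rewrite expf_neq0// !mulf_neq0 ?pnatr_eq0//; first by rewrite fmorph_eq0 gt_eqF ?pi_gt0.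
  by rewrite eq_complex /= oner_eq0 andbF.
rewrite /prefactor /K.
have PB : (\prod_(k < N) (-1 / b (Y k))) * (\prod_j - b (Y j)) = 1.
  rewrite -big_split big1//= => k _; have b0 := b_neq0 (Y k).
  by move: (b (Y k)) b0 => x x0; field.
move: PB Z0; move: (\prod_(k < N) (-1 / b (Y k))) (\prod_j - b (Y j)) ((-1) ^+ s : C) ((2%:R * pi%:C * imag_unit : C) ^+ N) => x1 x2 x3 x4 PB Z0.
transitivity ((x1 * x2) * (x3 * c) * (x4 / x4)); first by field.
by rewrite PB mul1r divff// mulr1.
Qed.

End Initial.

Section InitialSum.
Variables (Y : {ffun 'I_N -> int}).
Hypotheses (cY : ring_config L Y) (N0 : (0 < N)%N).

Lemma uval_initial_other X : ring_config L X -> X != Y -> uval Y X 0 = 0.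
Proof.
move=> cX XY; rewrite /uval /total big1 ?mulr0// => s _; apply: fsbig1 => l l0.
apply/eqP/negPn/negP => /(coef_initial_nonzero cY cX l0) E.
by move: XY; rewrite (apos_eq_config cY N0 cX l0 E) eqxx.
Qed.

(** The vector l is determined by s, and exists if and only if s^-1 preserves the
classes modulo L. *)
Lemma initial_vector s : let l := [ffun j => ((Y ((s^-1)%g j) - Y j) %/ L)%Z] in
  stab L Y (s^-1)%g -> int_vectors N 0 l /\ forall j, apos Y s l j = Y j.
Proof.
move=> l /forallP st; have Ll j : L%:Z * l j = Y ((s^-1)%g j) - Y j.
  by rewrite ffunE mulrC divzK// -eqz_mod_dvd; exact: st.
have L0 : L%:Z != 0 by rewrite eqz_nat -lt0n.
split; last by move=> j; rewrite /apos Ll opprB addrC subrK.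
apply: (mulfI L0); rewrite mulr0 mulr_sumr; under eq_bigr do rewrite Ll.
by rewrite sumrB [X in X - _](_ : _ = \sum_j Y j) ?subrr// [RHS](reindex_inj (@perm_inj _ (s^-1)%g)).
Qed.

Lemma sum_coef_initial s :
  prefactor Y * \sum_(l \in int_vectors N 0) coef Y Y s l (exp_factor 0) =
  if stab L Y (s^-1)%g then
    (-1) ^+ (s^-1)%g * \prod_(i < N) \prod_(j < N | (i < j)%N)
      (- q%:C) ^+ absz (height_diff L Y ((s^-1)%g i) ((s^-1)%g j) - height_diff L Y i j)%R
  else 0.
Proof.
have L0 : L%:Z != 0 by rewrite eqz_nat -lt0n.
case: ifPn => st; last first.
  rewrite fsbig1 ?mulr0// => l l0; apply/eqP/negPn/negP => /(coef_initial_nonzero cY cY l0) E.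
  case/negP: st; apply/forallP => j; rewrite /same_class eqz_mod_dvd.
  by have := E j; rewrite /apos => /eqP; rewrite subr_eq addrC -subr_eq => /eqP ->; rewrite dvdz_mulr.
have /= [l0 lE] := initial_vector st; set l : {ffun 'I_N -> int} := finfun _ in l0 lE.
rewrite -(fsbig_widen [set l] (int_vectors N 0))/=; first last.
- move=> m [m0 ml]; apply/eqP/negPn/negP => /(coef_initial_nonzero cY cY m0) E; apply: ml.
  apply/ffunP => j; apply: (mulfI L0); have := E j; rewrite -(lE j) /apos.
  by move=> /addrI/oppr_inj.
- by move=> m ->.
rewrite fsbig_set1 coef_initial_value// odd_permV.
congr (_ * _); apply: eq_bigr => i _; apply: eq_bigr => j ij; congr (_ ^+ absz _).
rewrite /ainv /height_diff.
have lij : ((Y ((s^-1)%g i) - Y ((s^-1)%g j)) %/ L)%Z = l i - l j + ((Y i - Y j) %/ L)%Z.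
  rewrite -divzMDl//; congr (_ %/ _)%Z.
  by have := lE i; have := lE j; rewrite /apos => h1 h2; rewrite -[in RHS]h1 -[in RHS]h2; ring.
rewrite lij (ltnNge j i) (ltnW ij) /=; ring.
Qed.

Lemma uval_initial : uval Y Y 0 = (weight L q Y)%:C.
Proof.
rewrite /uval /total mulr_sumr (eq_bigr _ (fun s _ => sum_coef_initial s)) -big_mkcond /=.
rewrite -(config_stab_sum hL hq cY) rmorph_sum /= (reindex_inj (@invg_inj _)) /=.
apply: eq_big => [s|s _]; rewrite invgK//.
rewrite rmorphM rmorph_sign; congr (_ * _); rewrite rmorph_prod; apply: eq_bigr => i _.
rewrite rmorph_prod; apply: eq_bigr => j _.
by rewrite rmorphXn rmorphN.
Qed.

End InitialSum.

End Tazrp.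

(** * Jumps of the chain *)

Section States.
Context {N L : nat}.
Local Notation state := (ring_state N L).
Implicit Types (Z : state) (j : 'I_N).

(** Each jump raises this by 1, so that it separates the states into finite layers. *)
Definition level (x : {ffun 'I_N -> int}) : int := \sum_j x j.

Lemma level_jump x j : level (jump x j) = level x + 1.
Proof.
rewrite /level; under eq_bigr do rewrite ffunE.
rewrite big_split /=; congr (_ + _); rewrite (bigD1 j)//= eqxx big1 ?addr0// => k kj.
by rewrite (negPf kj).
Qed.

Definition jump_targets Z : seq {ffun 'I_N -> int} :=
  [seq jump (val Z) j | j <- enum 'I_N & is_top L (val Z) j].

(** Every target of a jump is a configuration, so the partial injection [insub] loses
nothing here; see [exit_rateE]. *)
Definition neighbours Z : seq state := pmap insub (jump_targets Z).

Lemma jump_inj x : injective (jump x : 'I_N -> _).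
Proof.
move=> i j /ffunP/(_ i); rewrite !ffunE eqxx => /addrI.
by case: eqVneq.
Qed.

Lemma mem_neighbours Z Z' : (Z' \in neighbours Z) = (val Z' \in jump_targets Z).
Proof. exact: mem_pmap_sub. Qed.

Lemma neighboursP Z Z' : reflect (exists2 j, is_top L (val Z) j & val Z' = jump (val Z) j) (Z' \in neighbours Z).
Proof.
rewrite mem_neighbours; apply: (iffP mapP) => -[j]; first by rewrite mem_filter => /andP[? _]; exists j.
by move=> tj E; exists j => //; rewrite mem_filter tj mem_enum.
Qed.

Lemma level_neighbours Z Z' : Z' \in neighbours Z -> level (val Z') = level (val Z) + 1.
Proof. by case/neighboursP => j _ ->; exact: level_jump. Qed.

Lemma neighbours_uniq Z : uniq (neighbours Z).
Proof.
by apply: pmap_sub_uniq; rewrite map_inj_uniq; [exact/filter_uniq/enum_uniq|exact: jump_inj].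
Qed.

Lemma neighbours_irrefl Z : Z \notin neighbours Z.
Proof. by apply/negP => /level_neighbours/eqP; rewrite -{1}[level _]addr0 (inj_eq (addrI _)). Qed.

(** All coordinates of a configuration are within L of each other, so their sum controls
each of them. *)
Lemma finite_levels (lo hi : int) : exists2 F : seq state, uniq F &
  forall Z, (Z \in F) = (lo <= level (val Z) <= hi).
Proof.
pose M := (absz lo + absz hi + N * L)%N.
have fB := @finite_ffun_box N M.
set B := [set l : {ffun 'I_N -> int} | _] in fB.
pose s : seq {ffun 'I_N -> int} := finmap.enum_fset (fset_set B).
exists [seq Z <- pmap insub s : seq state | lo <= level (val Z) <= hi].
  by apply/filter_uniq/pmap_sub_uniq/finmap.fset_uniq.
move=> Z; rewrite mem_filter; apply: andb_idr => /andP[h1 h2].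
rewrite mem_pmap_sub (_ : (val Z \in s) = (val Z \in B)); last exact: (in_fset_set fB).
rewrite inE => j.
have /ring_configP[X1 X2] := valP Z.
have N0 : (0 < N)%N by rewrite (leq_ltn_trans _ (ltn_ord j)).
have near i : val Z i <= val Z j + L%:Z /\ val Z j <= val Z i + L%:Z by [].
have h3 : \sum_(i < N) (val Z j - L%:Z) <= level (val Z).
  by apply: ler_sum => i _; have := near i; lia.
have h4 : level (val Z) <= \sum_(i < N) (val Z j + L%:Z).
  by apply: ler_sum => i _; have := near i; lia.
rewrite sumr_const card_ord -mulr_natl natz mulrBr in h3.
rewrite sumr_const card_ord -mulr_natl natz mulrDr in h4.
have h5 : `|val Z j| <= N%:Z * `|val Z j| by rewrite ler_peMl//; lia.
have h6 : N%:Z * `|val Z j| = `|N%:Z * val Z j| by rewrite normrM.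
have h7 : N%:Z * L%:Z = (N * L)%N%:Z by rewrite PoszM.
move: h1 h2 h3 h4 h5 h6; rewrite h7 /M; move: (N * L)%N (N%:Z * val Z j) (N%:Z * `|val Z j|) (level _) (val Z j) => u x y z v.
lia.
Qed.

End States.

Section RingChain.
Context {R : realType} (N L : nat) (q : R) (a : int -> R).
Hypotheses (hL : (0 < L)%N) (hq : 0 < q < 1) (ha : forall k, 0 < a k)
  (a_periodic : forall k, a (k + L%:Z) = a k).
Local Notation state := (ring_state N L).
Implicit Types (Z : state) (j : 'I_N).

Lemma rate_neighbours Z Z' : Z' \notin neighbours Z -> tazrp_rate q a Z Z' = 0.
Proof.
move=> h; rewrite /tazrp_rate big_pred0// => j; apply: contraNF h => /andP[tj /eqP E].
by apply/neighboursP; exists j.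
Qed.

Lemma jump_rate_ge0 (x : {ffun 'I_N -> int}) (k : int) : 0 <= a k * (1 - q ^+ occupation L x k).
Proof. by case/andP: hq => q0 q1; rewrite mulr_ge0 ?(ltW (ha _))// subr_ge0 exprn_ile1// ltW. Qed.

Lemma tazrp_rate_ge0 Z Z' : 0 <= tazrp_rate q a Z Z'.
Proof. by apply: sumr_ge0 => j _; exact: jump_rate_ge0. Qed.

Lemma tazrp_rate_diag Z : tazrp_rate q a Z Z = 0.
Proof. exact/rate_neighbours/neighbours_irrefl. Qed.

Lemma exit_rateE Z : exit_rate (tazrp_rate q a) neighbours Z =
  \sum_(j | is_top L (val Z) j) a (val Z j) * (1 - q ^+ occupation L (val Z) (val Z j)).
Proof.
pose c j := a (val Z j) * (1 - q ^+ occupation L (val Z) (val Z j)).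
pose f y := \sum_(j | is_top L (val Z) j && (y == jump (val Z) j)) c j.
transitivity (\sum_(y <- map val (neighbours Z)) f y); first by rewrite big_map.
rewrite /neighbours (pmap_filter (insubK _)) (all_filterP _); last first.
  apply/allP => y /mapP[j]; rewrite mem_filter => /andP[tj _] ->.
  by rewrite isSome_insub ring_config_jump//; exact: valP Z.
rewrite big_map big_filter big_enum_cond /=; apply: eq_bigr => j tj.
rewrite /f (big_pred1 j)// => k /=; rewrite (inj_eq (@jump_inj _ _)) eq_sym.
by case: eqVneq => [->|]; rewrite ?tj ?andbF.
Qed.

Lemma exit_rate_le Z (r : R) : (forall k, conductance_b q a k < r) ->
  exit_rate (tazrp_rate q a) neighbours Z <= N%:R * (r / (1 - q)).
Proof.
case/andP: hq => q0 q1 hr; have q2 : 0 < 1 - q by rewrite subr_gt0.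
rewrite exit_rateE; apply: (@le_trans _ _ (\sum_(j < N) r / (1 - q))); last first.
  by rewrite sumr_const card_ord mulr_natl.
rewrite [leRHS](bigID (is_top L (val Z)))/=; apply: ler_wpDr.
  apply: sumr_ge0 => j _; rewrite divr_ge0 ?(ltW q2)// ltW// (lt_trans _ (hr 0))//.
  by rewrite mulr_gt0.
apply: ler_sum => j _; apply: (@le_trans _ _ (a (val Z j) * 1)).
  by rewrite ler_wpM2l ?(ltW (ha _))// gerBl exprn_ge0// ltW.
by rewrite mulr1 ler_pdivlMr// mulrC ltW// hr.
Qed.

End RingChain.

(** * Comparison with the transition function *)

Section Solution.
Context {R : realType} (N L : nat) (q : R) (a : int -> R) (r : R).
Hypotheses (hN : (0 < N)%N) (hL : (0 < L)%N) (hq : 0 < q < 1) (ha : forall k, 0 < a k)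
  (a_periodic : forall k, a (k + L%:Z) = a k) (hr : forall k, conductance_b q a k < r).
Local Notation state := (ring_state N L).
Variable Y : state.
Implicit Types (Z : state) (j : 'I_N).

(** The right-hand side of the claimed formula. *)
Definition candidate Z (t : R) : R[i] := uval L q a r (val Y) (val Z) t / (weight L q (val Z))%:C.

Definition candidate_deriv Z (t : R) : R[i] :=
  u_deriv L q a r (val Y) (val Z) t / (weight L q (val Z))%:C.

Lemma weight_neq0 Z : (weight L q (val Z))%:C != 0 :> R[i].
Proof. by rewrite fmorph_eq0 gt_eqF// weight_gt0. Qed.

Lemma qnum_conductance (n : nat) (k : int) :
  qnum q%:C n * (conductance_b q a k)%:C = (a k * (1 - q ^+ n))%:C.
Proof.
have q1 : 1 - q != 0 by case/andP: hq => _ h; rewrite subr_eq0 gt_eqF.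
have -> : qnum q%:C n = (qnum q n)%:C.
  by rewrite /qnum fmorph_div !rmorphB rmorph1 rmorphXn.
rewrite -rmorphM /qnum /conductance_b; congr (_%:C).
by move: (q ^+ n) (a k) q1 => x y z; field.
Qed.

(** The states from which Z is reached by a jump of j are exactly the result of moving a
bottom particle of Z one step back. *)
Lemma top_jumpP (Z X : state) j :
  (is_top L (val X) j && (val Z == jump (val X) j)) =
  (~~ below L (val Z) j && (val X == unjump (val Z) j)).
Proof.
have cX := valP X; have cZ := valP Z.
apply/andP/andP => [[tj /eqP E]|[bj /eqP E]].
  rewrite E (below_jump hL cX); split=> //; apply/eqP/ffunP => k.
  by rewrite !ffunE addrK.
rewrite E (is_top_unjump hL cZ); split=> //; apply/eqP/ffunP => k.
by rewrite !ffunE subrK.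
Qed.

Lemma exit_rate_bottom Z : exit_rate (tazrp_rate q a) (@neighbours N L) Z =
  \sum_(j | ~~ below L (val Z) j) a (val Z j) * (1 - q ^+ occupation L (val Z) (val Z j)).
Proof.
rewrite exit_rateE//; apply: (top_bottom_sum (phi := fun j => a (val Z j) * _)) => i.
rewrite /below /directly_above => /orP[/andP[_ /eqP ->]//|/and3P[_ _ /eqP ->]].
by rewrite a_periodic (@occupation_same L _ _ _ (val Z i))// /same_class modzDr.
Qed.

(** The weight identity [weight_unjump] converts the rate a (1 - q^n') at the departure
site, n' being its occupation before the jump, into the factor a (1 - q^n) with n the
occupation at the arrival site. *)
Lemma inflow_bottom Z (t : R) (F : seq state) : uniq F ->
  (forall X, X \notin F -> Z \in neighbours X -> candidate X t = 0) ->
  \sum_(X <- F) (tazrp_rate q a X Z)%:C * candidate X t =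
  \sum_(j | ~~ below L (val Z) j)
    (a (val Z j - 1) * (1 - q ^+ occupation L (val Z) (val Z j)))%:C *
    (uval L q a r (val Y) (unjump (val Z) j) t / (weight L q (val Z))%:C).
Proof.
move=> uF HF; have cZ := valP Z.
pose c (X : state) j : R[i] := (a (val X j) * (1 - q ^+ occupation L (val X) (val X j)))%:C.
transitivity (\sum_j \sum_(X <- F | ~~ below L (val Z) j && (val X == unjump (val Z) j)) c X j * candidate X t).
  rewrite (exchange_big_dep xpredT)//=; apply: eq_bigr => X _.
  rewrite /tazrp_rate rmorph_sum /= mulr_suml; apply: eq_bigl => j; exact: top_jumpP.
rewrite [RHS]big_mkcond; apply: eq_bigr => j _; case: (boolP (below L (val Z) j)) => bj /=.
  by rewrite big_pred0.
have cU := ring_config_unjump hL cZ bj; pose U : state := exist _ (unjump (val Z) j) cU.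
have UE : val U = unjump (val Z) j by [].
transitivity (c U j * candidate U t).
  rewrite -UE; under eq_bigl do rewrite (inj_eq val_inj).
  case: (boolP (U \in F)) => UF; first by rewrite -big_filter (filter_pred1_uniq uF UF) big_seq1.
  rewrite HF ?mulr0//.
    by rewrite big_seq_cond big1// => X /andP[XF /eqP XU]; move: UF; rewrite -XU XF.
  by apply/neighboursP; exists j; [exact: is_top_unjump|apply/ffunP => k; rewrite !ffunE subrK].
have H := weight_unjump hL hq (val Z) j; rewrite /= in H.
rewrite /c /candidate UE [unjump (val Z) j j]ffunE eqxx.
have wZ := weight_neq0 Z; have wU := weight_neq0 U; rewrite UE in wU.
have H' := congr1 (fun x => x%:C) H; rewrite !rmorphM /= in H'.
rewrite !rmorphM /= /unjump in H' wU *.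
move: ((weight L q _)%:C) wZ ((weight L q _)%:C) wU ((1 - q ^+ _)%:C) ((1 - q ^+ _)%:C) H'.
move: (uval _ _ _ _ _ _ _) ((a _)%:C) => y z w1 w10 w2 w20 x1 x2 H'.
have -> : x2 = w2 * x1 / w1 by rewrite -H' mulrC mulKf.
by field; rewrite w10 w20.
Qed.

(** States outside F contribute nothing, by hypothesis; the gain terms are
[inflow_bottom] and the loss terms [exit_rate_bottom]. *)
Lemma candidate_forward Z (t : R) (F : seq state) : uniq F ->
  (forall X, X \notin F -> Z \in neighbours X -> candidate X t = 0) ->
  candidate_deriv Z t = \sum_(X <- F) (tazrp_rate q a X Z)%:C * candidate X t
    - (exit_rate (tazrp_rate q a) (@neighbours N L) Z)%:C * candidate Z t.
Proof.
move=> uF HF; rewrite inflow_bottom// exit_rate_bottom rmorph_sum /= mulr_suml -sumrB.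
rewrite /candidate_deriv (u_deriv_forward hL hq ha a_periodic hr (valP Y) hN)//; last exact: valP Z.
rewrite mulr_suml; apply: eq_bigr => j _.
have split_flow (c b1 b2 u1 u2 W c1 c2 : R[i]) : c * b1 = c1 -> c * b2 = c2 ->
    c * (b1 * u1 - b2 * u2) * W = c1 * (u1 * W) - c2 * (u2 * W) by move=> <- <-; ring.
exact: split_flow (qnum_conductance _ _) (qnum_conductance _ _).
Qed.

Lemma candidate_support Z t : candidate Z t != 0 -> level (val Y) <= level (val Z).
Proof.
rewrite mulf_eq0 negb_or => /andP[h _].
exact: (uval_support hL hq ha a_periodic hr (valP Y) (valP Z) h).
Qed.

Lemma candidate_initial Z : candidate Z 0 = (Z == Y)%:R.
Proof.
rewrite /candidate; case: eqVneq => [->|ZY].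
  by rewrite (uval_initial hL hq ha a_periodic hr (valP Y) hN) divff// weight_neq0.
by rewrite (uval_initial_other hL hq ha a_periodic hr (valP Y) hN (valP Z)) ?mul0r// (inj_eq val_inj).
Qed.

(** Uniformity over the finite set F of the bounds required by [duality]. *)
Lemma candidate_regular (F : seq state) (t : R) : exists M : R, forall Z, Z \in F ->
  (forall s, 0 <= s <= t -> `|candidate Z s| <= M%:C) /\
  (forall s h, 0 <= s -> 0 < h <= (2%:R * N%:R * r)^-1 -> s + h <= t ->
     `|candidate Z (s + h) - candidate Z s - h%:C * candidate_deriv Z s| <= (M * h ^+ 2)%:C).
Proof.
elim: F => [|Z F [M HM]]; first by exists 0.
have [K HK] := uval_bounded hL hq ha a_periodic hr (valP Y) hN t (valP Z).
have [K' HK'] := uval_quad_incr hL hq ha a_periodic hr (valP Y) hN t (valP Z).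
pose W := (weight L q (val Z))^-1; have W0 : 0 < W by rewrite invr_gt0 weight_gt0.
have WE : (weight L q (val Z))%:C^-1 = W%:C by rewrite fmorphV.
exists (Num.max M (Num.max (K * W) (K' * W))) => Z'; rewrite inE => /predU1P[->|ZF].
  rewrite /candidate /candidate_deriv WE; split=> [s hs|s h s0 h0 st].
    rewrite normrM [`|W%:C|]ger0_norm ?ler0c ?(ltW W0)//. apply: (@le_trans _ _ (K * W)%:C).
      by rewrite rmorphM /= ler_wpM2r ?ler0c ?(ltW W0)//; exact: HK.
    by rewrite lecR !le_max lexx orbT.
  rewrite mulrA -!mulrBl normrM [`|W%:C|]ger0_norm ?ler0c ?(ltW W0)//; apply: (@le_trans _ _ (K' * W * h ^+ 2)%:C).
    by rewrite mulrAC rmorphM /= ler_wpM2r ?ler0c ?(ltW W0)//; exact: HK'.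
  by rewrite lecR ler_wpM2r ?sqr_ge0// !le_max lexx !orbT.
have [H1 H2] := HM Z' ZF; split=> [s hs|s h s0 h0 st].
  by apply: (le_trans (H1 s hs)); rewrite lecR le_max lexx.
by apply: (le_trans (H2 s h s0 h0 st)); rewrite lecR ler_wpM2r ?sqr_ge0// le_max lexx.
Qed.

(** [duality] on the states with level between those of X and Y. A path leaving this set
upwards cannot return to X, and the formula vanishes below the level of Y. *)
Lemma transition_candidate (p : R -> state -> state -> R) (X : state) (t : R) : 0 <= t ->
  transition_function p -> has_jump_rates (tazrp_rate q a) p ->
  (p t Y X)%:C = candidate X t.
Proof.
move=> t0 tp jr.
pose lo := Order.min (level (val X)) (level (val Y)).
pose hi := Order.max (level (val X)) (level (val Y)).
have [F uF memF] := @finite_levels N L lo hi.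
have FX : X \in F by rewrite memF ge_min le_max !lexx.
have FY : Y \in F by rewrite memF ge_min le_max !lexx !orbT.
have r0 : 0 < r by rewrite (lt_trans _ (hr 0))// mulr_gt0// subr_gt0; case/andP: hq.
have [M HM] := candidate_regular F t.
have d0 : 0 < (2%:R * N%:R * r)^-1 by rewrite invr_gt0 !mulr_gt0// ltr0n.
have stay : forall y x s, y \in F -> x \in neighbours y -> x \notin F -> 0 <= s -> p s x X = 0.
  move=> y x s; rewrite !memF => /andP[y1 y2] xy xF s0.
  have lx := level_neighbours xy.
  have hx : level (val X) < level (val x).
    apply: (@le_lt_trans _ _ hi); first by rewrite le_max lexx.
    by rewrite ltNge; apply: contra xF => xh; rewrite xh andbT (le_trans y1)// lx lerDl.
  pose D : pred state := fun Z => level (val X) < level (val Z).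
  have D_exit Z : D Z -> exit_rate (tazrp_rate q a) (@neighbours N L) Z <= N%:R * (r / (1 - q)).
    by move=> _; exact: exit_rate_le.
  have D_closed Z Z' : D Z -> Z' \in neighbours Z -> D Z'.
    by rewrite /D => h /level_neighbours ->; rewrite (lt_trans h)// ltrDl.
  have DX : ~~ D X by rewrite /D ltxx.
  exact: (transition_unreachable tp jr (@neighbours_uniq N L) (@neighbours_irrefl N L) (@rate_neighbours _ N L q a)
    (tazrp_rate_ge0 hq ha) D_exit D_closed DX s0 hx).
have forward y s : y \in F -> candidate_deriv y s = \sum_(x <- F) (tazrp_rate q a x y)%:C * candidate x s
    - (exit_rate (tazrp_rate q a) (@neighbours N L) y)%:C * candidate y s.
  move=> yF; apply: candidate_forward => // x xF /level_neighbours yx.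
  apply/eqP/negPn/negP => /candidate_support xY.
  case/negP: xF; move: yF; rewrite !memF => /andP[y1 y2].
  have lo_le : lo <= level (val Y) by rewrite ge_min lexx orbT.
  by rewrite (le_trans lo_le xY) (le_trans _ y2)// yx lerDl.
have := duality tp jr (@neighbours_uniq N L) (@neighbours_irrefl N L) (@rate_neighbours _ N L q a)
  (tazrp_rate_ge0 hq ha) (v := candidate) (v' := candidate_deriv) uF t0 d0 (@tazrp_rate_diag _ N L q a) stay
  forward (fun y s yF => (HM y yF).1 s) (fun y s h yF => (HM y yF).2 s h).
have p0 x y : p 0 x y = (x == y)%:R by case: tp.
rewrite (bigD1_seq X)//= p0 eqxx mulr1 big1 ?addr0 => [|Z ZX]; last by rewrite p0 (negPf ZX) mulr0.
rewrite (bigD1_seq Y)//= candidate_initial eqxx mul1r big1 ?addr0 => [->//|Z ZY].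
by rewrite candidate_initial (negPf ZY) mul0r.
Qed.

End Solution.

(** The one-time marginals, from the two-time distributions at 0 and t since the chain
starts from y almost surely. *)
Lemma probability_transition (R : realType) (T : countType) (rate : T -> T -> R) (y x : T)
    (d : measure_display) (Omega : measurableType d) (P : probability Omega R)
    (xi : R -> Omega -> T) (t : R) : 0 <= t -> is_markov_chain rate y P xi ->
  exists2 p, transition_function p /\ has_jump_rates rate p &
    fine (P [set o | xi t o = x]) = p t y x.
Proof.
move=> t0 [mxi [p [tp jr fdd]]]; exists p => //.
pose B := [set o | xi 0 o = y]; pose A := [set o | xi t o = x].
have mA : measurable A by exact: mxi.
have mB : measurable B by exact: mxi.
have PB : P B = 1%E.
  have := fdd 0%N (fun=> 0) (fun=> y) erefl (fun=> lexx _).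
  rewrite eqxx big_ord0 mulr1 => <-; congr (P _); apply/seteqP; split=> o /= h; [move=> k _; exact: h|exact: (h 0%N)].
have PAB : P (A `&` B) = (p t y x)%:E.
  pose s k : R := if k is 0%N then 0 else t.
  have s_le k : s k <= s k.+1 by case: k.
  have := fdd 1%N s (fun k => if k is 0%N then y else x) erefl s_le.
  rewrite big_ord_recl big_ord0 eqxx mul1r mulr1 /= subr0 => <- ; congr (P _); apply/seteqP.
  split=> [w [hA hB] [|[|k]]|w h] //; split; [exact: (h 1%N)|exact: (h 0%N)].
have PD : P (A `\` B) = 0%E.
  apply/eqP; rewrite eq_le measure_ge0 andbT.
  have -> : 0%E = P (~` B) :> \bar R by rewrite probability_setC// PB subee.
  by apply: le_measure; rewrite ?inE; [exact: measurableD|exact: measurableC|exact: subDsetr].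
have -> : P [set o | xi t o = x] = (P (A `\` B) + P (A `&` B))%E by exact: measureDI.
by rewrite PD add0e PAB.
Qed.

Theorem theorem3 (R : realType) (N L : nat) (q : R) (a : int -> R) (r : R)
    (hN : (1 <= N)%N) (hL : (1 <= L)%N) (hq : 0 < q < 1)
    (ha : forall k, 0 < a k) (a_periodic : forall k, a (k + L%:Z) = a k)
    (hr : forall k, conductance_b q a k < r)
    (X Y : ring_state N L) (t : R) (ht : 0 <= t)
    (d : measure_display) (Omega : measurableType d) (P : probability Omega R)
    (xi : R -> Omega -> ring_state N L)
    (hxi : is_markov_chain (tazrp_rate q a) Y P xi) :
  finite_set [set l | int_vectors N 0 l /\
                      u_term L q a r (val Y) (val X) t l != 0] /\
  (fine (P [set o | xi t o = X]))%:C =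
    u_total L q a r (val Y) (val X) t / (weight L q (val X))%:C.
Proof.
have cX := valP X; have cY := valP Y; split.
  apply: sub_finite_set (finite_bounded_vectors (vector_bound (val Y) (val X))) => l /= [l0 nz].
  exact: (u_term_support hL hq ha a_periodic hr cY cX l0 nz).
have [p [tp jr] ->] := probability_transition X ht hxi.
rewrite (transition_candidate hN hL hq ha a_periodic hr Y X ht tp jr).
by rewrite /candidate (u_totalE hL hq ha a_periodic hr cY t cX).
Qed.
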